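(* Let $N\ge 3$, let $\Omega\subset\mathbb{R}^N$ be a bounded domain with $\partial\Omega\in C^2$, let $\lambda,\kappa>0$, and let $J$ and $\mathcal{M}$ be the functional and the Nehari-type manifold defined in the context. If $u\in\mathcal{M}$ is a locally Lipschitz continuous minimizer of the restriction $J|_{\mathcal{M}}$ (that is, $J(u)=\inf_{\mathcal{M}}J$), then $u$ is nondegenerate: there exist constants $r_0,c>0$ such that if $x_0\in\{u>1\}$ and $r:=\operatorname{dist}(x_0,\{u\le 1\})\le r_0$, then $u(x_0)\ge 1+c\,r$.
   Context: Here $2^\ast=2N/(N-2)$, $t_\pm=\max\{\pm t,0\}$, and $\chi_A$ is the characteristic function of a set $A$. The functional is $$J(u)=\int_\Omega\left[\tfrac12|\nabla u|^2+\chi_{\{u>1\}}(x)-\tfrac{\lambda}{2}(u-1)_+^2-\tfrac{\kappa}{2^\ast}(u-1)_+^{2^\ast}\right]dx,\quad u\in H^1_0(\Omega),$$ and the Nehari-type manifold is $$\mathcal{M}=\left\{u\in H^1_0(\Omega):\int_{\{u>1\}}\left[|\nabla u|^2-\lambda(u-1)^2\right]dx=\kappa\int_{\{u>1\}}(u-1)^{2^\ast}dx>0\right\}.$$ (These are associated with the free boundary problem $-\Delta u=\lambda(u-1)_++\kappa(u-1)_+^{2^\ast-1}$ in $\Omega\setminus\partial\{u>1\}$, $|\nabla u^+|^2-|\nabla u^-|^2=2$ on $\partial\{u>1\}$, $u=0$ on $\partial\Omega$, where $\nabla u^\pm$ are the limits of $\nabla u$ from $\{u>1\}$ and from the interior of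 $\{u\le1\}$, respectively.) *)

(* Defs.v *)
From HB Require Import structures.
From mathcomp Require Import all_boot all_order all_algebra.
From mathcomp Require Import all_classical all_reals all_analysis.

Set Implicit Arguments.
Unset Strict Implicit.
Unset Printing Implicit Defensive.

Import Order.TTheory GRing.Theory Num.Theory.
Import numFieldNormedType.Exports.

Local Open Scope classical_set_scope.
Local Open Scope ring_scope.

(* R^n is 'rV[R]_n, with the sigma-algebra generated by the coordinates, that
   is, the Borel sigma-algebra. *)
Definition rV_display : measure_display. Proof. exact. Qed.

Section measurable_rV.
Context {R : realType} {n : nat}.

Let coors : 'I_n -> 'rV[R]_n -> R := fun i x => x 0 i.

Let rV_set0 : g_sigma_preimage coors set0.
Proof. exact: sigma_algebra0. Qed.

Let rV_setC A : g_sigma_preimage coors A -> g_sigma_preimage coors (~` A).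
Proof. exact: sigma_algebraC. Qed.

Let rV_bigcup (F : (set 'rV[R]_n)^nat) :
  (forall i, g_sigma_preimage coors (F i)) ->
  g_sigma_preimage coors (\bigcup_i (F i)).
Proof. exact: sigma_algebra_bigcup. Qed.

HB.instance Definition _ := @isMeasurable.Build rV_display
  'rV[R]_n (g_sigma_preimage coors) rV_set0 rV_setC rV_bigcup.

Lemma measurable_coord (i : 'I_n) :
  measurable_fun [set: 'rV[R]_n] (fun x : 'rV[R]_n => x 0 i).
Proof.
move=> _ Y mY; rewrite setTI; apply: sub_sigma_algebra => /=.
rewrite -bigcup_seq/=; exists i => /=; first by rewrite mem_index_enum.
by exists Y => //; rewrite setTI.
Qed.

Lemma measurable_fun_coordP d (T : measurableType d) (f : T -> 'rV[R]_n) :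
  (forall i, measurable_fun [set: T] (fun t => f t 0 i)) ->
  measurable_fun [set: T] f.
Proof.
move=> mf; suff H : g_sigma_preimage (fun i => coors i \o f) `<=` measurable.
  move=> _ A mA; apply: H; rewrite g_sigma_preimage_comp; by exists A.
apply: smallest_sub; first exact: sigma_algebra_measurable.
by rewrite -bigcup_seq => A [i _ [B mB <-]]; exact: mf.
Qed.

End measurable_rV.

Section lebesgue_rV.
Context {R : realType}.

Definition rV_cons n (p : measurableTypeR R * 'rV[R]_n) : 'rV[R]_n.+1 :=
  \row_i oapp (p.2 0) p.1 (unlift ord0 i).

Definition rV_uncons n (x : 'rV[R]_n.+1) :
    measurableTypeR R * 'rV[R]_n :=
  (x 0 ord0, \row_j x 0 (lift ord0 j)).

Lemma rV_consK n : cancel (@rV_cons n) (@rV_uncons n).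
Proof.
move=> [a y]; congr pair; first by rewrite mxE unlift_none.
by apply/rowP => j; rewrite !mxE liftK.
Qed.

Lemma measurable_rV_cons n :
  measurable_fun [set: (measurableTypeR R * 'rV[R]_n)%type] (@rV_cons n).
Proof.
apply: measurable_fun_coordP => i; rewrite /rV_cons.
case: (unliftP ord0 i) => [j ->|->].
- under eq_fun do rewrite mxE liftK /=.
  by apply: (measurableT_comp (measurable_coord j)); exact: measurable_snd.
- under eq_fun do rewrite mxE unlift_none /=.
  exact: measurable_fst.
Qed.

Lemma measurable_rV_uncons n :
  measurable_fun [set: 'rV[R]_n.+1] (@rV_uncons n).
Proof.
apply: measurable_fun_pair; first exact: measurable_coord.
apply: measurable_fun_coordP => j.
under eq_fun do rewrite mxE.
exact: measurable_coord.
Qed.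

Section step.
Variables (n : nat) (mu : {sigma_finite_measure set 'rV[R]_n -> \bar R}).

Definition rV_step : set 'rV[R]_n.+1 -> \bar R :=
  pushforward (@lebesgue_measure R \x mu)%E (@rV_cons n).

HB.instance Definition _ := Measure.copy rV_step
  (measure_function_pushforward__canonical__measure_function_Measure
    (@lebesgue_measure R \x mu)%E (@measurable_rV_cons n)).

Let rV_step_sigma_finite : sigma_finite [set: 'rV[R]_n.+1] rV_step.
Proof.
have /sigma_finiteP[F [UF ndF Foo]] := sigma_finiteT (@lebesgue_measure R).
have /sigma_finiteP[G [UG ndG Goo]] := sigma_finiteT mu.
exists (fun k => @rV_uncons n @^-1` (F k `*` G k)).
  apply/seteqP; split=> // x _.
  have [k _ Fk] : (\bigcup_k F k) (rV_uncons x).1 by rewrite -UF.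
  have [l _ Gl] : (\bigcup_k G k) (rV_uncons x).2 by rewrite -UG.
  exists (maxn k l) => //; split.
  - by move: Fk; apply/subsetPset/ndF/leq_maxl.
  - by move: Gl; apply/subsetPset/ndG/leq_maxr.
move=> k; have [mF Fk] := Foo k; have [mG Gk] := Goo k.
have mFG : measurable (F k `*` G k) by exact: measurableX.
split; first by rewrite -[X in measurable X]setTI; exact: measurable_rV_uncons.
rewrite /rV_step /pushforward -comp_preimage (_ : _ \o _ = id); last first.
  by apply/funext => p; exact: rV_consK.
by rewrite preimage_id product_measure1E// lte_mul_pinfty// ge0_fin_numE.
Qed.

HB.instance Definition _ := @Measure_isSigmaFinite.Build _ _ _ rV_step
  rV_step_sigma_finite.

End step.

(* Lebesgue measure on R^n: the n-fold product of the one on R. *)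
Fixpoint lebesgue_rV n : {sigma_finite_measure set 'rV[R]_n -> \bar R} :=
  if n is n'.+1 then rV_step (lebesgue_rV n') else \d_(0 : 'rV[R]_0).

Lemma lebesgue_rV_box n (A : 'I_n -> set R) : (forall i, measurable (A i)) ->
  lebesgue_rV n [set x | forall i, A i (x 0 i)] =
  (\prod_(i < n) lebesgue_measure (A i))%E.
Proof.
elim: n A => [|n IHn] A mA.
  by rewrite big_ord0 /= diracE mem_set// => -[].
have mbox : measurable [set x : 'rV[R]_n | forall i, A (lift ord0 i) (x 0 i)].
  rewrite (_ : [set x | _] =
    \big[setI/setT]_(i < n) [set x : 'rV[R]_n | A (lift ord0 i) (x 0 i)]).
    apply: bigsetI_measurable => i _; rewrite -[X in measurable X]setTI.
    exact: (measurable_coord i) (mA (lift ord0 i)).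
  rewrite -bigcap_seq; apply/seteqP; split=> x /= Ax i.
    by move=> _; exact: Ax.
  by apply: Ax; rewrite /= mem_index_enum.
rewrite big_ord_recl -IHn; last by move=> i; exact: mA.
rewrite -product_measure1E//; last exact: mA.
rewrite [lebesgue_rV _]/= /rV_step /pushforward; congr (product_measure1 _ _ _).
apply/seteqP; split=> -[a y] /=.
  move=> Ax; split=> [|i]; first by have := Ax ord0; rewrite mxE unlift_none.
  by have := Ax (lift ord0 i); rewrite mxE liftK.
move=> [Aa Ay] i; rewrite mxE.
by case: (unliftP ord0 i) => [j ->|->];
  rewrite ?liftK ?unlift_none; [exact: Ay|exact: Aa].
Qed.

End lebesgue_rV.

Section calculus.
Context {R : realType} {n : nat}.
Implicit Types (f : 'rV[R]_n -> R) (Omega : set 'rV[R]_n).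

Definition partial (i : 'I_n) f : 'rV[R]_n -> R := 'D_(delta_mx 0 i) f.

Fixpoint Ck (k : nat) f : Prop :=
  continuous f /\
  if k is k'.+1 then
    forall i, (forall x, derivable f x (delta_mx 0 i)) /\ Ck k' (partial i f)
  else True.

Definition smooth f := forall k, Ck k f.

Definition test_function Omega f :=
  [/\ smooth f, compact (closure [set x | f x != 0]) &
      closure [set x | f x != 0] `<=` Omega].

(* The norm of the library on 'rV[R]_n is the maximum norm. *)
Definition eucl_norm (x : 'rV[R]_n) : R := Num.sqrt (\sum_i x 0 i ^+ 2).

Definition eucl_dist (x : 'rV[R]_n) (A : set 'rV[R]_n) : R :=
  inf [set eucl_norm (x - y) | y in A].

End calculus.

Definition bounded_domain (R : realType) n (Omega : set 'rV[R]_n) :=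
  [/\ open Omega, connected Omega, Omega !=set0 & bounded_set Omega].

(* Near each boundary point, Omega is the region strictly on one side of the
   graph of a C^2 function expressing one coordinate in terms of the others;
   the sign (-1)^b chooses the side. *)
Definition C2_boundary (R : realType) n (Omega : set 'rV[R]_n) :=
  forall p, (closure Omega `\` interior Omega) p ->
  exists (i : 'I_n) (b : bool) (gamma : 'rV[R]_n.-1 -> R),
    Ck 2 gamma /\
    \forall x \near p, Omega x <-> gamma (col' i x) < (-1) ^+ b * x 0 i.

Section sobolev.
Context {R : realType} {n : nat}.
Variable Omega : set 'rV[R]_n.
Implicit Types (u : 'rV[R]_n -> R) (g : 'rV[R]_n -> 'rV[R]_n).

Local Notation mu := (lebesgue_rV n).

Definition L2 u := measurable_fun Omega u /\
  (\int[mu]_(x in Omega) ((u x ^+ 2)%:E) < +oo)%E.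

Definition is_weak_gradient u g := forall i : 'I_n,
  L2 (fun x => g x 0 i) /\
  forall phi, test_function Omega phi ->
    (\int[mu]_(x in Omega) ((u x * partial i phi x)%:E) =
     - \int[mu]_(x in Omega) ((g x 0 i * phi x)%:E))%E.

(* Functions are not identified almost everywhere: only the values on Omega of
   an element of H^1(Omega) matter, and its gradient is some representative of
   the weak gradient, which is unique up to a null set. *)
Definition H1 u := L2 u /\ exists g, is_weak_gradient u g.

Definition grad u : 'rV[R]_n -> 'rV[R]_n :=
  xget (fun=> 0) [set g | is_weak_gradient u g].

Definition grad2 u (x : 'rV[R]_n) : R := eucl_norm (grad u x) ^+ 2.

Definition H10 u := H1 u /\
  exists phi : nat -> 'rV[R]_n -> R,
    [/\ forall k, test_function Omega (phi k),
        (\int[mu]_(x in Omega) (((u x - phi k x) ^+ 2)%:E))%E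
          @[k --> \oo] --> 0%E &
        forall i : 'I_n,
        (\int[mu]_(x in Omega) (((grad u x 0 i - partial i (phi k) x) ^+ 2)%:E))%E
          @[k --> \oo] --> 0%E].

End sobolev.

(* The critical Sobolev exponent 2^*. *)
Definition crit (R : realType) (N : nat) : R := 2 * N%:R / (N%:R - 2).

Section functional.
Context {R : realType} {N : nat}.
Variables (Omega : set 'rV[R]_N) (lambda kappa : R).
Implicit Types u : 'rV[R]_N -> R.

Local Notation mu := (lebesgue_rV N).
Local Notation p := (crit R N).

Definition pos_part (t : R) : R := Num.max t 0.

Definition above1 u : set 'rV[R]_N := [set x | Omega x /\ 1 < u x].

Definition below1 u : set 'rV[R]_N := [set x | Omega x /\ u x <= 1].

Definition J u : \bar R :=
  (\int[mu]_(x in Omega)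
    ((2^-1 * grad2 Omega u x + \1_(above1 u) x
      - lambda / 2 * pos_part (u x - 1) ^+ 2
      - kappa / p * pos_part (u x - 1) `^ p)%R%:E))%E.

Definition Nehari u :=
  [/\ H10 Omega u,
      (\int[mu]_(x in above1 u)
         ((grad2 Omega u x - lambda * (u x - 1) ^+ 2)%R%:E) =
       kappa%:E * \int[mu]_(x in above1 u) (((u x - 1) `^ p)%R%:E))%E &
      (0 < kappa%:E * \int[mu]_(x in above1 u) (((u x - 1) `^ p)%R%:E))%E].

End functional.

(* Main.v *)
Require Import Defs.
From mathcomp Require Import all_boot all_order all_algebra.
From mathcomp Require Import all_classical all_reals all_analysis.
From mathcomp Require Import measurable_realfun ring lra.

(** Put [v = (u - 1)_+] and let [p] be the critical exponent. For [psi <= v], the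
    function [min (u, 1) + s (v - psi)] belongs to the Nehari manifold for a
    suitable [s], and minimality bounds the measure of the part of [{u > 1}] where
    [psi = v] by the loss of energy.

    For [psi = - e * phi] with [phi >= 0] this shows that
    [- Laplacian v >= lambda v + kappa v^(p-1)] weakly in [{u > 1}]. Hence [v] is
    superharmonic there: its mean over a ball is controlled by its value at the
    centre, and its truncations satisfy a Caccioppoli inequality.

    Let the ball of radius [rho] around [x0] be contained in [{u > 1}], and suppose
    that [v x0 < alpha rho]. Take [psi = zeta * T v], with [zeta] a cutoff and [T v]
    a smooth truncation of [v] at height [m = K v x0]. For large [K] the set where
    [psi = v] has measure at least [c rho^N], whereas the loss of energy is at most
    [C m^2 rho^(N-2) <= C K^2 alpha^2 rho^N], a contradiction if [alpha] is small.

    Finally the ball with the distance to [{u <= 1}] as its radius does not leave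
    [Omega]: near a boundary point inside it, [u > 1] on [Omega], which is
    incompatible with the zero boundary values of [u]. *)

Set Implicit Arguments.
Unset Strict Implicit.
Unset Printing Implicit Defensive.

Import Order.TTheory GRing.Theory Num.Theory.
Import numFieldNormedType.Exports.

Local Open Scope classical_set_scope.
Local Open Scope ring_scope.

(** * Borel sets and Lebesgue measure on [R^n] *)

Section borel_rV.
Context {R : realType} {n : nat}.
Implicit Types (a b c x : 'rV[R]_n) (e : R).

(** The gain in measure is of order [rho^N], whereas Cauchy-Schwarz against the global energy bounds
    the first-order term [dot (g x) (h x)] only by a multiple of [m * rho^((N-2)/2)]. That term is
    therefore removed by its sign: the supersolution inequality trades it for the integral of
    [v^(p-1) * psi], and only quantities of order [m^2] survive.

    No Lagrange multiplier is available, since the measure term of [J] jumps. The scaling [s] takes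
    its place: the constraint fixes [s^(p-2)] as a quotient of two integrals, and [s^2/2 - s^p/p] is
    largest at [s = 1], so that only the deviations of these integrals from their common value at
    [u] matter.

    Functions and gradients are honest pointwise functions. Instead of the almost everywhere
    statement that a gradient vanishes on a level set, the cutoffs are built so that the gradients
    of [psi] and [v] agree at every point where [psi = v].

    Balls of the maximum norm are cubes. Volumes and cutoffs use cubes, the Laplacian uses Euclidean
    balls, and [sig = rho / (2 * N)] passes from one to the other. *)

Definition obox a b : set 'rV[R]_n :=
  [set x | forall i, a 0 i < x 0 i < b 0 i].

Lemma measurable_pi_set (A : 'I_n -> set R) : (forall i, measurable (A i)) ->
  measurable [set x : 'rV[R]_n | forall i, A i (x 0 i)].
Proof.
move=> mA; rewrite (_ : [set x | _] =
    \big[setI/setT]_(i < n) [set x : 'rV[R]_n | A i (x 0 i)]).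
  apply: bigsetI_measurable => i _; rewrite -[X in measurable X]setTI.
  exact: (measurable_coord i) (mA i).
rewrite -bigcap_seq; apply/seteqP; split=> x /= Ax i.
  by move=> _; exact: Ax.
by apply: Ax; rewrite /= mem_index_enum.
Qed.

Lemma oboxE a b :
  obox a b = [set x | forall i, [set` `]a 0 i, b 0 i[] (x 0 i)].
Proof.
by apply/seteqP; split=> x /= Hx i; have := Hx i; rewrite in_itv.
Qed.

Lemma measurable_obox a b : measurable (obox a b).
Proof.
rewrite oboxE.
exact: (measurable_pi_set (A := fun i => [set` `]a 0 i, b 0 i[])).
Qed.

Lemma norm_coord_le x i : `|x 0 i| <= `|x|.
Proof.
have /mapP[k Hk E] : `|x 0 i| \in [seq `|x y.1 y.2| | y : 'I_1 * 'I_n].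
  by apply/mapP; exists (0, i) => //=; rewrite mem_enum.
by rewrite [leRHS]/Num.norm /= mx_normrE E; apply/bigmax_geP; right => /=; exists k.
Qed.

Lemma rV_ballE c e : 0 < e ->
  ball c e = [set x | forall i, `|x 0 i - c 0 i| < e].
Proof.
move=> e0; apply/seteqP; split=> x.
  by move=> [_ H] i /=; have := H 0 i; rewrite /ball/= distrC.
by move=> H; split=> // i j; rewrite !ord1 /ball/= distrC; exact: H.
Qed.

Lemma ball_obox c e : 0 < e ->
  ball c e = obox (c - const_mx e) (c + const_mx e).
Proof.
move=> e0; rewrite rV_ballE//; apply/seteqP; split=> x /= H i;
  by have := H i; rewrite !mxE ltr_distl.
Qed.

(** Balls of the maximum norm are cubes, so rational centres and radii give countably many boxes.
    This ties the sigma-algebra generated by the coordinates to the topology. *)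
Lemma open_bigcup_obox (A : set 'rV[R]_n) : open A ->
  A = \bigcup_(q in [set q : 'rV[rat]_n * rat | 0 < ratr q.2 :> R /\
       ball (map_mx ratr q.1 : 'rV[R]_n) (ratr q.2) `<=` A])
       ball (map_mx ratr q.1 : 'rV[R]_n) (ratr q.2).
Proof.
move=> oA; apply/seteqP; split=> [x Ax|x [q [_ +]]]; last by apply.
have /nbhs_ballP[e /= e0 xe] := open_nbhs_nbhs (conj oA Ax).
have e20 : 0 < e / 2 by rewrite divr_gt0.
have [r] := rat_in_itvoo e20; rewrite in_itv/= => /andP[r0 re].
have H i : exists q : rat, `|x 0 i - ratr q| < ratr r.
  have : x 0 i - ratr r < x 0 i + ratr r by lra.
  by move/rat_in_itvoo => [q]; rewrite in_itv/= => H; exists q; rewrite ltr_distlC; lra.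
have [q Hq] := choice H.
exists (\row_i q i, r) => /=; last by rewrite rV_ballE//= => i; rewrite !mxE.
split=> // y; rewrite !rV_ballE//= => Hy; apply: xe; rewrite rV_ballE//= => i.
have := Hq i; have := Hy i; rewrite !mxE => h1 h2.
have := ler_distD (ratr (q i)) (y 0 i) (x 0 i).
by rewrite (distrC (ratr _)); lra.
Qed.

Lemma rV_open_measurable (A : set 'rV[R]_n) : open A -> measurable A.
Proof.
move=> oA; rewrite (open_bigcup_obox oA).
(* The index type is countable: [unpickle] turns the union into one over [nat]. *)
have -> : forall (P : set ('rV[rat]_n * rat)) (F : _ -> set 'rV[R]_n),
   \bigcup_(q in P) F q =
   \bigcup_k (if unpickle k is Some q then if `[< P q >] then F q else set0
      else set0).
  move=> P F; apply/seteqP; split=> x.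
    move=> [q Pq Fq]; exists (pickle q) => //.
    by rewrite pickleK asboolT.
  move=> [k _]; case: unpickle => // q; case: ifPn => // /asboolP Pq Fq.
  by exists q.
apply: bigcup_measurable => k _; case: unpickle => // q; case: ifPn => // /asboolP.
by move=> /= [q0 _]; rewrite ball_obox//; exact: measurable_obox.
Qed.

Lemma rV_closed_measurable (A : set 'rV[R]_n) : closed A -> measurable A.
Proof.
by move=> /closed_openC/rV_open_measurable/measurableC; rewrite setCK.
Qed.

Lemma rV_continuous_measurable (D : set 'rV[R]_n) (f : 'rV[R]_n -> R) :
  open D -> (forall x, D x -> {for x, continuous f}) -> measurable_fun D f.
Proof.
move=> oD cf; apply: (measurability _ (RGenOpens.measurableE R)).
move=> _ [_ [a [b ->] <-]]; apply: rV_open_measurable.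
rewrite openE => x [Dx fx]; apply: filterI; first exact: open_nbhs_nbhs.
by apply: (cf x Dx); apply: open_nbhs_nbhs; split=> //; exact: interval_open.
Qed.

Lemma rV_continuous_measurableT (f : 'rV[R]_n -> R) (D : set 'rV[R]_n) :
  continuous f -> measurable_fun D f.
Proof.
move=> cf; apply: measurable_funTS.
by apply: (rV_continuous_measurable (D := setT)) => [|x _]; [exact: openT|exact: cf].
Qed.

Lemma lebesgue_obox a b : (forall i, a 0 i <= b 0 i) ->
  lebesgue_rV n (obox a b) = (\prod_(i < n) (b 0 i - a 0 i))%:E.
Proof.
move=> ab; rewrite oboxE.
rewrite (lebesgue_rV_box (A := fun i => [set` `]a 0 i, b 0 i[]))//.
rewrite -prodEFin; apply: eq_bigr => i _.
rewrite lebesgue_measure_itv/= lte_fin; case: ltP => [_|ba].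
  by rewrite EFinB.
by rewrite (le_anti (introT andP (conj ba (ab i)))) subrr.
Qed.

Lemma lebesgue_ball c e : 0 < e -> lebesgue_rV n (ball c e) = ((e *+ 2) ^+ n)%:E.
Proof.
move=> e0; rewrite ball_obox// lebesgue_obox; last by move=> i; rewrite !mxE; lra.
congr (_%:E); rewrite -[X in _ ^+ X]card_ord -prodr_const; apply: eq_bigr => i _.
by rewrite !mxE; lra.
Qed.

Lemma bounded_finite_measure (A : set 'rV[R]_n) : measurable A -> bounded_set A ->
  (lebesgue_rV n A < +oo)%E.
Proof.
move=> mA [M [_ HM]].
have M0 : 0 < `|M| + 1 by rewrite ltr_wpDl.
apply: (@le_lt_trans _ _ (lebesgue_rV n (ball (0 : 'rV[R]_n) (`|M| + 2)))).
  apply: le_measure; rewrite ?inE//.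
    by apply: rV_open_measurable; exact: ball_open.
  move=> x Ax; rewrite mx_norm_ball /ball_ /=.
  rewrite distrC subr0.
  apply: (@le_lt_trans _ _ (`|M| + 1)); last lra.
  by apply: (HM (`|M| + 1)) => //; rewrite (le_lt_trans (ler_norm _))// ltrDl.
by rewrite lebesgue_ball ?ltry// (lt_le_trans M0)//; lra.
Qed.

End borel_rV.

(** * Smooth functions *)

Section smooth1.
Context {R : realType}.
Implicit Types (f g : R -> R) (p : {poly R}) (x : R).

(** Counterpart of [Ck] on [R], which is not a type of row vectors; the outer functions of
    compositions live here. *)
Fixpoint Ck1 (k : nat) f : Prop :=
  continuous f /\
  if k is k'.+1 then (forall x, derivable f x 1) /\ Ck1 k' (derive1 f) else True.

Definition smooth1 f := forall k, Ck1 k f.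

Lemma is_derive1_continuous f x (d : R) : is_derive x 1 f d ->
  {for x, continuous f}.
Proof.
by move=> fd; apply/differentiable_continuous/derivable1_diffP/ex_derive.
Qed.

Lemma is_derive_val f g x (d e : R) : is_derive x 1 f d -> f = g -> d = e ->
  is_derive x 1 g e.
Proof. by move=> ? <- <-. Qed.

Lemma Ck1S k f g : (forall x, is_derive x 1 f (g x)) -> Ck1 k g ->
  Ck1 k.+1 f.
Proof.
move=> fg cg; split; first by move=> x; exact: (is_derive1_continuous (fg x)).
split; first by move=> x; exact: ex_derive.
suff -> : (derive1 f) = g by [].
by apply/funext => x; rewrite derive1E; apply: derive_val.
Qed.

Lemma Ck1_continuous k f : Ck1 k f -> continuous f.
Proof. by case: k => [|k] []. Qed.

Lemma Ck1SP k f : Ck1 k.+1 f -> exists g,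
  (forall x, is_derive x 1 f (g x)) /\ Ck1 k g.
Proof.
move=> [_ [df cf]]; exists (derive1 f); split=> // x.
by rewrite derive1E; apply: DeriveDef.
Qed.

Lemma Ck1W k f : Ck1 k.+1 f -> Ck1 k f.
Proof.
elim: k f => [|k IH] f; first by case.
move=> [cf [df c']]; split=> //; split=> //; exact: IH.
Qed.

Lemma Ck1_cst k (c : R) : Ck1 k (fun=> c).
Proof.
elim: k c => [|k IH] c; first by split=> // x; exact: cvg_cst.
by apply: (@Ck1S _ _ (fun=> 0)).
Qed.

Lemma Ck1_id k : Ck1 k (fun x => x).
Proof.
case: k => [|k]; first by split=> // x.
by apply: (@Ck1S _ _ (fun=> 1)); exact: Ck1_cst.
Qed.

Lemma Ck1D k f g : Ck1 k f -> Ck1 k g -> Ck1 k (fun x => f x + g x).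
Proof.
elim: k f g => [|k IH] f g.
  by move=> [cf _] [cg _]; split=> // x; apply: cvgD; [exact: cf|exact: cg].
move=> /Ck1SP[f' [df cf]] /Ck1SP[g' [dg cg]].
by apply: (@Ck1S _ _ (fun x => f' x + g' x)); exact: IH.
Qed.

Lemma Ck1M k f g : Ck1 k f -> Ck1 k g -> Ck1 k (fun x => f x * g x).
Proof.
elim: k f g => [|k IH] f g.
  by move=> [cf _] [cg _]; split=> // x; apply: cvgM; [exact: cf|exact: cg].
move=> fS gS; have [f' [df cf]] := Ck1SP fS; have [g' [dg cg]] := Ck1SP gS.
apply: (@Ck1S _ _ (fun x => f x * g' x + g x * f' x)).
by apply: Ck1D; apply: IH => //; exact: Ck1W.
Qed.

Lemma Ck1_comp k f g : Ck1 k f -> Ck1 k g -> Ck1 k (fun x => f (g x)).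
Proof.
elim: k f g => [|k IH] f g.
  move=> [cf _] [cg _]; split=> // x; apply: continuous_comp; [exact: cg|exact: cf].
move=> /Ck1SP[f' [df cf]] gS; have [g' [dg cg]] := Ck1SP gS.
apply: (@Ck1S _ _ (fun x => f' (g x) * g' x)).
by apply: Ck1M => //; apply: IH => //; exact: Ck1W.
Qed.

Lemma is_derive1V f x (d : R) : f x != 0 -> is_derive x 1 f d ->
  is_derive x 1 (fun y => (f y)^-1) (- (d * ((f x)^-1 * (f x)^-1))).
Proof.
move=> fx0 [df <-]; apply: DeriveDef; first exact: derivableV.
rewrite deriveV// /GRing.scale/= mulNr mulrC; congr (- (_ * _)).
by rewrite expr2 invfM.
Qed.

Lemma Ck1V k f : (forall x, f x != 0) -> Ck1 k f -> Ck1 k (fun x => (f x)^-1).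
Proof.
move=> f0; elim: k => [|k IH].
  by move=> [cf _]; split=> // x; apply: cvgV => //; exact: cf.
move=> fS; have [f' [df cf]] := Ck1SP fS; have fk := IH (Ck1W fS).
apply: (@Ck1S _ _ (fun x => -1 * (f' x * ((f x)^-1 * (f x)^-1)))) => [x|].
  by rewrite mulN1r; exact: is_derive1V.
by apply: Ck1M; [exact: Ck1_cst|apply: Ck1M => //; exact: Ck1M].
Qed.

Lemma smooth1_derive f : smooth1 f ->
  (forall x, is_derive x 1 f ((derive1 f) x)) /\ smooth1 (derive1 f).
Proof.
move=> sf; split; last by move=> k; have [_ []] := sf k.+1.
by move=> x; have [_ [df _]] := sf 1%N; rewrite derive1E; exact: DeriveDef.
Qed.

Lemma smooth1_continuous f : smooth1 f -> continuous f.
Proof. by move=> /(_ 0%N)[]. Qed.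

Lemma smooth1_bounded f (a b : R) (c d : R) : continuous f ->
  (forall x, x <= a -> f x = c) -> (forall x, b <= x -> f x = d) ->
  exists M, forall x, `|f x| <= M.
Proof.
move=> cf fa fb; have [ab|ba] := leP a b; last first.
  exists `|c|; move=> x; have [xa|ax] := leP x a; first by rewrite fa.
  by rewrite (fb x) ?(ltW (lt_trans ba ax))// -(fb a (ltW ba)) fa.
have cnf : {within `[a, b], continuous (fun x => `|f x|)}.
  apply: continuous_subspaceT => x; apply: continuous_comp; first exact: cf.
  exact: norm_continuous.
have [m _ Hm] := EVT_max ab cnf.
exists (Num.max `|f m| (Num.max `|c| `|d|)) => x.
have [xa|ax] := leP x a; first by rewrite fa// !le_max lexx orbT.
have [bx|xb] := leP b x; first by rewrite fb// !le_max lexx !orbT.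
by rewrite le_max Hm// in_itv/= !ltW.
Qed.

(** With an arbitrary polynomial in [1/x] as factor, the family is closed under derivation, so that
    smoothness at [0] is a single induction on the order. *)
Definition flat p x := if 0 < x then p.[x^-1] * expR (- x^-1) else 0.

(** Monomial by monomial, from [y^i <= i! * exp y]. *)
Lemma poly_expR_bounded p :
  exists2 C, 0 <= C & forall y, 0 <= y -> `|p.[y] * expR (- y)| <= C.
Proof.
exists (\sum_(i < size p) `|p`_i| * (i`!)%:R).
  by apply: sumr_ge0 => i _; rewrite mulr_ge0.
move=> y y0; rewrite horner_coef mulr_suml.
apply: le_trans (ler_norm_sum _ _ _) _; apply: ler_sum => i _.
rewrite normrM normrM -mulrA ler_wpM2l//.
rewrite ger0_norm ?exprn_ge0// ger0_norm ?expR_ge0// expRN.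
rewrite ler_pdivrMr ?expR_gt0//.
have fi : 0 < (i`!)%:R :> R by rewrite ltr0n fact_gt0.
rewrite mulrC -ler_pdivrMr//; case: (val i : nat) => [|j].
  by rewrite expr0 fact0 divr1 -expR0 ler_expR.
by apply: le_trans (expR_ge1Dxn j y0); rewrite lerDr.
Qed.

Lemma flat_quadratic p : exists C, forall x, `|flat p x| <= C * x ^+ 2.
Proof.
have [C C0 HC] := poly_expR_bounded ('X ^+ 2 * p); exists C => x.
rewrite /flat; case: ifPn => [x0|_]; last by rewrite normr0 mulr_ge0// sqr_ge0.
have := HC x^-1; rewrite invr_ge0 (ltW x0) => /(_ isT).
rewrite hornerM hornerXn -mulrA normrM exprVn ger0_norm ?invr_ge0 ?sqr_ge0//.
by rewrite mulrC ler_pdivrMr// exprn_gt0.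
Qed.

Lemma is_derive_quadratic f (C : R) : (forall x, `|f x| <= C * x ^+ 2) ->
  is_derive (0 : R) (1 : R) f 0.
Proof.
move=> H; have f0 : f 0 = 0.
  by apply/normr0_eq0/le_anti; rewrite normr_ge0 andbT (le_trans (H 0))// expr0n mulr0.
suff L : h^-1 *: ((f \o shift 0) (h *: 1) - f 0) @[h --> 0^'] --> (0 : R).
  apply: DeriveDef; first by apply/cvg_ex; exists 0.
  exact: cvg_lim L.
apply/cvgr0Pnorm_le => e e0.
near=> h.
have h0 : h != 0 by near: h; exact: nbhs_dnbhs_neq.
rewrite /= /GRing.scale/= mulr1 addr0 f0 subr0 normrM normfV ler_pdivrMl ?normr_gt0//.
apply: (le_trans (H h)); rewrite -real_normK ?num_real// expr2 mulrA mulrC ler_wpM2l//.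
have : `|h| <= e / (`|C| + 1).
  near: h; apply: dnbhs0_le; rewrite divr_gt0//.
rewrite ler_pdivlMr ?ltr_wpDl// => he.
have := ler_norm C; have := normr_ge0 h; nra.
Unshelve. all: by end_near. Qed.

Lemma is_derive_flat p x :
  is_derive x 1 (flat p) (flat ('X ^+ 2 * (p - p^`())) x).
Proof.
have [x0|x0|->] := ltgtP x 0.
- rewrite {2}/flat ltNge (ltW x0)/=.
  apply: (@near_eq_is_derive _ _ _ (cst 0)).
  near=> y; rewrite /flat ltNge ltW//; near: y; exact: lt_nbhsl.
- rewrite {2}/flat x0.
  have xn0 : x != 0 by rewrite gt_eqF.
  have dV := is_derive1V xn0 (is_derive_id x (1 : R)).
  have dp := @is_derive1_comp _ (horner p) (fun y => y^-1) x _ _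
    (is_derive_poly p x^-1) dV.
  have dN := is_deriveN dV.
  have dE := @is_derive1_comp _ expR (fun y => - y^-1) x _ _
    (is_derive_expR _) dN.
  have N : \forall y \near x, (((horner p) \o (fun y => y^-1)) *
      (expR \o (fun y => - y^-1))) y = flat p y.
    near=> y; rewrite /flat ifT//; near: y; exact: lt_nbhsr.
  apply: is_derive_val (near_eq_is_derive N (is_deriveM dp dE)) _ _ => //.
  rewrite /GRing.scale/= !(hornerM, hornerXn, hornerX, hornerD, hornerN).
  by rewrite /comp; ring.
- rewrite {2}/flat ltxx; have [C HC] := flat_quadratic p.
  exact: is_derive_quadratic HC.
Unshelve. all: by end_near. Qed.

Lemma smooth1_flat p : smooth1 (flat p).
Proof.
move=> k; elim: k p => [|k IH] p.
  by split=> // x; exact: is_derive1_continuous (is_derive_flat p x).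
by apply: Ck1S (is_derive_flat p) _.
Qed.

End smooth1.

(** * Smooth functions of several variables *)

Section smooth_rV.
Context {R : realType} {n : nat}.
Implicit Types (f g : 'rV[R]_n -> R) (x v : 'rV[R]_n) (i j : 'I_n).

Local Notation e_ i := (delta_mx 0 i : 'rV[R]_n).

Lemma rV_continuous_cst (c : R) : continuous (fun _ : 'rV[R]_n => c).
Proof. by move=> x; exact: cst_continuous. Qed.

Lemma rV_continuousD f g : continuous f -> continuous g ->
  continuous (fun x => f x + g x).
Proof. by move=> cf cg x; apply: continuousD; [exact: cf|exact: cg]. Qed.

Lemma rV_continuousM f g : continuous f -> continuous g ->
  continuous (fun x => f x * g x).
Proof. by move=> cf cg x; apply: continuousM; [exact: cf|exact: cg]. Qed.

Lemma rV_continuous_comp1 (T : R -> R) f : continuous T -> continuous f ->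
  continuous (fun x => T (f x)).
Proof. by move=> cT cf x; apply: continuous_comp; [exact: cf|exact: cT]. Qed.

(** Restriction to a line reduces directional derivatives to one variable, where the chain rule is
    available. *)
Lemma is_derive_lineP f x v (d : R) :
  is_derive x v f d <-> is_derive (0 : R) (1 : R) (fun h : R => f (h *: v + x)) d.
Proof.
have E : (fun h : R => h^-1 *: ((f \o shift x) (h *: v) - f x)) =
  (fun h : R => h^-1 *: (((fun h : R => f (h *: v + x)) \o shift 0) (h *: 1)
      - f (0 *: v + x))).
  by apply/funext => h /=; rewrite !addr0 scale0r add0r /GRing.scale/= mulr1.
split=> -[fd <-].
  apply: DeriveDef; first exact: (derivable1P f x v).1.
  by rewrite /derive E.
apply: DeriveDef; first exact: (derivable1P f x v).2.
by rewrite /derive E.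
Qed.

Lemma is_derive_comp1 (T : R -> R) f x v (d e : R) :
  is_derive (f x) (1 : R) T d -> is_derive x v f e ->
  is_derive x v (fun y => T (f y)) (d * e).
Proof.
move=> dT /is_derive_lineP df; apply/is_derive_lineP.
apply: (@is_derive1_comp _ T (fun h : R => f (h *: v + x)) 0 d e) => //.
by rewrite scale0r add0r.
Qed.

Lemma is_derive_near_line f x v (d : R) (g : R -> R) :
  (forall h, f (h *: v + x) = g h) -> is_derive (0 : R) (1 : R) g d ->
  is_derive x v f d.
Proof.
move=> fg dg; apply/is_derive_lineP.
by rewrite (_ : (fun _ => _) = g)//; apply/funext.
Qed.

Lemma CkS k f (g : 'I_n -> 'rV[R]_n -> R) : continuous f ->
  (forall i x, is_derive x (e_ i) f (g i x)) -> (forall i, Ck k (g i)) ->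
  Ck k.+1 f.
Proof.
move=> cf fg cg; split=> // i; split; first by move=> x; exact: ex_derive.
suff -> : partial i f = g i by [].
by apply/funext => x; apply: derive_val.
Qed.

Lemma CkSP k f : Ck k.+1 f -> continuous f /\
  forall i, (forall x, is_derive x (e_ i) f (partial i f x)) /\ Ck k (partial i f).
Proof.
move=> [cf df]; split=> // i; have [di ci] := df i; split=> // x.
Qed.

Lemma Ck_continuous k f : Ck k f -> continuous f.
Proof. by case: k => [|k] []. Qed.

Lemma CkW k f : Ck k.+1 f -> Ck k f.
Proof.
elim: k f => [|k IH] f; first by case.
move=> [cf df]; split=> // i; have [di ci] := df i; split=> //; exact: IH.
Qed.

Lemma Ck_cst k (c : R) : Ck k (fun _ : 'rV[R]_n => c).
Proof.
elim: k c => [|k IH] c; first by split=> //; exact: rV_continuous_cst.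
apply: (@CkS _ _ (fun _ _ => 0)) ; first exact: rV_continuous_cst.
by move=> i; exact: IH.
Qed.

Lemma is_derive_coord i x v : is_derive x v (fun y : 'rV[R]_n => y 0 i) (v 0 i).
Proof.
apply: (@is_derive_near_line _ _ _ _ (fun h => h * v 0 i + x 0 i)).
  by move=> h; rewrite !mxE.
apply: is_derive_val (is_deriveD (is_deriveM (is_derive_id _ _)
  (is_derive_cst (v 0 i) _ _)) (is_derive_cst (x 0 i) _ _)) _ _ => //.
by rewrite /GRing.scale/= mul0r add0r mulr1 addr0.
Qed.

Lemma Ck_coord k i : Ck k (fun y : 'rV[R]_n => y 0 i).
Proof.
case: k => [|k]; first by split=> // x; exact: coord_continuous.
apply: (@CkS _ _ (fun j _ => (e_ j) 0 i)).
- by move=> x; exact: coord_continuous.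
- by move=> j x; exact: is_derive_coord.
- by move=> j; exact: Ck_cst.
Qed.

Lemma CkD k f g : Ck k f -> Ck k g -> Ck k (fun x => f x + g x).
Proof.
elim: k f g => [|k IH] f g.
  by move=> [cf _] [cg _]; split=> //; exact: rV_continuousD.
move=> /CkSP[cf df] /CkSP[cg dg].
apply: (@CkS _ _ (fun i x => partial i f x + partial i g x)).
- exact: rV_continuousD.
- by move=> i x; apply: is_deriveD; [exact: (df i).1|exact: (dg i).1].
- by move=> i; apply: IH; [exact: (df i).2|exact: (dg i).2].
Qed.

Lemma CkM k f g : Ck k f -> Ck k g -> Ck k (fun x => f x * g x).
Proof.
elim: k f g => [|k IH] f g.
  by move=> [cf _] [cg _]; split=> //; exact: rV_continuousM.
move=> fS gS; have [cf df] := CkSP fS; have [cg dg] := CkSP gS.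
apply: (@CkS _ _ (fun i x => f x * partial i g x + g x * partial i f x)).
- exact: rV_continuousM.
- by move=> i x; apply: is_deriveM; [exact: (df i).1|exact: (dg i).1].
- move=> i; apply: CkD; apply: IH; try exact: CkW.
    exact: (dg i).2.
  exact: (df i).2.
Qed.

Lemma Ck_comp1 k (T : R -> R) f : Ck1 k T -> Ck k f -> Ck k (fun x => T (f x)).
Proof.
elim: k T f => [|k IH] T f.
  by move=> [cT _] [cf _]; split=> //; exact: rV_continuous_comp1.
move=> TS fS; have [T' [dT cT]] := Ck1SP TS; have [cf df] := CkSP fS.
apply: (@CkS _ _ (fun i x => T' (f x) * partial i f x)).
- exact: rV_continuous_comp1 (Ck1_continuous TS) cf.
- by move=> i x; apply: (is_derive_comp1 (dT (f x)) ((df i).1 x)).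
- by move=> i; apply: CkM; [apply: IH => //; exact: CkW|exact: (df i).2].
Qed.

Lemma smooth_cst (c : R) : smooth (fun _ : 'rV[R]_n => c).
Proof. by move=> k; exact: Ck_cst. Qed.

Lemma smooth_coord i : smooth (fun y : 'rV[R]_n => y 0 i).
Proof. by move=> k; exact: Ck_coord. Qed.

Lemma smoothD f g : smooth f -> smooth g -> smooth (fun x => f x + g x).
Proof. by move=> sf sg k; exact: CkD. Qed.

Lemma smoothM f g : smooth f -> smooth g -> smooth (fun x => f x * g x).
Proof. by move=> sf sg k; exact: CkM. Qed.

Lemma smooth_comp1 (T : R -> R) f : smooth1 T -> smooth f ->
  smooth (fun x => T (f x)).
Proof. by move=> sT sf k; exact: Ck_comp1. Qed.

Lemma smooth_sum (I : Type) (r : seq I) (F : I -> 'rV[R]_n -> R) :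
  (forall k, smooth (F k)) -> smooth (fun x => \sum_(i <- r) F i x).
Proof.
move=> sF; elim: r => [|i r IH].
  under eq_fun do rewrite big_nil; exact: smooth_cst.
by under eq_fun do rewrite big_cons; exact: smoothD.
Qed.

Lemma smooth_prod (I : Type) (r : seq I) (F : I -> 'rV[R]_n -> R) :
  (forall k, smooth (F k)) -> smooth (fun x => \prod_(i <- r) F i x).
Proof.
move=> sF; elim: r => [|i r IH].
  under eq_fun do rewrite big_nil; exact: smooth_cst.
by under eq_fun do rewrite big_cons; exact: smoothM.
Qed.

Lemma smooth_continuous f : smooth f -> continuous f.
Proof. by move=> /(_ 0%N)[]. Qed.

Lemma smooth_partial f i : smooth f -> smooth (partial i f).
Proof. by move=> sf k; have [_ /(_ i)[]] := CkSP (sf k.+1). Qed.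

Lemma smooth_is_derive f i x : smooth f -> is_derive x (e_ i) f (partial i f x).
Proof. by move=> sf; have [_ /(_ i)[]] := CkSP (sf 1%N). Qed.

Lemma partialE f i x (d : R) : is_derive x (e_ i) f d -> partial i f x = d.
Proof. by move=> ?; exact: derive_val. Qed.

Lemma partialM f g i x : smooth f -> smooth g ->
  partial i (fun x => f x * g x) x = f x * partial i g x + g x * partial i f x.
Proof.
by move=> sf sg; apply/partialE/is_deriveM; exact: smooth_is_derive.
Qed.

Lemma partial_comp1 (T : R -> R) f i x : smooth1 T -> smooth f ->
  partial i (fun x => T (f x)) x = derive1 T (f x) * partial i f x.
Proof.
move=> sT sf; apply/partialE/is_derive_comp1; last exact: smooth_is_derive.
exact: (smooth1_derive sT).1.
Qed.

Lemma partial_out f i x : (\forall y \near x, f y = 0) -> partial i f x = 0.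
Proof.
move=> fx; apply: partialE.
apply: (@near_eq_is_derive _ _ _ (cst 0)).
by near=> y; rewrite /cst; apply/esym; near: y.
Unshelve. all: by end_near. Qed.

End smooth_rV.

(** * Test functions and their supports *)

Section test_functions.
Context {R : realType} {n : nat}.
Implicit Types (f g : 'rV[R]_n -> R) (x v : 'rV[R]_n) (i j : 'I_n).
Implicit Types (Omega : set 'rV[R]_n).

Local Notation supp f := (closure [set x | f x != 0]).

Lemma supp_out f x : ~ supp f x -> \forall y \near x, f y = 0.
Proof.
move=> nx; have : open (~` supp f) by apply/closed_openC/closed_closure.
rewrite openE => /(_ x nx); apply: filterS => y /= ny.
by apply/eqP/negPn/negP => fy; apply: ny; exact: subset_closure.
Qed.

Lemma supp_out0 f x : ~ supp f x -> f x = 0.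
Proof. by move=> /supp_out/nbhs_singleton. Qed.

Lemma supp_sub f (K : set 'rV[R]_n) : closed K -> (forall x, ~ K x -> f x = 0) ->
  supp f `<=` K.
Proof.
move=> cK H; rewrite [X in _ `<=` X](closure_id K).1//; apply: closure_subset => x /= fx.
by apply: contrapT => /H f0; rewrite f0 eqxx in fx.
Qed.

Lemma test_function_supp Omega f (K : set 'rV[R]_n) : smooth f -> compact K ->
  K `<=` Omega -> (forall x, ~ K x -> f x = 0) -> test_function Omega f.
Proof.
move=> sf cK KO H; have clK : closed K by exact: compact_closed.
have S := supp_sub clK H; split=> //; last exact: subset_trans S KO.
by apply: subclosed_compact cK S; exact: closed_closure.
Qed.

Lemma test_function_sub Omega Omega' f : Omega `<=` Omega' ->
  test_function Omega f -> test_function Omega' f.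
Proof. by move=> OO [sf cf fO]; split=> //; exact: subset_trans fO OO. Qed.

Lemma test_function_out Omega f x : test_function Omega f -> ~ Omega x -> f x = 0.
Proof. by move=> [_ _ fO] nx; apply: supp_out0 => /fO. Qed.

Lemma test_function_partial Omega f i : test_function Omega f ->
  test_function Omega (partial i f).
Proof.
move=> [sf cf fO]; apply: (test_function_supp (K := supp f)) => //.
  exact: smooth_partial.
by move=> x nx; apply: partial_out; exact: supp_out.
Qed.

Lemma test_function_mul Omega f g : test_function Omega f -> smooth g ->
  test_function Omega (fun x => f x * g x).
Proof.
move=> [sf cf fO] sg; apply: (test_function_supp (K := supp f)) => //.
  exact: smoothM.
by move=> x nx; rewrite supp_out0// mul0r.
Qed.

Lemma test_function_add Omega f g : test_function Omega f ->
  test_function Omega g -> test_function Omega (fun x => f x + g x).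
Proof.
move=> [sf cf fO] [sg cg gO].
apply: (test_function_supp (K := supp f `|` supp g)) => //.
- exact: smoothD.
- exact: compactU.
- by move=> x [/fO|/gO].
- by move=> x /not_orP[nf ng]; rewrite !supp_out0// addr0.
Qed.

Lemma test_function_comp1 Omega (T : R -> R) f : smooth1 T -> T 0 = 0 ->
  test_function Omega f -> test_function Omega (fun x => T (f x)).
Proof.
move=> sT T0 [sf cf fO]; apply: (test_function_supp (K := supp f)) => //.
  exact: smooth_comp1.
by move=> x nx; rewrite supp_out0.
Qed.

Lemma test_function_bounded Omega f : test_function Omega f ->
  exists M, forall x, `|f x| <= M.
Proof.
move=> [sf cf fO]; have cfK : compact (f @` supp f).
  apply: continuous_compact => //; apply: continuous_subspaceT.
  exact: smooth_continuous.
have [M [_ HM]] := compact_bounded cfK.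
exists (`|M| + 1) => x; have [sx|/supp_out0 ->] := pselect (supp f x).
  by apply: (HM (`|M| + 1)); [rewrite (le_lt_trans (ler_norm M))// ltrDl|exists x].
by rewrite normr0 addr_ge0.
Qed.

End test_functions.

(** * Cutoff functions *)

Section cutoff1.
Context {R : realType}.
Implicit Types (x y t : R).

Lemma smooth1_cst (c : R) : smooth1 (fun=> c).
Proof. by move=> k; exact: Ck1_cst. Qed.

Lemma smooth1_id : smooth1 (fun x : R => x).
Proof. by move=> k; exact: Ck1_id. Qed.

Lemma smooth1D (f g : R -> R) : smooth1 f -> smooth1 g ->
  smooth1 (fun x => f x + g x).
Proof. by move=> sf sg k; exact: Ck1D. Qed.

Lemma smooth1M (f g : R -> R) : smooth1 f -> smooth1 g ->
  smooth1 (fun x => f x * g x).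
Proof. by move=> sf sg k; exact: Ck1M. Qed.

Lemma smooth1_comp (f g : R -> R) : smooth1 f -> smooth1 g ->
  smooth1 (fun x => f (g x)).
Proof. by move=> sf sg k; exact: Ck1_comp. Qed.

Lemma smooth1_affine (a b : R) : smooth1 (fun x => a * x + b).
Proof.
apply: smooth1D; last exact: smooth1_cst.
by apply: smooth1M; [exact: smooth1_cst|exact: smooth1_id].
Qed.

Lemma smooth1_ext (f g : R -> R) : f =1 g -> smooth1 f -> smooth1 g.
Proof. by move=> /funext ->. Qed.

Definition flat1 : R -> R := flat 1.

Lemma flat1E x : 0 < x -> flat1 x = expR (- x^-1).
Proof. by move=> x0; rewrite /flat1 /flat x0 hornerC mul1r. Qed.

Lemma flat1_le0 x : x <= 0 -> flat1 x = 0.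
Proof. by move=> x0; rewrite /flat1 /flat ltNge x0. Qed.

Lemma flat1_gt0 x : 0 < x -> 0 < flat1 x.
Proof. by move=> x0; rewrite flat1E// expR_gt0. Qed.

Lemma flat1_ge0 x : 0 <= flat1 x.
Proof. by have [/flat1_le0 ->|/flat1_gt0/ltW] := leP x 0. Qed.

Lemma smooth1_flat1 : smooth1 flat1.
Proof. exact: smooth1_flat. Qed.

Lemma is_derive_flat1 x : is_derive x 1 flat1 (flat ('X ^+ 2) x).
Proof.
apply: is_derive_val (is_derive_flat 1 x) _ _ => //.
by rewrite derivC subr0 mulr1.
Qed.

Definition step x : R := flat1 (2 - x) / (flat1 (2 - x) + flat1 (x - 1)).

Lemma step_den_gt0 x : 0 < flat1 (2 - x) + flat1 (x - 1).
Proof.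
have [x2|x2] := ltP x 2.
  by rewrite ltr_wpDr ?flat1_ge0// flat1_gt0// subr_gt0.
by rewrite ltr_wpDl ?flat1_ge0// flat1_gt0// subr_gt0; lra.
Qed.

Lemma smooth1_step : smooth1 step.
Proof.
have s1 : smooth1 (fun x => flat1 (2 - x)).
  apply: (smooth1_comp smooth1_flat1).
  by apply: (smooth1_ext _ (smooth1_affine (-1) 2)) => x; rewrite mulN1r addrC.
have s2 : smooth1 (fun x => flat1 (x - 1)).
  apply: (smooth1_comp smooth1_flat1).
  by apply: (smooth1_ext _ (smooth1_affine 1 (-1))) => x; rewrite mul1r.
apply: smooth1M => // k; apply: Ck1V; last exact: (smooth1D s1 s2).
by move=> x; rewrite gt_eqF// step_den_gt0.
Qed.

Lemma step_le1 x : x <= 1 -> step x = 1.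
Proof.
move=> x1; rewrite /step (flat1_le0 (x := x - 1)) ?subr_le0// addr0 divff//.
by rewrite gt_eqF// flat1_gt0//; lra.
Qed.

Lemma step_ge2 x : 2 <= x -> step x = 0.
Proof. by move=> x2; rewrite /step flat1_le0 ?subr_le0// mul0r. Qed.

Lemma step_ge0 x : 0 <= step x.
Proof. by rewrite divr_ge0 ?flat1_ge0// ltW// step_den_gt0. Qed.

(** The strictness matters: it is how [local_decrement] deduces from [psi x = v x] that [v x] lies
    below the truncation height. *)
Lemma step_lt1 x : 1 < x -> step x < 1.
Proof.
move=> x1; rewrite ltr_pdivrMr ?step_den_gt0// mul1r ltrDl flat1_gt0//; lra.
Qed.

Lemma step_bound x : step x <= 1.
Proof. by have [/step_le1 ->//|/step_lt1/ltW] := leP x 1. Qed.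

(* [m * rise (t / m)] tends to the positive part of [t] as [m] goes to [0]. *)
Definition rise x : R := x * (1 - step x).
(** The truncation of the overview, up to [rescale]. It returns to [0] instead of staying constant,
    so that [psi] vanishes where [v >= 2 * m] and [v^(p-1) * psi] is bounded by a power of [m]. *)
Definition hump x : R := x * step x.

Lemma smooth1_hump : smooth1 hump.
Proof. exact: smooth1M smooth1_id smooth1_step. Qed.

Lemma smooth1_rise : smooth1 rise.
Proof.
apply: (smooth1_ext _ (smooth1D smooth1_id
  (smooth1M (smooth1_cst (-1)) smooth1_hump))) => x.
by rewrite /rise /hump; ring.
Qed.

Lemma rise_le1 x : x <= 1 -> rise x = 0.
Proof. by move=> x1; rewrite /rise step_le1// subrr mulr0. Qed.

Lemma rise_ge2 x : 2 <= x -> rise x = x.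
Proof. by move=> x1; rewrite /rise step_ge2// subr0 mulr1. Qed.

Lemma hump_le1 x : x <= 1 -> hump x = x.
Proof. by move=> x1; rewrite /hump step_le1// mulr1. Qed.

Lemma hump_ge2 x : 2 <= x -> hump x = 0.
Proof. by move=> x1; rewrite /hump step_ge2// mulr0. Qed.

Lemma derive1_near (f : R -> R) x (c d : R) :
  (\forall y \near x, f y = c * y + d) -> derive1 f x = c.
Proof.
move=> fx; rewrite derive1E.
rewrite (near_eq_derive (g := fun y => c * y + d))//.
apply: derive_val; apply: is_derive_val (is_deriveD (is_deriveM
  (is_derive_cst c _ _) (is_derive_id _ _)) (is_derive_cst d _ _)) _ _ => //.
by rewrite /GRing.scale/= mulr0 !addr0 mulr1.
Qed.

Lemma derive1_lt (f : R -> R) (a c d : R) : (forall y, y <= a -> f y = c * y + d) ->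
  forall x, x < a -> derive1 f x = c.
Proof.
move=> fa x xa; apply: (derive1_near (d := d)); near=> y; apply: fa.
by apply: ltW; near: y; exact: lt_nbhsl.
Unshelve. all: by end_near. Qed.

Lemma derive1_gt (f : R -> R) (a c d : R) : (forall y, a <= y -> f y = c * y + d) ->
  forall x, a < x -> derive1 f x = c.
Proof.
move=> fa x xa; apply: (derive1_near (d := d)); near=> y; apply: fa.
by apply: ltW; near: y; exact: lt_nbhsr.
Unshelve. all: by end_near. Qed.

Lemma continuous_eq_lt (f : R -> R) (a c : R) : continuous f ->
  (forall x, x < a -> f x = c) -> f a = c.
Proof.
move=> cf fc; apply/eqP/negPn/negP => fac.
have d0 : 0 < `|f a - c| by rewrite normr_gt0 subr_eq0.
have /cvgrPdist_lt/(_ _ d0)/nbhs_ballP[e /= e0 He] := cf a.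
have := He (a - e / 2); rewrite /ball/= opprB addrC subrK.
rewrite ger0_norm; last lra.
rewrite (fc (a - e / 2)); last lra.
by rewrite ltxx => H; have : false by apply: H; lra.
Qed.

Lemma derive1_hump_le1 x : x <= 1 -> derive1 hump x = 1.
Proof.
have H : forall x, x < 1 -> derive1 hump x = 1.
  apply: (derive1_lt (d := 0)) => y y1.
  by rewrite hump_le1// mul1r addr0.
rewrite le_eqVlt => /predU1P[->|]; last exact: H.
exact: (continuous_eq_lt (smooth1_continuous (smooth1_derive smooth1_hump).2)).
Qed.

Lemma derive1_hump_gt2 x : 2 < x -> derive1 hump x = 0.
Proof.
apply: (derive1_gt (d := 0)) => y y2.
by rewrite hump_ge2// mul0r addr0.
Qed.

Lemma derive1_rise_lt1 x : x < 1 -> derive1 rise x = 0.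
Proof.
apply: (derive1_lt (d := 0)) => y y1.
by rewrite rise_le1// mul0r addr0.
Qed.

Lemma derive1_rise_gt2 x : 2 < x -> derive1 rise x = 1.
Proof.
apply: (derive1_gt (d := 0)) => y y2.
by rewrite rise_ge2// mul1r addr0.
Qed.

Lemma smooth1_derive1_bounded (f : R -> R) (a b c d c' d' : R) : smooth1 f ->
  (forall y, y <= a -> f y = c * y + d) -> (forall y, b <= y -> f y = c' * y + d') ->
  exists M, forall x, `|derive1 f x| <= M.
Proof.
move=> sf fa fb.
apply: (smooth1_bounded (a := a - 1) (b := b + 1) (c := c) (d := c')).
- exact: (smooth1_continuous (smooth1_derive sf).2).
- by move=> x xa; apply: (derive1_lt fa); lra.
- by move=> x xb; apply: (derive1_gt fb); lra.
Qed.

Lemma smooth1_derive2_bounded (f : R -> R) (a b c d c' d' : R) : smooth1 f ->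
  (forall y, y <= a -> f y = c * y + d) -> (forall y, b <= y -> f y = c' * y + d') ->
  exists M, forall x, `|derive1 (derive1 f) x| <= M.
Proof.
move=> sf fa fb; apply: (smooth1_derive1_bounded (a := a - 1) (b := b + 1)
  (c := 0) (d := c) (c' := 0) (d' := c')).
- exact: (smooth1_derive sf).2.
- by move=> x xa; rewrite mul0r add0r; apply: (derive1_lt fa); lra.
- by move=> x xb; rewrite mul0r add0r; apply: (derive1_gt fb); lra.
Qed.

Lemma is_derive1_affine_comp (f : R -> R) (c b x : R) : smooth1 f ->
  is_derive x 1 (fun t => f ((t - b) / c)) (c^-1 * derive1 f ((x - b) / c)).
Proof.
move=> sf; have da : is_derive x 1 (fun t => (t - b) / c) c^-1.
  apply: is_derive_val (is_deriveM (is_deriveB (is_derive_id x (1 : R))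
    (is_derive_cst b _ _)) (is_derive_cst c^-1 _ _)) _ _ => //.
  by rewrite /GRing.scale/= mulr0 add0r subr0 mulr1.
have := @is_derive1_comp _ f (fun t => (t - b) / c) x _ _
  ((smooth1_derive sf).1 _) da.
by rewrite mulrC.
Qed.

(** Argument and value are scaled together, so that bounds on the first derivative do not depend on
    [c]. The second derivative blows up as [c] tends to [0], but its bound enters no estimate: it
    only serves to justify the chain rule. *)
Definition rescale (f : R -> R) (b c : R) : R -> R := fun t => c * f ((t - b) / c).

Lemma smooth1_affine_comp (f : R -> R) (c b : R) : smooth1 f ->
  smooth1 (fun t => f ((t - b) / c)).
Proof.
move=> sf; apply: smooth1_comp => //.
by apply: (smooth1_ext _ (smooth1_affine c^-1 (- b / c))) => t; ring.
Qed.

Lemma smooth1_rescale (f : R -> R) (b c : R) : smooth1 f -> smooth1 (rescale f b c).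
Proof. by move=> sf; exact: smooth1M (smooth1_cst _) (smooth1_affine_comp _ _ sf). Qed.

Lemma derive1_rescale (f : R -> R) (b c : R) : c != 0 -> smooth1 f ->
  derive1 (rescale f b c) = fun t => derive1 f ((t - b) / c).
Proof.
move=> c0 sf; apply/funext => x; rewrite derive1E; apply: derive_val.
apply: is_derive_val (is_deriveM (is_derive_cst c x (1 : R))
  (is_derive1_affine_comp c b x sf)) _ _ => //.
by rewrite /GRing.scale/= mulr0 addr0 mulrA divff// mul1r.
Qed.

Lemma derive2_rescale (f : R -> R) (b c : R) : c != 0 -> smooth1 f ->
  derive1 (derive1 (rescale f b c)) =
  fun t => c^-1 * derive1 (derive1 f) ((t - b) / c).
Proof.
move=> c0 sf; rewrite derive1_rescale//; apply/funext => x.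
rewrite derive1E; apply: derive_val.
by apply: is_derive1_affine_comp; exact: (smooth1_derive sf).2.
Qed.

Lemma smooth1_lipschitz (f : R -> R) (M : R) : smooth1 f ->
  (forall x, `|derive1 f x| <= M) -> forall x y, `|f x - f y| <= M * `|x - y|.
Proof.
move=> sf fM; have cf := smooth1_continuous sf.
have H x y : x <= y -> `|f y - f x| <= M * `|y - x|.
  move=> xy; have cw : {within `[x, y], continuous f} by exact: continuous_subspaceT.
  have dz z : z \in `]x, y[ -> is_derive z 1 f (derive1 f z).
    by move=> _; exact: (smooth1_derive sf).1.
  have [z _ ->] := MVT_segment xy dz cw.
  by rewrite normrM ler_wpM2r.
move=> x y; have [xy|/ltW yx] := leP x y; last exact: H.
by rewrite distrC (distrC x); exact: H.
Qed.

(** The square keeps the argument of [step] smooth through [0]; the factor [4] puts the plateau at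
    [|x| <= 1/2]. *)
Definition bump x : R := step (4 * (x * x)).

Lemma smooth1_bump : smooth1 bump.
Proof.
apply: (smooth1_comp smooth1_step); apply: smooth1M; first exact: smooth1_cst.
exact: smooth1M smooth1_id smooth1_id.
Qed.

Lemma bump_ge0 x : 0 <= bump x. Proof. exact: step_ge0. Qed.
Lemma bump_bound x : bump x <= 1. Proof. exact: step_bound. Qed.

Lemma bump_in x : `|x| <= 2^-1 -> bump x = 1.
Proof. by rewrite ler_norml => /andP[a b]; apply: step_le1; nra. Qed.

Lemma bump_out x : 1 <= `|x| -> bump x = 0.
Proof.
move=> x1; apply: step_ge2; have : 1 <= `|x| * `|x| by nra.
by rewrite -normrM ger0_norm -?expr2 ?sqr_ge0// => ?; nra.
Qed.

Lemma derive1_bump_bounded : exists2 M, 0 < M & forall x, `|derive1 bump x| <= M.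
Proof.
have Hl y : y <= -1 -> bump y = 0 * y + 0.
  by move=> h; rewrite mul0r addr0 bump_out// ler_normr; apply/orP; right; lra.
have Hr y : 1 <= y -> bump y = 0 * y + 0.
  by move=> h; rewrite mul0r addr0 bump_out// ler_normr h.
have [M HM] := smooth1_derive1_bounded smooth1_bump Hl Hr.
exists (`|M| + 1); first by rewrite ltr_wpDl.
by move=> x; rewrite (le_trans (HM x))// (le_trans (ler_norm M))// lerDl.
Qed.

End cutoff1.

(** * Tensor-product cutoffs and approximations of boxes *)

Section cutoff_rV.
Context {R : realType} {n : nat}.
Implicit Types (c x : 'rV[R]_n) (s : R).

Definition ccube c s : set 'rV[R]_n := [set x | forall i, `|x 0 i - c 0 i| <= s].

Lemma compact_ccube c s : compact (ccube c s).
Proof.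
rewrite (_ : ccube c s =
    [set x | forall i, [set` `[c 0 i - s, c 0 i + s]] (x 0 i)]).
  apply: (@rV_compact _ _ (fun i => [set` `[c 0 i - s, c 0 i + s]])) => i.
  exact: segment_compact.
by apply/seteqP; split=> x /= H i; have := H i; rewrite /= in_itv/= ler_distl.
Qed.

Definition tensor (f : 'I_n -> R -> R) (x : 'rV[R]_n) : R := \prod_j f j (x 0 j).

Lemma smooth_tensor f : (forall j, smooth1 (f j)) -> smooth (tensor f).
Proof.
by move=> sf; apply: smooth_prod => j; exact: smooth_comp1 (sf j) (smooth_coord j).
Qed.

Lemma partial_tensor f i x : (forall j, smooth1 (f j)) ->
  partial i (tensor f) x = derive1 (f i) (x 0 i) * \prod_(j < n | j != i) f j (x 0 j).
Proof.
move=> sf; apply: partialE; apply: (is_derive_near_line (g := fun h : R =>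
   f i (h + x 0 i) * \prod_(j < n | j != i) f j (x 0 j))).
  move=> h; rewrite /tensor (bigD1 i)//=; congr (_ * _).
    by rewrite !mxE !eqxx /= mulr1.
  by apply: eq_bigr => j ji; rewrite !mxE eqxx/= (negbTE ji) mulr0 add0r.
have df := (smooth1_derive (sf i)).1 (0 + x 0 i).
have da : is_derive (0 : R) (1 : R) (fun h => h + x 0 i) 1.
  apply: is_derive_val (is_deriveD (is_derive_id (0 : R) (1 : R))
    (is_derive_cst (x 0 i) (0 : R) (1 : R))) _ _ => //.
  by rewrite addr0.
have dfa := @is_derive1_comp _ (f i) (fun h => h + x 0 i) 0 _ _ df da.
apply: is_derive_val (is_deriveM dfa (is_derive_cst
  (\prod_(j < n | j != i) f j (x 0 j)) (0 : R) (1 : R))) _ _ => //.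
by rewrite /GRing.scale/= !mulr0 !add0r mulr1 mulrC.
Qed.

Definition cutoff c s : 'rV[R]_n -> R := tensor (fun i t => bump ((t - c 0 i) / s)).

Lemma smooth_cutoff c s : smooth (cutoff c s).
Proof. by apply: smooth_tensor => i; exact: smooth1_affine_comp smooth1_bump. Qed.

Lemma cutoff_ge0 c s x : 0 <= cutoff c s x.
Proof. by apply: prodr_ge0 => i _; exact: bump_ge0. Qed.

Lemma cutoff_bound c s x : cutoff c s x <= 1.
Proof. by apply: prodr_ile1 => i _; rewrite bump_ge0 bump_bound. Qed.

Lemma cutoff_in c s x : 0 < s -> ccube c (s / 2) x -> cutoff c s x = 1.
Proof.
move=> s0 H; rewrite /cutoff /tensor big1// => i _; apply: bump_in.
by rewrite normrM normfV (gtr0_norm s0) ler_pdivrMr// mulrC; exact: H.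
Qed.

Lemma cutoff_out c s x : 0 < s -> ~ ccube c s x -> cutoff c s x = 0.
Proof.
move=> s0 /existsNP[i /negP]; rewrite -ltNge => H.
rewrite /cutoff /tensor (bigD1 i)//= bump_out ?mul0r//.
by rewrite normrM normfV (gtr0_norm s0) ler_pdivlMr// mul1r ltW.
Qed.

Lemma test_function_cutoff (Omega : set 'rV[R]_n) c s : 0 < s ->
  ccube c s `<=` Omega -> test_function Omega (cutoff c s).
Proof.
move=> s0 H; apply: (test_function_supp (K := ccube c s)) => //.
- exact: smooth_cutoff.
- exact: compact_ccube.
- by move=> x; exact: cutoff_out.
Qed.

Lemma partial_cutoff_bounded : exists2 M : R, 0 < M &
  forall c s i x, 0 < s -> `|partial i (cutoff c s) x| <= M / s.
Proof.
have [M M0 HM] := @derive1_bump_bounded R; exists M => // c s i x s0.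
rewrite partial_tensor; last by move=> j; exact: smooth1_affine_comp smooth1_bump.
rewrite derive1E (derive_val (is_derive := is_derive1_affine_comp s (c 0 i) (x 0 i) smooth1_bump)).
rewrite (mulrC s^-1) normrM normrM normfV (gtr0_norm s0).
rewrite -[leRHS]mulr1 ler_pM//.
- by rewrite mulr_ge0 ?invr_ge0// ltW.
- by rewrite ler_wpM2r// invr_ge0 ltW.
rewrite ger0_norm; last by apply: prodr_ge0 => j _; exact: bump_ge0.
by apply: prodr_ile1 => j _; rewrite bump_ge0 bump_bound.
Qed.

Lemma partial_max (f : 'rV[R]_n -> R) i x : smooth f -> (forall y, f y <= f x) ->
  partial i f x = 0.
Proof.
move=> sf fx; pose g (h : R) := f (h *: delta_mx 0 i + x).
have dg (h : R) : derivable g h 1.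
  have /is_derive_lineP[+ _] := smooth_is_derive i (h *: delta_mx 0 i + x) sf.
  rewrite (_ : (fun k => _) = (fun k => g (k *: 1 + h))); last first.
    by apply/funext => k; rewrite /g [k%:A]mulr1 scalerDl addrA.
  by move=> D; exact: (derivable1P g h 1).2.
have : is_derive (0 : R) (1 : R) g 0.
  have h1 : (-1 : R) <= 1 by lra.
  have h2 : (0 : R) \in `](-1), 1[ by rewrite in_itv/=; lra.
  apply: (derive1_at_max h1 _ h2) => // t _.
  by rewrite /g scale0r add0r.
by move/is_derive_lineP/partialE.
Qed.

(** The value [1] is the maximum, so the gradient vanishes wherever it is attained, the edge of the
    plateau included. *)
Lemma partial_cutoff_in c s i x : 0 < s -> cutoff c s x = 1 ->
  partial i (cutoff c s) x = 0.
Proof.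
move=> s0 x1; apply: partial_max; first exact: smooth_cutoff.
by move=> y; rewrite x1 cutoff_bound.
Qed.

(** Each factor is [0] within [1/k] of its face and [1] beyond [2/k], so these test functions tend
    pointwise to the indicator of the open box. *)
Definition box_bump (a b : 'rV[R]_n) (k : nat) x : R :=
  \prod_(i < n) ((1 - step (k%:R * (x 0 i - a 0 i))) *
                 (1 - step (k%:R * (b 0 i - x 0 i)))).

Lemma smooth_box_bump a b k : smooth (box_bump a b k).
Proof.
have sn : smooth1 (fun t : R => 1 - step t).
  apply: (smooth1_ext _ (smooth1D (smooth1_cst 1)
    (smooth1M (smooth1_cst (-1)) smooth1_step))) => t.
  by rewrite mulN1r.
apply: smooth_prod => i; apply: smoothM; apply: (smooth_comp1 sn) => m;
  apply: CkM; try exact: Ck_cst; apply: CkD; try exact: Ck_cst.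
  exact: Ck_coord.
apply: (@Ck_comp1 _ _ _ (fun t => - t)); last exact: Ck_coord.
apply: (smooth1_ext _ (smooth1M (smooth1_cst (-1)) smooth1_id)) => t.
by rewrite mulN1r.
Qed.

Lemma box_bump_ge0 a b k x : 0 <= box_bump a b k x.
Proof. by apply: prodr_ge0 => i _; rewrite mulr_ge0// subr_ge0 step_bound. Qed.

Lemma box_bump_bound a b k x : box_bump a b k x <= 1.
Proof.
apply: prodr_ile1 => i _.
have := step_bound (k%:R * (x 0 i - a 0 i)).
have := step_bound (k%:R * (b 0 i - x 0 i)).
have := step_ge0 (k%:R * (x 0 i - a 0 i)).
have := step_ge0 (k%:R * (b 0 i - x 0 i)).
nra.
Qed.

Lemma test_function_box_bump (Omega : set 'rV[R]_n) a b k : obox a b `<=` Omega ->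
  test_function Omega (box_bump a b k.+1).
Proof.
move=> abO; pose e : R := k.+1%:R^-1.
have k0 : 0 < k.+1%:R :> R by rewrite ltr0n.
have e0 : 0 < e by rewrite invr_gt0.
apply: (test_function_supp (K := [set x | forall i,
    [set` `[a 0 i + e, b 0 i - e]] (x 0 i)])) => //.
- exact: smooth_box_bump.
- by apply: (@rV_compact _ _ (fun i => [set` `[a 0 i + e, b 0 i - e]])) => i;
    exact: segment_compact.
- move=> x H; apply: abO => i; have := H i; rewrite /= in_itv/= => /andP[? ?].
  by apply/andP; split; lra.
- move=> x /existsNP[i]; rewrite /= in_itv/= => /negP; rewrite negb_and -!ltNge => H.
  rewrite /box_bump (bigD1 i)//=.
  case/orP: H => H.
    rewrite (step_le1 (x := _ * (x 0 i - _))) ?subrr ?mul0r//.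
    by rewrite -ler_pdivlMl// mulr1 -/e; lra.
  rewrite (step_le1 (x := _ * (b 0 i - _))) ?subrr ?mulr0 ?mul0r//.
  by rewrite -ler_pdivlMl// mulr1 -/e; lra.
Qed.

Lemma box_bump_out a b k x : ~ obox a b x -> box_bump a b k.+1 x = 0.
Proof. by apply: test_function_out; exact: test_function_box_bump. Qed.

Lemma box_bump_cvg a b x : (box_bump a b k x) @[k --> \oo] --> (\1_(obox a b) x : R).
Proof.
have [abx|nabx] := pselect (obox a b x); last first.
  rewrite indicE memNset//; apply: cvg_near_cst; near=> k.
  have k0 : (0 < k)%N by near: k; exact: nbhs_infty_gt.
  by rewrite -(prednK k0) box_bump_out.
rewrite indicE mem_set//; apply: cvg_near_cst.
have H i : \forall k \near \oo, 2 <= k%:R * (x 0 i - a 0 i) /\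
    2 <= k%:R * (b 0 i - x 0 i).
  have /andP[xa xb] := abx i.
  have d0 : 0 < x 0 i - a 0 i by lra.
  have d1 : 0 < b 0 i - x 0 i by lra.
  near=> k; split.
    by rewrite -ler_pdivrMr//; near: k; exact: nbhs_infty_ger.
  by rewrite -ler_pdivrMr//; near: k; exact: nbhs_infty_ger.
have {}H : \forall k \near \oo, forall i, 2 <= k%:R * (x 0 i - a 0 i) /\
    2 <= k%:R * (b 0 i - x 0 i).
  exact: filter_forall.
near=> k; rewrite /box_bump big1// => i _.
have [h1 h2] : 2 <= k%:R * (x 0 i - a 0 i) /\ 2 <= k%:R * (b 0 i - x 0 i).
  by move: i; near: k.
by rewrite !step_ge2// subr0 mulr1.
Unshelve. all: by end_near. Qed.

End cutoff_rV.

(** * Integrals of partial derivatives *)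

Section integral_partial.
Context {R : realType}.

Lemma integrable_rV_cons n (F : 'rV[R]_n.+1 -> \bar R) :
  (lebesgue_rV n.+1).-integrable setT F ->
  (lebesgue_measure \x lebesgue_rV n)%E.-integrable setT (F \o @rV_cons R n).
Proof.
move=> /integrableP[mF iF]; apply/integrableP; split.
  exact: measurableT_comp mF (@measurable_rV_cons R n).
have mA : measurable_fun setT (fun x => `|F x|%E) by exact: measurableT_comp.
have E := ge0_integral_pushforward (@measurable_rV_cons R n)
  (@lebesgue_measure R \x lebesgue_rV n)%E measurableT mA.
by rewrite -E//; exact: iF.
Qed.

Lemma integral_rV_cons n (F : 'rV[R]_n.+1 -> \bar R) :
  (lebesgue_rV n.+1).-integrable setT F ->
  (\int[lebesgue_rV n.+1]_x F x =
   \int[(lebesgue_measure \x lebesgue_rV n)%E]_z F (rV_cons z))%E.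
Proof.
move=> iF; have iG := integrable_rV_cons iF; case/integrableP : (iF) => mF _.
exact: (integral_pushforward (@measurable_rV_cons R n) mF iG measurableT).
Qed.

Lemma integral_rV_fubini1 n (F : 'rV[R]_n.+1 -> \bar R) :
  (lebesgue_rV n.+1).-integrable setT F ->
  (\int[lebesgue_rV n.+1]_x F x =
   \int[lebesgue_measure]_t \int[lebesgue_rV n]_y F (rV_cons (t, y)))%E.
Proof.
move=> iF; rewrite integral_rV_cons// -integral12_prod_meas1//.
exact: integrable_rV_cons.
Qed.

Lemma integral_rV_fubini2 n (F : 'rV[R]_n.+1 -> \bar R) :
  (lebesgue_rV n.+1).-integrable setT F ->
  (\int[lebesgue_rV n.+1]_x F x =
   \int[lebesgue_rV n]_y \int[lebesgue_measure]_t F (rV_cons (t, y)))%E.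
Proof.
move=> iF; rewrite integral_rV_cons// -integral21_prod_meas1//.
exact: integrable_rV_cons.
Qed.

Lemma integrable_bounded_support n (f : 'rV[R]_n -> R) (D : set 'rV[R]_n)
    (M r : R) : measurable D ->
  measurable_fun D f -> (forall x, `|f x| <= M) ->
  (forall x, f x != 0 -> ball 0 r x) ->
  (lebesgue_rV n).-integrable D (EFin \o f).
Proof.
move=> mD mf fM fr.
have [r0|r0] := leP r 0.
  suff -> : f = cst 0 by exact: integrable0.
  apply/funext => x; apply/eqP/negPn/negP => /fr; rewrite -ball_normE /ball_/= => H.
  by have := le_lt_trans (normr_ge0 _) H; rewrite ltNge r0.
have mB : measurable (ball (0 : 'rV[R]_n) r)
  by apply: rV_open_measurable; exact: ball_open.
have E : f = f \_ (ball 0 r).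
  apply/funext => x; rewrite patchE; case: ifPn => // /negP H.
  by apply/eqP/negPn/negP => /fr; rewrite -[ball 0 r x]inE.
rewrite E -restrict_EFin; apply/integrable_restrict => //.
apply: measurable_bounded_integrable.
- exact: measurableI.
- apply: (@le_lt_trans _ _ (lebesgue_rV n (ball (0 : 'rV[R]_n) r))).
    by apply: le_measure; rewrite ?inE//; exact: measurableI.
  by rewrite lebesgue_ball ?ltry.
- by apply: measurable_funS mf.
- exists M; split; first exact: num_real.
  by move=> y My x _ /=; rewrite (le_trans (fM x))// ltW.
Qed.

Lemma integral_derive1_eq0 (f g : R -> R) (M : R) : 0 < M -> continuous g ->
  (forall x : R, is_derive x (1 : R) f (g x)) ->
  (forall x, M <= `|x| -> f x = 0) ->
  (\int[lebesgue_measure]_x (g x)%:E = 0)%E.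
Proof.
move=> M0 cg fg fM.
have gM x : M < `|x| -> g x = 0.
  move=> xM; have [_ <-] := fg x.
  rewrite (near_eq_derive (g := cst 0)) ?derive_cst//.
  near=> y; rewrite fM//; apply: ltW.
  near: y; have := @norm_continuous _ _ x.
  by move=> /cvgr_gt; apply.
have -> : (fun x => (g x)%:E) = (EFin \o g) \_ `[(- M), M].
  apply/funext => x; rewrite patchE; case: ifPn => //=.
  rewrite notin_setE/= in_itv/= -ler_norml => /negP; rewrite -ltNge => /gM ->.
  by [].
rewrite -integral_mkcond.
have MM : - M < M by lra.
have c0 x : {for x, continuous f} by exact: is_derive1_continuous (fg x).
rewrite (continuous_FTC2 MM (F := f)) ?fM ?subee//.
- by rewrite normrN ler_norm.
- by rewrite ler_norm.
- exact: continuous_subspaceT.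
- split.
  + by move=> x _; exact: ex_derive.
  + by apply: cvg_at_right_filter; exact: c0.
  + by apply: cvg_at_left_filter; exact: c0.
- by move=> x _; rewrite derive1E; exact: derive_val.
Unshelve. all: by end_near. Qed.

Lemma rV_consE n (t : R) (y : 'rV[R]_n) j :
  rV_cons (t, y) 0 j = oapp (y 0) t (unlift ord0 j).
Proof. by rewrite mxE. Qed.

Lemma rV_cons_lift n (t h : R) (y : 'rV[R]_n) j :
  h *: delta_mx 0 (lift ord0 j) + rV_cons (t, y) =
  rV_cons (t, h *: delta_mx 0 j + y) :> 'rV[R]_n.+1.
Proof.
apply/rowP => k; rewrite !mxE; case: (unliftP ord0 k) => [l ->|->] /=.
  by rewrite !mxE /= (inj_eq (@lift_inj _ ord0)).
by rewrite mulr0 add0r.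
Qed.

Lemma rV_cons_ord0 n (t h : R) (y : 'rV[R]_n) :
  h *: delta_mx 0 ord0 + rV_cons (t, y) = rV_cons (h + t, y) :> 'rV[R]_n.+1.
Proof.
apply/rowP => k; rewrite !mxE; case: (unliftP ord0 k) => [l ->|->] /=.
  by rewrite mulr0 add0r.
by rewrite mulr1.
Qed.

Lemma continuous_rV_cons1 n (t : R) :
  continuous (fun y : 'rV[R]_n => rV_cons (t, y) : 'rV[R]_n.+1).
Proof.
move=> y A /nbhs_ballP[e /= e0 He]; apply/nbhs_ballP; exists e => //= z.
rewrite rV_ballE//= => yz; apply: He; rewrite rV_ballE//= => i.
rewrite !rV_consE; case: unliftP => [j|] _ /=; first exact: yz.
by rewrite subrr normr0.
Qed.

Lemma continuous_rV_cons0 n (y : 'rV[R]_n) :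
  continuous (fun t : R => rV_cons (t, y) : 'rV[R]_n.+1).
Proof.
move=> t A /nbhs_ballP[e /= e0 He]; apply/nbhs_ballP; exists e => //= z.
rewrite /ball/= => tz; apply: He; rewrite rV_ballE//= => i.
rewrite !rV_consE; case: unliftP => [j|] _ /=; last by rewrite distrC.
by rewrite subrr normr0.
Qed.

Lemma is_derive_rV_cons n (f : 'rV[R]_n.+1 -> R) (t : R) (y : 'rV[R]_n) j (d : R) :
  is_derive (rV_cons (t, y)) (delta_mx 0 (lift ord0 j)) f d ->
  is_derive y (delta_mx 0 j) (fun y => f (rV_cons (t, y))) d.
Proof.
move=> /is_derive_lineP D; apply/is_derive_lineP.
by under eq_fun do rewrite -rV_cons_lift.
Qed.

Lemma Ck_rV_cons n k (f : 'rV[R]_n.+1 -> R) (t : R) : Ck k f ->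
  Ck k (fun y : 'rV[R]_n => f (rV_cons (t, y))).
Proof.
have C (g : 'rV[R]_n.+1 -> R) : continuous g ->
    continuous (fun y : 'rV[R]_n => g (rV_cons (t, y))).
  by move=> cg y; apply: continuous_comp; [exact: continuous_rV_cons1|exact: cg].
elim: k f => [|k IH] f; first by move=> [cf _]; split=> //; exact: C.
move=> /CkSP[cf df].
apply: (@CkS _ _ _ _ (fun j y => partial (lift ord0 j) f (rV_cons (t, y)))).
- exact: C.
- by move=> j y; apply: is_derive_rV_cons; exact: (df _).1.
- by move=> j; apply: IH; exact: (df _).2.
Qed.

(** Induction on the dimension, following the construction of the measure. A derivative in the
    split-off coordinate integrates to [0] over lines by the fundamental theorem of calculus; for
    any other coordinate the inner integral is [0] by induction. *)
Lemma integral_partial_eq0 n (f : 'rV[R]_n -> R) (M : R) i : smooth f -> 0 < M ->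
  (forall x, f x != 0 -> ball 0 M x) ->
  (\int[lebesgue_rV n]_x (partial i f x)%:E = 0)%E.
Proof.
elim: n f i => [|n IH] f i sf M0 fM; first by case: i.
have tf : test_function setT f.
  apply: (test_function_supp (K := ccube 0 M)) => //.
    exact: compact_ccube.
  move=> x nx; apply/eqP/negPn/negP => /fM; rewrite rV_ballE// => H; apply: nx => j.
  exact/ltW/H.
have tp := test_function_partial i tf.
have [B HB] := test_function_bounded tp.
(* The partial derivative may be nonzero wherever [f] is not locally zero, hence on the closed cube
   of half-side [M]; the radius [M + 1] leaves room for it. *)
have pM x : partial i f x != 0 -> ball 0 (M + 1) x.
  move=> px; have M1 : 0 < M + 1 by rewrite addr_gt0.
  rewrite rV_ballE// => j; rewrite ltNge; apply/negP => Mx.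
  move/eqP : px; apply; apply: partial_out.
  have cj : continuous (fun y : 'rV[R]_n.+1 => `|y 0 j|).
    apply: (@rV_continuous_comp1 _ _ (fun t => `|t|)) => y.
      exact: norm_continuous.
    exact: coord_continuous.
  have Mj : M < `|x 0 j|.
    by move: Mx; rewrite mxE subr0; apply: lt_le_trans; rewrite ltrDl.
  have N : nbhs x [set y : 'rV[R]_n.+1 | M < `|y 0 j|].
    by apply: (cj x [set t | M < t]); exact: lt_nbhsr.
  apply: filterS N => y My; apply/eqP/negPn/negP => /fM; rewrite rV_ballE// => /(_ j).
  by rewrite mxE subr0 ltNge ltW.
have iF : (lebesgue_rV n.+1).-integrable setT (EFin \o partial i f).
  apply: (integrable_bounded_support (M := B) (r := M + 1)) => //.
  by apply: rV_continuous_measurableT; apply: smooth_continuous; case: tp.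
have [j ij|i0] := unliftP ord0 i.
- rewrite integral_rV_fubini1//; apply: integral0_eq => t _.
  have E y : partial i f (rV_cons (t, y)) =
      partial j (fun y => f (rV_cons (t, y))) y.
    apply/esym/partialE; rewrite ij; apply: is_derive_rV_cons.
    exact: smooth_is_derive.
  under eq_integral do rewrite /= E.
  apply: IH => //; first by move=> k; apply: Ck_rV_cons.
  move=> y /fM; rewrite !rV_ballE// => H k; have := H (lift ord0 k).
  by rewrite rV_consE liftK/= !mxE.
- rewrite integral_rV_fubini2//; apply: integral0_eq => y _ /=.
  apply: (integral_derive1_eq0 (f := fun t => f (rV_cons (t, y))) (M := M)) => //.
  + move=> t; apply: continuous_comp; first exact: continuous_rV_cons0.
    by apply: smooth_continuous; case: tp.
  + move=> t; have /is_derive_lineP := smooth_is_derive i (rV_cons (t, y)) sf.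
    rewrite i0; under eq_fun do rewrite rV_cons_ord0.
    move=> D; apply: DeriveDef.
      apply/derivable1P; case: D => + _.
      by under [in X in _ -> X]eq_fun do rewrite [_%:A]mulr1.
    by case: D => _ <-; rewrite /derive; under [in RHS]eq_fun do
      rewrite /= addr0 add0r.
  + move=> t tM; apply/eqP/negPn/negP => /fM; rewrite rV_ballE// => /(_ ord0).
    by rewrite rV_consE unlift_none/= mxE subr0 ltNge tM.
Qed.

End integral_partial.

(** * Square integrable functions *)

Section L2_theory.
Context {d : measure_display} {T : measurableType d} {R : realType}.
Variables (mu : {measure set T -> \bar R}) (D : set T).
Hypothesis mD : measurable D.
Implicit Types (f g h : T -> R).

Local Notation "f \in_L1" := (mu.-integrable D (EFin \o f)) (at level 2).

Definition sqint f := measurable_fun D f /\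
  (\int[mu]_(x in D) ((f x ^+ 2)%:E) < +oo)%E.

Definition ip f g : R := \int[mu]_(x in D) (f x * g x).
Definition nrm2 f : R := \int[mu]_(x in D) (f x ^+ 2).

Lemma L1_measurable f : f \in_L1 -> measurable_fun D f.
Proof. by case/integrableP => /measurable_EFinP. Qed.

Lemma EFin_Rintegral f : f \in_L1 ->
  ((\int[mu]_(x in D) f x)%:E = \int[mu]_(x in D) (f x)%:E)%E.
Proof. by move=> If; rewrite fineK//; exact: integrable_fin_num. Qed.

Lemma L1_cst : (mu D < +oo)%E -> forall c : R, (fun=> c) \in_L1.
Proof.
move=> Dfin c; apply: measurable_bounded_integrable => //.
exact: bounded_cst.
Qed.

Lemma L1D f g : f \in_L1 -> g \in_L1 -> (fun x => f x + g x) \in_L1.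
Proof.
move=> If Ig; rewrite (_ : EFin \o _ = (EFin \o f) \+ (EFin \o g))%E//.
exact: integrableD.
Qed.

Lemma L1Z (c : R) f : f \in_L1 -> (fun x => c * f x) \in_L1.
Proof.
move=> If; rewrite (_ : EFin \o _ = (fun x => c%:E * (EFin \o f) x))%E//.
exact: integrableZl.
Qed.

Lemma L1B f g : f \in_L1 -> g \in_L1 -> (fun x => f x - g x) \in_L1.
Proof.
move=> If Ig; rewrite (_ : EFin \o _ = (EFin \o f) \- (EFin \o g))%E//.
exact: integrableB.
Qed.

Lemma L1_le f g : measurable_fun D f -> g \in_L1 ->
  (forall x, D x -> `|f x| <= g x) -> f \in_L1.
Proof.
move=> mf Ig fg; apply: le_integrable Ig => //; first exact/measurable_EFinP.
by move=> x Dx /=; rewrite lee_fin (le_trans (fg x Dx))// ler_norm.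
Qed.

Lemma L1_ext f g : {in D, f =1 g} -> f \in_L1 -> g \in_L1.
Proof.
by move=> fg; apply: eq_integrable => // x xD /=; rewrite fg.
Qed.

Lemma sqint_L1 f : sqint f -> (fun x => f x ^+ 2) \in_L1.
Proof.
move=> [mf If]; apply/integrableP; split.
  by apply/measurable_EFinP; exact: measurable_funX.
by under eq_integral do rewrite /= ger0_norm ?sqr_ge0//.
Qed.

Lemma L1_sqint f : measurable_fun D f -> (fun x => f x ^+ 2) \in_L1 -> sqint f.
Proof.
move=> mf /integrableP[_]; under eq_integral do rewrite /= ger0_norm ?sqr_ge0//.
by [].
Qed.

Lemma sqint_mul_L1 f g : sqint f -> sqint g -> (fun x => f x * g x) \in_L1.
Proof.
move=> sf sg; apply: (L1_le (g := fun x => f x ^+ 2 + g x ^+ 2)).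
- by apply: measurable_funM; [case: sf|case: sg].
- by apply: L1D; exact: sqint_L1.
move=> x _; rewrite normrM.
have := sqr_ge0 (`|f x| - `|g x|); rewrite sqrrB !real_normK ?num_real//.
have := sqr_ge0 (f x); have := sqr_ge0 (g x); rewrite -mulr_natr; nra.
Qed.

Lemma sqintZ (c : R) f : sqint f -> sqint (fun x => c * f x).
Proof.
move=> sf; apply: L1_sqint; first by apply: measurable_funM => //; case: sf.
apply: (L1_ext (f := fun x => c ^+ 2 * f x ^+ 2)).
  by move=> x _; rewrite exprMn.
exact/L1Z/sqint_L1.
Qed.

Lemma sqintD f g : sqint f -> sqint g -> sqint (fun x => f x + g x).
Proof.
move=> sf sg; apply: L1_sqint.
  by apply: measurable_funD; [case: sf|case: sg].
apply: (L1_ext (f := fun x => f x ^+ 2 + (2 * (f x * g x) + g x ^+ 2))).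
  by move=> x _; ring.
by apply: L1D; [exact: sqint_L1|apply: L1D;
  [apply: L1Z; exact: sqint_mul_L1|exact: sqint_L1]].
Qed.

Lemma sqintB f g : sqint f -> sqint g -> sqint (fun x => f x - g x).
Proof.
move=> sf sg; have := sqintD sf (sqintZ (-1) sg).
by under eq_fun do rewrite mulN1r.
Qed.

Lemma sqint_bounded f (M : R) : (mu D < +oo)%E -> measurable_fun D f ->
  (forall x, D x -> `|f x| <= M) -> sqint f.
Proof.
move=> Dfin mf fM; apply: L1_sqint => //.
apply: (L1_le (g := fun=> M ^+ 2)); first exact: measurable_funX.
  exact: L1_cst.
move=> x Dx; rewrite normrX; have := fM x Dx; have := normr_ge0 (f x); nra.
Qed.

Lemma sqint_boundedM f g (M : R) : measurable_fun D f ->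
  (forall x, D x -> `|f x| <= M) -> sqint g -> sqint (fun x => f x * g x).
Proof.
move=> mf fM sg; apply: L1_sqint.
  by apply: measurable_funM => //; case: sg.
apply: (L1_le (g := fun x => M ^+ 2 * g x ^+ 2)).
- by apply: measurable_funX; apply: measurable_funM => //; case: sg.
- exact/L1Z/sqint_L1.
move=> x Dx; rewrite normrX normrM exprMn !real_normK ?num_real//.
apply: ler_wpM2r; first exact: sqr_ge0.
rewrite -[f x ^+ 2]real_normK ?num_real//.
by have := fM x Dx; have := normr_ge0 (f x); nra.
Qed.

Lemma sqint_ext f g : {in D, f =1 g} -> sqint f -> sqint g.
Proof.
move=> fg sf; apply: L1_sqint; last first.
  by apply: L1_ext (sqint_L1 sf) => x xD; rewrite fg.
by apply: eq_measurable_fun (proj1 sf).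
Qed.

Lemma sqint_L1_fin f : (mu D < +oo)%E -> sqint f -> f \in_L1.
Proof.
move=> Dfin sf; apply: (L1_ext (f := fun x => 1 * f x)).
  by move=> x _; rewrite mul1r.
apply: sqint_mul_L1 => //; apply: (sqint_bounded (M := 1)) => //.
by move=> x _; rewrite normr1.
Qed.

Lemma nrm2_ge0 f : 0 <= nrm2 f.
Proof. by apply: Rintegral_ge0 => x _; exact: sqr_ge0. Qed.

Lemma nrm2E f : nrm2 f = ip f f.
Proof. by apply: eq_Rintegral => x _; rewrite expr2. Qed.

Lemma nrm2_ext f g : {in D, f =1 g} -> nrm2 f = nrm2 g.
Proof. by move=> fg; apply: eq_Rintegral => x xD; rewrite fg. Qed.

Lemma ipC f g : ip f g = ip g f.
Proof. by apply: eq_Rintegral => x _; rewrite mulrC. Qed.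

Lemma ipD f g h : sqint f -> sqint g -> sqint h ->
  ip (fun x => f x + g x) h = ip f h + ip g h.
Proof.
move=> sf sg sh; rewrite /ip -RintegralD//; try exact: sqint_mul_L1.
by apply: eq_Rintegral => x _; rewrite mulrDl.
Qed.

Lemma ipZ (c : R) f h : sqint f -> sqint h ->
  ip (fun x => c * f x) h = c * ip f h.
Proof.
move=> sf sh; rewrite /ip -RintegralZl//; last exact: sqint_mul_L1.
by apply: eq_Rintegral => x _; rewrite mulrA.
Qed.

Lemma ipB f g h : sqint f -> sqint g -> sqint h ->
  ip (fun x => f x - g x) h = ip f h - ip g h.
Proof.
move=> sf sg sh; rewrite /ip -RintegralB//; try exact: sqint_mul_L1.
by apply: eq_Rintegral => x _; rewrite mulrBl.
Qed.

Lemma nrm2Z (c : R) f : sqint f -> nrm2 (fun x => c * f x) = c ^+ 2 * nrm2 f.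
Proof.
move=> sf; rewrite /nrm2 -RintegralZl//; last exact: sqint_L1.
by apply: eq_Rintegral => x _; rewrite exprMn.
Qed.

Lemma nrm2D f g : sqint f -> sqint g ->
  nrm2 (fun x => f x + g x) = nrm2 f + 2 * ip f g + nrm2 g.
Proof.
move=> sf sg; have sfg := sqintD sf sg.
rewrite !nrm2E ipD// (ipC f) (ipC g) !ipD// (ipC g f); ring.
Qed.

Lemma nrm2D_le f g : sqint f -> sqint g ->
  nrm2 (fun x => f x + g x) <= 2 * nrm2 f + 2 * nrm2 g.
Proof.
move=> sf sg; rewrite nrm2D//.
have := nrm2_ge0 (fun x => f x + (-1) * g x).
by rewrite nrm2D//; [rewrite ipC ipZ// nrm2Z// ipC; lra|exact: sqintZ].
Qed.

Lemma le_nrm2 f g : sqint f -> sqint g -> (forall x, D x -> `|f x| <= `|g x|) ->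
  nrm2 f <= nrm2 g.
Proof.
move=> sf sg fg; apply: le_Rintegral => //; try exact: sqint_L1.
move=> x Dx; rewrite -[f x ^+ 2]real_normK ?num_real// -[g x ^+ 2]real_normK ?num_real//.
by rewrite lerXn2r ?nnegrE//; exact: fg.
Qed.

Lemma nrm2_boundedM f g (M : R) : measurable_fun D f ->
  (forall x, D x -> `|f x| <= M) -> sqint g ->
  nrm2 (fun x => f x * g x) <= M ^+ 2 * nrm2 g.
Proof.
move=> mf fM sg; rewrite -nrm2Z//; apply: le_nrm2.
- exact: sqint_boundedM fM sg.
- exact: sqintZ.
move=> x Dx; rewrite !normrM ler_wpM2r// (le_trans (fM x Dx))//.
exact: ler_norm.
Qed.

Lemma cauchy_schwarz f g : sqint f -> sqint g ->
  ip f g ^+ 2 <= nrm2 f * nrm2 g.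
Proof.
move=> sf sg.
have H (t : R) : 0 <= nrm2 f + 2 * t * ip f g + t ^+ 2 * nrm2 g.
  have := nrm2_ge0 (fun x => f x + t * g x).
  rewrite nrm2D//; last exact: sqintZ.
  by rewrite ipC ipZ// ipC nrm2Z// mulrA.
have := nrm2_ge0 g; rewrite le_eqVlt => /predU1P[g0|g0]; last first.
  have := H (- ip f g / nrm2 g).
  have -> : nrm2 f + 2 * (- ip f g / nrm2 g) * ip f g +
      (- ip f g / nrm2 g) ^+ 2 * nrm2 g = (nrm2 f * nrm2 g - ip f g ^+ 2) / nrm2 g.
    by field; rewrite gt_eqF.
  by rewrite pmulr_lge0 ?invr_gt0// subr_ge0.
rewrite -g0 mulr0 in H *.
have [->|ne] := eqVneq (ip f g) 0; first by rewrite expr0n.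
(* When [g] has norm [0] the polynomial is affine in its variable; this value makes it equal to
   [-1]. *)
have := H (- (nrm2 f + 1) / (2 * ip f g)).
rewrite mulr0 addr0.
have -> : nrm2 f + 2 * (- (nrm2 f + 1) / (2 * ip f g)) * ip f g = -1.
  by field.
by rewrite lerNr oppr0 ler10.
Qed.

Definition L2cvg (F : nat -> T -> R) f :=
  [/\ forall k, sqint (F k), sqint f &
      nrm2 (fun x => f x - F k x) @[k --> \oo] --> 0].

Lemma L2cvg_le (F : nat -> T -> R) f (e : nat -> R) : (forall k, sqint (F k)) ->
  sqint f -> (forall k, nrm2 (fun x => f x - F k x) <= e k) ->
  e k @[k --> \oo] --> 0 -> L2cvg F f.
Proof.
move=> sF sf Fe e0; split=> //.
apply: (squeeze_cvgr _ (cvg_cst 0) e0); near=> k.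
by rewrite nrm2_ge0 Fe.
Unshelve. all: by end_near. Qed.

Lemma L2cvg_cst f : sqint f -> L2cvg (fun=> f) f.
Proof.
move=> sf; apply: (L2cvg_le (e := fun=> 0)) => //; last exact: cvg_cst.
move=> k; rewrite (nrm2_ext (g := fun x => 0 * f x)); last first.
  by move=> x _; rewrite subrr mul0r.
by rewrite nrm2Z// expr0n mul0r.
Qed.

Lemma L2cvgD F G f g : L2cvg F f -> L2cvg G g ->
  L2cvg (fun k x => F k x + G k x) (fun x => f x + g x).
Proof.
move=> [sF sf Ff] [sG sg Gg].
apply: (L2cvg_le (e := fun k => 2 * nrm2 (fun x => f x - F k x)
    + 2 * nrm2 (fun x => g x - G k x))).
- by move=> k; exact: sqintD.
- exact: sqintD.
- move=> k; rewrite (nrm2_ext (g := fun x => (f x - F k x) + (g x - G k x))).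
    by apply: nrm2D_le; exact: sqintB.
  by move=> x _; ring.
- rewrite (_ : 0 = 2 * 0 + 2 * 0 :> R); last by rewrite !mulr0 addr0.
  by apply: cvgD; apply: cvgMr.
Qed.

Lemma L2cvg_boundedM (F : nat -> T -> R) f (b : T -> R) (M : R) : measurable_fun D b ->
  (forall x, D x -> `|b x| <= M) -> L2cvg F f ->
  L2cvg (fun k x => b x * F k x) (fun x => b x * f x).
Proof.
move=> mb bM [sF sf Ff].
apply: (L2cvg_le (e := fun k => M ^+ 2 * nrm2 (fun x => f x - F k x))).
- by move=> k; exact: sqint_boundedM bM _.
- exact: sqint_boundedM bM _.
- move=> k; rewrite (nrm2_ext (g := fun x => b x * (f x - F k x))).
    by apply: nrm2_boundedM => //; exact: sqintB.
  by move=> x _; rewrite mulrBr.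
- by rewrite -[X in _ --> X](mulr0 (M ^+ 2)); apply: cvgMr.
Qed.

Lemma L2cvgZ (c : R) F f : L2cvg F f ->
  L2cvg (fun k x => c * F k x) (fun x => c * f x).
Proof. by apply: (L2cvg_boundedM (M := `|c|)). Qed.

Lemma L2cvg_boundedM_seq (B : nat -> T -> R) F f (M : R) :
  (forall k, measurable_fun D (B k)) ->
  (forall k x, D x -> `|B k x| <= M) -> L2cvg F f ->
  L2cvg (fun k x => B k x * (F k x - f x)) (fun=> 0).
Proof.
move=> mB BM [sF sf Ff].
apply: (L2cvg_le (e := fun k => M ^+ 2 * nrm2 (fun x => f x - F k x))).
- by move=> k; apply: sqint_boundedM (BM k) _ => //; exact: sqintB.
- by have := sqintZ 0 sf; under eq_fun do rewrite mul0r.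
- move=> k; rewrite (nrm2_ext (g := fun x => B k x * (f x - F k x))).
    by apply: nrm2_boundedM => //; [exact: BM|exact: sqintB].
  by move=> x _; ring.
- by rewrite -[X in _ --> X](mulr0 (M ^+ 2)); apply: cvgMr.
Qed.

Lemma L2cvg_ext F G f g : (forall k, {in D, F k =1 G k}) -> {in D, f =1 g} ->
  L2cvg F f -> L2cvg G g.
Proof.
move=> FG fg [sF sf Ff]; split.
- by move=> k; apply: sqint_ext (sF k).
- exact: sqint_ext sf.
- rewrite (_ : (fun k => _) = fun k => nrm2 (fun x => f x - F k x))//.
  by apply/funext => k; apply: nrm2_ext => x xD; rewrite fg// FG.
Qed.

Lemma ip_cvg F f g : L2cvg F f -> sqint g -> ip (F k) g @[k --> \oo] --> ip f g.
Proof.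
move=> [sF sf Ff] sg; apply/cvgrPdist_lt => e e0.
have N0 := nrm2_ge0 g.
have e1 : 0 < e ^+ 2 / (nrm2 g + 1) by rewrite divr_gt0 ?exprn_gt0// ltr_wpDl.
near=> k; rewrite -ipB//.
have /cauchy_schwarz/(_ sg) CS := sqintB sf (sF k).
have Hk : nrm2 (fun x => f x - F k x) < e ^+ 2 / (nrm2 g + 1).
  near: k; exact: (cvgr_lt _ Ff).
rewrite -(ltr_pXn2r (n := 2)) ?nnegrE// ?ltW// real_normK ?num_real//.
apply: (le_lt_trans CS); rewrite ltr_pdivlMr ?ltr_wpDl// in Hk.
have := nrm2_ge0 (fun x => f x - F k x); nra.
Unshelve. all: by end_near. Qed.

(** Diagonal extraction, the step by which [W0_lim] shows that [W0] is closed. *)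
Lemma L2cvg_comp (F : nat -> nat -> T -> R) (G : nat -> T -> R) g (N : nat -> nat) :
  (forall j, sqint (F j (N j))) -> L2cvg G g ->
  (forall j, nrm2 (fun x => G j x - F j (N j) x) <= (j.+1%:R)^-1) ->
  L2cvg (fun j => F j (N j)) g.
Proof.
move=> sF [sG sg Gg] H.
apply: (L2cvg_le (e := fun j => 2 * nrm2 (fun x => g x - G j x) + 2 * j.+1%:R^-1)) => //.
- move=> j; apply: (@le_trans _ _ (2 * nrm2 (fun x => g x - G j x) +
      2 * nrm2 (fun x => G j x - F j (N j) x))); last first.
    by rewrite lerD2l ler_wpM2l.
  rewrite (nrm2_ext (g := fun x => (g x - G j x) + (G j x - F j (N j) x))).
    by apply: nrm2D_le; exact: sqintB.
  by move=> x _; ring.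
- rewrite (_ : 0 = 2 * 0 + 2 * 0 :> R); last by rewrite !mulr0 addr0.
  by apply: cvgD; apply: cvgMr => //; exact: cvg_harmonic.
Qed.

Lemma L2cvg_dominated (F : nat -> T -> R) f g : (forall k, measurable_fun D (F k)) ->
  measurable_fun D f -> sqint g ->
  (forall x, D x -> F k x @[k --> \oo] --> f x) ->
  (forall k x, D x -> `|F k x| <= `|g x|) -> L2cvg F f.
Proof.
move=> mF mf sg Ff Fg.
have fg x : D x -> `|f x| <= `|g x|.
  move=> Dx; have : `|F k x| @[k --> \oo] --> `|f x| by apply: cvg_norm; exact: Ff.
  move=> /cvg_lim <-//; apply: limr_le.
    by apply/cvg_ex; exists `|f x|; apply: cvg_norm; exact: Ff.
  by near=> k; exact: Fg.
have S h : measurable_fun D h -> (forall x, D x -> `|h x| <= `|g x|) -> sqint h.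
  move=> mh hg; apply: L1_sqint => //.
  apply: (L1_le (g := fun x => g x ^+ 2)).
  - exact: measurable_funX.
  - exact: sqint_L1.
  - move=> x Dx; rewrite normrX -[g x ^+ 2]real_normK ?num_real//.
    by rewrite lerXn2r ?nnegrE//; exact: hg.
have sf := S _ mf fg; have sF k := S _ (mF k) (Fg k).
split=> //.
have mdf k : measurable_fun D (fun x => ((f x - F k x) ^+ 2)%:E).
  by apply/measurable_EFinP; apply: measurable_funX; exact: measurable_funB.
have pt : {ae mu, forall x, D x ->
    (fun k => ((f x - F k x) ^+ 2)%:E) @ \oo --> cst 0%E x}.
  apply/aeW => x Dx; rewrite -[cst 0%E x]/(0%:E).
  apply: cvg_EFin; first exact: nearW.
  rewrite /comp/= (_ : 0 = (f x - f x) * (f x - f x)); last by rewrite subrr mul0r.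
  rewrite /=; under eq_fun do rewrite expr2.
  by apply: cvgM; apply: cvgB; try exact: cvg_cst; exact: Ff.
have dom : {ae mu, forall x k, D x ->
    (`|((f x - F k x) ^+ 2)%:E| <= (4 * g x ^+ 2)%:E)%E}.
  apply/aeW => x k Dx; rewrite lee_fin ger0_norm ?sqr_ge0//.
  rewrite -[g x ^+ 2]real_normK ?num_real// -[leLHS]real_normK ?num_real//.
  have := ler_normB (f x) (F k x); have := fg x Dx; have := Fg k x Dx.
  have := normr_ge0 (f x - F k x); nra.
have [_ _] := @dominated_convergence _ _ _ mu D mD
  (fun k x => ((f x - F k x) ^+ 2)%:E) (cst 0%E) (fun x => (4 * g x ^+ 2)%:E)
  mdf (@measurable_cst _ _ _ _ _ _) pt (L1Z 4 (sqint_L1 sg)) dom.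
rewrite integral0 => H.
exact: (fine_cvg H).
Unshelve. all: by end_near. Qed.

(** Split according to the size of [g]. Where [|g| <= K] the convergence of [B] suffices; the part
    of [g] above [K] is small in norm for large [K], and there the uniform bound on [B] is used. *)
Lemma L2cvg_boundedMr (B : nat -> T -> R) b g (C : R) :
  (forall k x, D x -> `|B k x| <= C) -> (forall x, D x -> `|b x| <= C) ->
  L2cvg B b -> sqint g -> L2cvg (fun k x => B k x * g x) (fun x => b x * g x).
Proof.
move=> BC bC [sB sb Bb] sg.
have [mg _] := sg.
pose A (M : R) : set T := [set x | D x /\ M < `|g x|].
have mA (M : R) : measurable (A M).
  have mng : measurable_fun D (fun x => `|g x|) by exact: measurableT_comp.
  have := mng mD `]M, +oo[%classic (measurable_itv _).
  congr measurable; apply/seteqP; split=> x [Dx]; rewrite /= in_itv/= andbT.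
    by [].
  by [].
pose h (k : nat) x := g x * \1_(A k%:R) x.
have mh k : measurable_fun D (h k).
  by apply: measurable_funM => //; exact: measurable_indic.
have h0 : L2cvg h (fun=> 0).
  apply: (L2cvg_dominated mh _ sg) => //.
    move=> x Dx; apply: cvg_near_cst; near=> k; rewrite /h indicE memNset ?mulr0//.
    move=> [_]; apply/negP; rewrite -leNgt; near: k; exact: nbhs_infty_ger.
  move=> k x Dx; rewrite /h normrM indicE; case: (_ \in _).
    by rewrite normr1 mulr1.
  by rewrite normr0 mulr0.
have sBg k := sqint_boundedM (proj1 (sB k)) (BC k) sg.
have sbg := sqint_boundedM (proj1 sb) bC sg.
split=> //; apply/cvgrPdist_lt => e e0.
case: h0 => sh s0 /cvgrPdist_lt hh.
pose C4 := 4 * C ^+ 2 + 1.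
have C40 : 0 < C4 by rewrite ltr_wpDl// mulr_ge0// sqr_ge0.
have eC : 0 < e / (2 * C4) by rewrite divr_gt0// mulr_gt0.
have [K _ /(_ K (leqnn K))] := hh _ eC.
rewrite sub0r normrN ger0_norm ?nrm2_ge0// => HK.
have K1 : 0 < (K%:R ^+ 2 + 1 : R) by rewrite ltr_wpDl// sqr_ge0.
near=> k; rewrite sub0r normrN ger0_norm ?nrm2_ge0//.
have Hk : nrm2 (fun x => b x - B k x) < e / (2 * (K%:R ^+ 2 + 1)).
  near: k; apply: (cvgr_lt _ Bb); rewrite divr_gt0// mulr_gt0//.
have sbB := sqintB sb (sB k); have s0h := sqintB s0 (sh K).
have : nrm2 (fun x => b x * g x - B k x * g x) <=
    K%:R ^+ 2 * nrm2 (fun x => b x - B k x) + 4 * C ^+ 2 * nrm2 (fun x => 0 - h K x).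
  rewrite /nrm2 -!RintegralZl//; try exact: sqint_L1.
  rewrite -RintegralD//; try (apply: L1Z; exact: sqint_L1).
  apply: le_Rintegral => //; first by apply: sqint_L1; exact: sqintB.
    by apply: L1D; apply: L1Z; exact: sqint_L1.
  move=> x Dx; rewrite -mulrBl exprMn sub0r sqrrN /h indicE.
  have [Ax|nAx] := boolP (x \in A K%:R).
    rewrite mulr1; apply: ler_wpDl; first by rewrite mulr_ge0// sqr_ge0.
    apply: ler_wpM2r; first exact: sqr_ge0.
    have := BC k x Dx; have := bC x Dx; rewrite !ler_norml => /andP[? ?] /andP[? ?].
    nra.
  rewrite mulr0 expr0n/= mulr0 addr0 mulrC; apply: ler_wpM2r; first exact: sqr_ge0.
  have : `|g x| <= K%:R.
    by rewrite leNgt; apply/negP => gK; move/negP : nAx; apply; rewrite inE.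
  by rewrite ler_norml => /andP[? ?]; nra.
move=> /le_lt_trans; apply.
move: Hk HK; rewrite !ltr_pdivlMr ?mulr_gt0// => Hk HK.
have := nrm2_ge0 (fun x => 0 - h K x); have := nrm2_ge0 (fun x => b x - B k x).
by rewrite /C4 in HK; nra.
Unshelve. all: by end_near. Qed.

Lemma L2cvg_lipschitz (t : R -> R) F f (C : R) : continuous t ->
  (forall x y, `|t x - t y| <= C * `|x - y|) -> t 0 = 0 -> L2cvg F f ->
  L2cvg (fun k x => t (F k x)) (fun x => t (f x)).
Proof.
move=> ct tC t0 [sF sf Ff].
have mt h : sqint h -> measurable_fun D (fun x => t (h x)).
  move=> [mh _]; apply: measurableT_comp => //.
  exact: continuous_measurable_fun.
have st h : sqint h -> sqint (fun x => t (h x)).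
  move=> sh; apply: L1_sqint; first exact: mt.
  apply: (L1_le (g := fun x => C ^+ 2 * h x ^+ 2)).
  - by apply: measurable_funX; exact: mt.
  - exact/L1Z/sqint_L1.
  move=> x Dx; rewrite ger0_norm ?sqr_ge0// -exprMn.
  rewrite -[leLHS]real_normK ?num_real// -[leRHS]real_normK ?num_real//.
  rewrite lerXn2r ?nnegrE// normrM.
  have := tC (h x) 0; rewrite t0 !subr0 => /le_trans; apply.
  by rewrite ler_wpM2r// ler_norm.
apply: (L2cvg_le (e := fun k => C ^+ 2 * nrm2 (fun x => f x - F k x))).
- by move=> k; exact: st.
- exact: st.
- move=> k; have sfF := sqintB sf (sF k); rewrite -nrm2Z//; apply: le_nrm2.
  + by apply: sqintB; exact: st.
  + exact: sqintZ.
  + move=> x Dx; rewrite normrM; apply: le_trans (tC _ _) _.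
    by rewrite ler_wpM2r// ler_norm.
- by rewrite -[X in _ --> X](mulr0 (C ^+ 2)); apply: cvgMr.
Qed.

End L2_theory.

(** * The fundamental lemma of the calculus of variations *)

Section du_bois_reymond.
Context {R : realType} {n : nat}.
Local Notation mu := (@lebesgue_rV R n).
Implicit Types (a b : 'rV[R]_n) (f : 'rV[R]_n -> R).

Definition oboxes : set (set 'rV[R]_n) := [set A | exists a b, A = obox a b].

Lemma oboxI a b a' b' : obox a b `&` obox a' b' =
  obox (\row_i Num.max (a 0 i) (a' 0 i)) (\row_i Num.min (b 0 i) (b' 0 i)).
Proof.
apply/seteqP; split=> x.
  move=> [H H'] i; have := H i; have := H' i.
  by rewrite !mxE gt_max lt_min => /andP[-> ->] /andP[-> ->].
by move=> H; split=> i; have := H i; rewrite !mxE gt_max lt_min => /andP[/andP[? ?] /andP[? ?]]; apply/andP.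
Qed.

Lemma setI_closed_oboxes : setI_closed oboxes.
Proof. by move=> _ _ [a [b ->]] [a' [b' ->]]; rewrite oboxI; do 2 eexists. Qed.

(** A slab in one coordinate is a countable union of boxes, so the coordinates are measurable for
    the sigma-algebra generated by the boxes. *)
Lemma measurable_oboxes : @measurable _ 'rV[R]_n = <<s oboxes >>.
Proof.
apply/seteqP; split; last first.
  apply: smallest_sub; first exact: sigma_algebra_measurable.
  by move=> _ [a [b ->]]; exact: measurable_obox.
have mid : measurable_fun [set: g_sigma_algebraType oboxes]
    (fun x : g_sigma_algebraType oboxes => (x : 'rV[R]_n)).
  apply: measurable_fun_coordP => i.
  apply: (measurability _ (RGenOpens.measurableE R)).
  move=> _ [_ [s [t ->] <-]]; rewrite setTI.
  have -> : (fun x : 'rV[R]_n => x 0 i) @^-1` `]s, t[%classic =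
      \bigcup_k obox (\row_j (if j == i then s else - k%:R))
                     (\row_j (if j == i then t else k%:R)).
    apply/seteqP; split=> x /=.
      rewrite in_itv/= => xst.
      exists (Num.truncn `|x|).+1 => // j; rewrite !mxE; case: eqP => [->//|_].
      rewrite -ltr_norml; apply: (@le_lt_trans _ _ `|x|); last first.
        exact: truncnS_gt.
      exact: norm_coord_le.
    by move=> [k _ /(_ i)]; rewrite !mxE eqxx in_itv.
  apply: bigcupT_measurable => k; apply: sub_sigma_algebra.
  by do 2 eexists.
by move=> A mA; have := mid measurableT A mA; rewrite setTI.
Qed.

Lemma integral_obox_eq0 f (Omega : set 'rV[R]_n) a b : open Omega ->
  mu.-integrable Omega (EFin \o f) ->
  (forall phi, test_function Omega phi -> (\int[mu]_(x in Omega) (f x * phi x)%:E = 0)%E) ->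
  obox a b `<=` Omega -> (\int[mu]_(x in obox a b) (f x)%:E = 0)%E.
Proof.
move=> oO If H abO; have mO := rV_open_measurable oO.
have mb k : measurable_fun Omega (box_bump a b k).
  by apply: rV_continuous_measurableT; apply: smooth_continuous; exact: smooth_box_bump.
have mf : measurable_fun Omega f by exact: L1_measurable If.
have mi : measurable_fun Omega (fun x => f x * \1_(obox a b) x).
  apply: measurable_funM => //; apply: measurable_funTS.
  by apply: measurable_indic; exact: measurable_obox.
have mfb k : measurable_fun Omega (fun x => (f x * box_bump a b k.+1 x)%:E).
  by apply/measurable_EFinP; exact: measurable_funM.
have pt : {ae mu, forall x, Omega x ->
    (fun k => (f x * box_bump a b k.+1 x)%:E) @ \oo --> (f x * \1_(obox a b) x)%:E}.
  apply/aeW => x _; apply: cvg_EFin; first exact: nearW.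
  apply: cvgMr; have := @box_bump_cvg _ _ a b x.
  by rewrite -(cvg_shiftS (fun k => box_bump a b k x)).
have dom : {ae mu, forall x k, Omega x ->
    (`|(f x * box_bump a b k.+1 x)%:E| <= `|(f x)%:E|)%E}.
  apply/aeW => x k _; rewrite lee_fin normrM (ger0_norm (box_bump_ge0 _ _ _ _)).
  by rewrite ler_piMr// box_bump_bound.
have mi' : measurable_fun Omega (fun x => (f x * \1_(obox a b) x)%:E).
  exact/measurable_EFinP.
have [_ _ L] := @dominated_convergence _ _ _ mu Omega mO _ _ _ mfb
  mi' pt (integrable_abse If) dom.
have Z : (fun k => \int[mu]_(x in Omega) (f x * box_bump a b k.+1 x)%:E)%E = cst 0%E.
  by apply/funext => k; apply: H; exact: test_function_box_bump.
have : (\int[mu]_(x in Omega) (f x * \1_(obox a b) x)%:E = 0)%E.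
  have /cvg_lim <- := L => //.
  by rewrite (_ : [sequence _]_k = cst 0%E)//; exact: lim_cst.
rewrite -[obox a b in X in _ -> X](setIidr abO) integral_mkcondr => <-.
apply: eq_integral => x _; rewrite patchE indicE.
by case: ifPn => _; rewrite ?mulr1 ?mulr0.
Qed.

(** Test functions approximate indicators of boxes. A Dynkin-system argument passes from boxes to
    all measurable subsets of a fixed box in [Omega], which gives [f = 0] almost everywhere on that
    box; countably many rational boxes then cover [Omega]. *)
Lemma integral_test_ae0 f (Omega : set 'rV[R]_n) : open Omega ->
  mu.-integrable Omega (EFin \o f) ->
  (forall phi, test_function Omega phi -> (\int[mu]_(x in Omega) (f x * phi x)%:E = 0)%E) ->
  {ae mu, forall x, Omega x -> f x = 0}.
Proof.
move=> oO If H; have mO := rV_open_measurable oO.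
have Q0 a b : obox a b `<=` Omega -> {ae mu, forall x, obox a b x -> f x = 0}.
  move=> abO; have mQ := @measurable_obox _ _ a b.
  have IQ : mu.-integrable (obox a b) (EFin \o f) by exact: integrableS If.
  have P A : measurable A -> (\int[mu]_(x in A `&` obox a b) (f x)%:E = 0)%E.
    rewrite measurable_oboxes; move: A.
    apply: (@dynkin_induction _ 'rV[R]_n oboxes
      (fun A => (\int[mu]_(x in A `&` obox a b) (f x)%:E = 0)%E)
      measurable_oboxes setI_closed_oboxes).
    - by rewrite setTI; exact: integral_obox_eq0 H abO.
    - move=> _ [a' [b' ->]]; rewrite oboxI; apply: integral_obox_eq0 H _ => //.
      by rewrite -oboxI; apply: subset_trans abO; exact: subIsetr.
    - move=> S mS PS.
      have : (\int[mu]_(x in obox a b) (f x)%:E = 0)%E by exact: integral_obox_eq0 H abO.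
      have E : obox a b = (S `&` obox a b) `|` (~` S `&` obox a b).
        by rewrite -setIUl setUv setTI.
      rewrite {1}E integral_setU//; first by rewrite PS add0e.
      + exact: measurableI.
      + by apply: measurableI => //; exact: measurableC.
      + by rewrite -E; case/integrableP : IQ.
      + by apply/disj_setPS => x [[Sx _] [nSx _]]; exact: nSx.
    - move=> F mF tF PF; rewrite setI_bigcupl integral_bigcup//.
      + by rewrite eseries0// => k _ _; exact: PF.
      + move=> i j _ _ [x [[Fi _] [Fj _]]]; apply: tF => //.
        by exists x.
      + by move=> k; exact: measurableI.
      + apply: integrableS IQ => //; last by move=> x [k _ []].
        by apply: bigcup_measurable => k _; exact: measurableI.
  have E : ae_eq mu (obox a b) (EFin \o f) (cst 0%E).
    apply: integral_ae_eq => // A AQ mA; rewrite integral0.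
    by have := P A mA; rewrite setIidl.
  by apply: filterS E => x Hx Qx; case: (Hx Qx).
pose F k : set 'rV[R]_n := if unpickle k is Some q then
   if `[< 0 < ratr q.2 :> R /\
       ball (map_mx ratr q.1 : 'rV[R]_n) (ratr q.2) `<=` Omega >] then
     ball (map_mx ratr q.1 : 'rV[R]_n) (ratr q.2) else set0
   else set0.
have FN k : mu.-negligible [set x | F k x /\ f x <> 0].
  rewrite /F; case: unpickle => [q|]; last first.
    by rewrite (_ : [set x | _] = set0)//; [exact: negligible_set0|apply/seteqP; split=> x []].
  case: ifPn => [/asboolP[q0 qO]|_]; last first.
    by rewrite (_ : [set x | _] = set0)//; [exact: negligible_set0|apply/seteqP; split=> x []].
  rewrite ball_obox// in qO *; have := Q0 _ _ qO.
  by apply: negligibleS => x /= [Qx fx] /(_ Qx).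
apply: negligibleS (negligible_bigcup FN) => x /= /not_implyP[Ox fx].
have [q [q0 qO] qx] : (\bigcup_(q in [set q : 'rV[rat]_n * rat | 0 < ratr q.2 :> R /\
       ball (map_mx ratr q.1 : 'rV[R]_n) (ratr q.2) `<=` Omega])
       ball (map_mx ratr q.1 : 'rV[R]_n) (ratr q.2)) x.
  by rewrite -(open_bigcup_obox oO).
by exists (pickle q) => //; rewrite /F pickleK asboolT.
Qed.

End du_bois_reymond.

(** * The space [H^1_0] *)

Section H10_theory.
Context {R : realType} {n : nat}.
Variable Omega : set 'rV[R]_n.
Hypothesis oO : open Omega.
Hypothesis fO : (lebesgue_rV n Omega < +oo)%E.
Implicit Types (u v : 'rV[R]_n -> R) (g : 'rV[R]_n -> 'rV[R]_n) (i : 'I_n).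
Local Notation mu := (@lebesgue_rV R n).

Let mO : measurable Omega := rV_open_measurable oO.

Lemma smooth_measurable (D : set 'rV[R]_n) u : smooth u -> measurable_fun D u.
Proof. by move=> su; apply: rV_continuous_measurableT; exact: smooth_continuous. Qed.

Lemma test_sqint (A : set 'rV[R]_n) u : test_function A u -> sqint mu Omega u.
Proof.
move=> tu; have [M HM] := test_function_bounded tu.
apply: (sqint_bounded mO fO (M := M)) => [|x _]; last exact: HM.
by apply: smooth_measurable; case: tu.
Qed.

Lemma test_ball (A : set 'rV[R]_n) u : test_function A u ->
  exists2 M, 0 < M & forall x, u x != 0 -> ball 0 M x.
Proof.
move=> [_ /compact_bounded[M [_ HM]] _].
exists (`|M| + 2); first by rewrite ltr_wpDl.
move=> x ux; rewrite mx_norm_ball /ball_ /=.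
rewrite distrC subr0; apply: (@le_lt_trans _ _ (`|M| + 1)); last lra.
apply: (HM (`|M| + 1)); first by rewrite (le_lt_trans (ler_norm M))// ltrDl.
exact: subset_closure.
Qed.

Lemma integral_test_partial u i : test_function Omega u ->
  \int[mu]_(x in Omega) partial i u x = 0.
Proof.
move=> tu; have [su _ _] := tu; have [M M0 uM] := test_ball tu.
have := integral_partial_eq0 i su M0 uM.
rewrite /Rintegral integral_mkcond => E.
rewrite (_ : (_ \_ Omega) = (fun x => (partial i u x)%:E)) ?E//.
apply/funext => x; rewrite patchE; case: ifPn => //.
rewrite notin_setE => nx; rewrite (test_function_out (test_function_partial i tu))//.
Qed.

Lemma test_ibp u v i : test_function Omega u -> smooth v ->
  ip mu Omega u (partial i v) = - ip mu Omega (partial i u) v.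
Proof.
move=> tu sv; have [su _ _] := tu.
have t1 := test_function_mul tu (smooth_partial i sv).
have t2 := test_function_mul (test_function_partial i tu) sv.
have I1 := sqint_L1_fin mO fO (test_sqint t1).
have I2 := sqint_L1_fin mO fO (test_sqint t2).
apply/eqP; rewrite -addr_eq0 /ip -RintegralD//; apply/eqP.
rewrite -(integral_test_partial i (test_function_mul tu sv)).
by apply: eq_Rintegral => x _; rewrite partialM//; ring.
Qed.

(* [H^1_0] as the closure of the test functions; the gradient is a parameter since
   [grad] is only determined up to a null set. *)
Definition W0 u g := exists phi : nat -> 'rV[R]_n -> R,
  [/\ forall k, test_function Omega (phi k), L2cvg mu Omega phi u &
      forall i, L2cvg mu Omega (fun k => partial i (phi k)) (fun x => g x 0 i)].

Lemma W0_sqint u g : W0 u g -> sqint mu Omega u.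
Proof. by move=> [phi [_ []]]. Qed.

Lemma W0_sqint_grad u g : W0 u g -> forall i, sqint mu Omega (fun x => g x 0 i).
Proof. by move=> [phi [_ _ H]] i; case: (H i). Qed.

(** The approximants are supported inside [Omega], so [v] may be a test function of the whole space.
    The zero boundary values of [u] are encoded here, and this is what [boundary_point_below]
    exploits. *)
Lemma W0_ibp u g v i : W0 u g -> test_function setT v ->
  ip mu Omega u (partial i v) = - ip mu Omega (fun x => g x 0 i) v.
Proof.
move=> [phi [tphi cu cg]] tv.
have H1 := ip_cvg mO cu (test_sqint (test_function_partial i tv)).
have H2 := ip_cvg mO (cg i) (test_sqint tv).
have E : (fun k => ip mu Omega (phi k) (partial i v)) =
    (fun k => - ip mu Omega (partial i (phi k)) v).
  by apply/funext => k; apply: test_ibp => //; case: tv.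
rewrite E in H1.
by rewrite -(cvg_lim _ H1)//; apply: cvg_lim => //; exact: cvgN.
Qed.

Lemma W0_weak u g : W0 u g -> is_weak_gradient Omega u g.
Proof.
move=> H i; split; first exact: W0_sqint_grad H i.
move=> phi tphi; have tT := test_function_sub (@subsetT _ Omega) tphi.
have I1 := sqint_mul_L1 mO (W0_sqint H) (test_sqint (test_function_partial i tT)).
have I2 := sqint_mul_L1 mO (W0_sqint_grad H i) (test_sqint tT).
rewrite -(EFin_Rintegral mO I1) -(EFin_Rintegral mO I2).
by congr (_%:E); exact: W0_ibp.
Qed.

Lemma weak_gradient_unique u g g' : is_weak_gradient Omega u g ->
  is_weak_gradient Omega u g' ->
  forall i, {ae mu, forall x, Omega x -> g x 0 i = g' x 0 i}.
Proof.
move=> wg wg' i; have [sg Hg] := wg i; have [sg' Hg'] := wg' i.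
have sB := sqintB mO sg sg'.
have Z phi : test_function Omega phi ->
    (\int[mu]_(x in Omega) ((g x 0 i - g' x 0 i) * phi x)%:E = 0)%E.
  move=> tphi; have tT := test_sqint tphi.
  have I1 := sqint_mul_L1 mO sg tT; have I2 := sqint_mul_L1 mO sg' tT.
  have I3 := sqint_mul_L1 mO sB tT.
  have := Hg phi tphi; rewrite Hg'// -!EFin_Rintegral// => -[] /oppr_inj E.
  congr (_%:E).
  rewrite (_ : Rintegral _ _ _ = ip mu Omega (fun x => g x 0 i - g' x 0 i) phi)//.
  by rewrite ipB// /ip E subrr.
have := integral_test_ae0 oO (sqint_L1_fin mO fO sB) Z.
by apply: filterS => x H Ox; apply/eqP; rewrite -subr_eq0; apply/eqP; exact: H.
Qed.

Lemma cvg_nrm2 (F : nat -> 'rV[R]_n -> R) u : (forall k, sqint mu Omega (F k)) ->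
  sqint mu Omega u ->
  (\int[mu]_(x in Omega) (((u x - F k x) ^+ 2)%:E))%E @[k --> \oo] --> 0%E <->
  nrm2 mu Omega (fun x => u x - F k x) @[k --> \oo] --> 0.
Proof.
move=> sF su; have E k : (\int[mu]_(x in Omega) (((u x - F k x) ^+ 2)%:E))%E =
    (nrm2 mu Omega (fun x => u x - F k x))%:E.
  by rewrite EFin_Rintegral//; apply: sqint_L1 => //; exact: sqintB.
split=> H; first exact: (fine_cvg H).
by under eq_fun do rewrite E; apply: cvg_EFin => //; exact: nearW.
Qed.

Lemma H10_W0 u : H10 Omega u -> W0 u (grad Omega u).
Proof.
move=> [[su [g wg]] [phi [tphi cu cg]]].
have wu : is_weak_gradient Omega u (grad Omega u).
  by rewrite /grad; case: xgetP => [g' _//|/(_ g)].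
have sgu i : sqint mu Omega (fun x => grad Omega u x 0 i) by have [] := wu i.
exists phi; split=> // [|i]; split=> //.
- by move=> k; exact: test_sqint (tphi k).
- by apply/cvg_nrm2 => // k; exact: test_sqint (tphi k).
- by move=> k; exact: test_sqint (test_function_partial i (tphi k)).
- apply/(@cvg_nrm2 (fun k => partial i (phi k))) => // k.
  exact: test_sqint (test_function_partial i (tphi k)).
Qed.

Lemma W0_grad u g : W0 u g ->
  forall i, {ae mu, forall x, Omega x -> grad Omega u x 0 i = g x 0 i}.
Proof.
move=> H; apply: (@weak_gradient_unique u); last exact: W0_weak.
rewrite /grad; case: xgetP => [g' _//|/(_ g)]; move=> /(_ (W0_weak H)) [].
Qed.

Lemma W0_H10 u g : W0 u g -> H10 Omega u.
Proof.
move=> H; have ag := W0_grad H; have [phi [tphi cu cg]] := H.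
split.
  by split; [exact: W0_sqint H|exists g; exact: W0_weak].
exists phi; split=> //.
  by apply/cvg_nrm2; case: cu.
move=> i; have [sphi sgi ci] := cg i.
have ci' := (cvg_nrm2 sphi sgi).2 ci.
have sgr : sqint mu Omega (fun x => grad Omega u x 0 i).
  have : is_weak_gradient Omega u (grad Omega u).
    rewrite /grad; case: xgetP => [g' _//|/(_ g)]; move=> /(_ (W0_weak H)) [].
  by move=> /(_ i)[].
rewrite (_ : (fun k => _) = (fun k =>
  (\int[mu]_(x in Omega) (((g x 0 i - partial i (phi k) x) ^+ 2)%:E))%E))//.
apply/funext => k; apply: ae_eq_integral => //.
- apply/measurable_EFinP; apply: measurable_funX; apply: measurable_funB.
    by case: sgr.
  by case: (sphi k).
- apply/measurable_EFinP; apply: measurable_funX; apply: measurable_funB.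
    by case: sgi.
  by case: (sphi k).
- by apply: filterS (ag i) => x Hx Ox; rewrite Hx.
Qed.

Lemma W0D u v g h : W0 u g -> W0 v h ->
  W0 (fun x => u x + v x) (fun x => g x + h x).
Proof.
move=> [phi [tphi cu cg]] [psi [tpsi cv ch]].
exists (fun k x => phi k x + psi k x); split.
- by move=> k; exact: test_function_add.
- exact: L2cvgD.
- move=> i; apply: (L2cvg_ext mO _ _ (L2cvgD mO (cg i) (ch i))).
    move=> k x _; apply/esym/partialE/is_deriveD; apply: smooth_is_derive.
      by case: (tphi k).
    by case: (tpsi k).
  by move=> x _; rewrite mxE.
Qed.

Lemma W0Z (c : R) u g : W0 u g -> W0 (fun x => c * u x) (fun x => c *: g x).
Proof.
move=> [phi [tphi cu cg]].
have tc k : test_function Omega (fun x => c * phi k x).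
  have := test_function_mul (tphi k) (@smooth_cst R n c).
  by under eq_fun do rewrite mulrC.
exists (fun k x => c * phi k x); split; first exact: tc.
- exact: L2cvgZ.
- move=> i; apply: (L2cvg_ext mO _ _ (L2cvgZ mO c (cg i))).
    move=> k x _; apply/esym/partialE.
    have [sp _ _] := tphi k.
    have := is_deriveM (is_derive_cst c x (delta_mx 0 i : 'rV[R]_n)) (smooth_is_derive i x sp).
    by rewrite /GRing.scale/= mulr0 addr0.
  by move=> x _; rewrite mxE.
Qed.

Lemma W0_ext u v g h : {in Omega, u =1 v} -> {in Omega, g =1 h} -> W0 u g -> W0 v h.
Proof.
move=> uv gh [phi [tphi cu cg]]; exists phi; split=> //.
  exact: (L2cvg_ext mO _ _ cu).
by move=> i; apply: (L2cvg_ext mO _ _ (cg i)) => // x xO; rewrite gh.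
Qed.

Lemma W0_lim (U : nat -> 'rV[R]_n -> R) (G : nat -> 'rV[R]_n -> 'rV[R]_n) u g :
  (forall j, W0 (U j) (G j)) -> L2cvg mu Omega U u ->
  (forall i, L2cvg mu Omega (fun j x => G j x 0 i) (fun x => g x 0 i)) -> W0 u g.
Proof.
move=> WU cU cG; have [phi Hphi] := choice WU.
have K j : exists k, nrm2 mu Omega (fun x => U j x - phi j k x) <= j.+1%:R^-1 /\
    forall i, nrm2 mu Omega (fun x => G j x 0 i - partial i (phi j k) x) <= j.+1%:R^-1.
  have [tphi [sp su cu] cg] := Hphi j.
  have j0 : 0 < j.+1%:R^-1 :> R by rewrite invr_gt0.
  have H1 : \forall k \near \oo, nrm2 mu Omega (fun x => U j x - phi j k x) <= j.+1%:R^-1.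
    exact: (cvgr_le _ cu).
  have H2 : \forall k \near \oo, forall i,
      nrm2 mu Omega (fun x => G j x 0 i - partial i (phi j k) x) <= j.+1%:R^-1.
    by apply: filter_forall => i; have [_ _ ci] := cg i; exact: (cvgr_le _ ci).
  have [k [? ?]] := filter_ex (filterI H1 H2).
  by exists k.
have [N HN] := choice K.
exists (fun j => phi j (N j)); split.
- by move=> j; have [tphi _ _] := Hphi j; exact: tphi.
- apply: (L2cvg_comp mO _ cU) => // j; last by have [] := HN j.
  by have [tphi _ _] := Hphi j; exact: test_sqint (tphi _).
- move=> i; apply: (@L2cvg_comp _ _ _ mu Omega mO (fun j k => partial i (phi j k))
    _ _ N _ (cG i)) => j.
    have [tphi _ _] := Hphi j; exact: test_sqint (test_function_partial i (tphi _)).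
  by have [_] := HN j; apply.
Qed.

Lemma W0_test u : test_function Omega u -> W0 u (fun x => \row_i partial i u x).
Proof.
move=> tu; exists (fun=> u); split=> //.
  by apply: L2cvg_cst => //; exact: test_sqint tu.
move=> i; apply: (L2cvg_ext mO _ _ (L2cvg_cst mO (test_sqint (test_function_partial i tu)))) => //.
by move=> x _; rewrite mxE.
Qed.

(** [t 0 = 0] keeps [t (phi k)] compactly supported. The product of [derive1 t (phi k)] and
    [partial i (phi k)] is split by inserting [g]: the difference of the gradients is multiplied by
    a bounded function, and the rest is [L2cvg_boundedMr]. The bound [C2] makes [derive1 t (phi k)]
    converge. *)
Lemma W0_chain u g (t : R -> R) (z : 'rV[R]_n -> R) (C C2 Z : R) : W0 u g ->
  smooth1 t -> t 0 = 0 -> (forall s, `|derive1 t s| <= C) ->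
  (forall s, `|derive1 (derive1 t) s| <= C2) ->
  smooth z -> (forall x, `|z x| <= Z) -> (forall i x, `|partial i z x| <= Z) ->
  W0 (fun x => z x * t (u x))
     (fun x => \row_i (partial i z x * t (u x) + z x * (derive1 t (u x) * g x 0 i))).
Proof.
move=> [phi [tphi cu cg]] st t0 tC tC2 sz zZ dzZ.
have [dt sdt] := smooth1_derive st.
have ct := L2cvg_lipschitz mO (smooth1_continuous st) (smooth1_lipschitz st tC) t0 cu.
have mz : measurable_fun Omega z by exact: smooth_measurable.
have mdz i : measurable_fun Omega (partial i z).
  by apply: smooth_measurable; exact: smooth_partial.
have mdt v : measurable_fun Omega v -> measurable_fun Omega (fun x => derive1 t (v x)).
  move=> mv; apply: measurableT_comp => //.
  by apply: continuous_measurable_fun; exact: smooth1_continuous.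
have [sphi su _] := cu.
have sdtv v : measurable_fun Omega v -> sqint mu Omega (fun x => derive1 t (v x)).
  by move=> mv; apply: (sqint_bounded mO fO (M := C)) => //; exact: mdt.
exists (fun k x => z x * t (phi k x)); split.
- move=> k; have := test_function_mul (test_function_comp1 st t0 (tphi k)) sz.
  by under eq_fun do rewrite mulrC.
- exact: (L2cvg_boundedM mO mz (fun x _ => zZ x)).
move=> i; have [sp sgi ci] := cg i.
have c1 := L2cvg_boundedM mO (mdz i) (fun x _ => dzZ i x) ct.
have cd : L2cvg mu Omega (fun k x => derive1 t (phi k x)) (fun x => derive1 t (u x)).
  apply: (L2cvg_le (e := fun k => C2 ^+ 2 * nrm2 mu Omega (fun x => u x - phi k x))).
  - by move=> k; apply: sdtv; case: (sphi k).
  - by apply: sdtv; case: su.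
  - move=> k; have sB := sqintB mO su (sphi k); rewrite -nrm2Z//; apply: le_nrm2 => //.
    + by apply: sqintB => //; apply: sdtv; [case: su|case: (sphi k)].
    + exact: sqintZ.
    + move=> x _; rewrite normrM; apply: le_trans (smooth1_lipschitz sdt tC2 _ _) _.
      by rewrite ler_wpM2r// ler_norm.
  - rewrite -[X in _ --> X](mulr0 (C2 ^+ 2)); apply: cvgMr.
    by case: cu.
have c2 := L2cvg_boundedMr mO (fun k x _ => tC (phi k x)) (fun x _ => tC (u x)) cd sgi.
have c3 := L2cvg_boundedM_seq mO (fun k => mdt _ (proj1 (sphi k)))
  (fun k x _ => tC (phi k x)) (cg i).
have c4 := L2cvg_boundedM mO mz (fun x _ => zZ x) (L2cvgD mO c2 c3).
apply: (L2cvg_ext mO _ _ (L2cvgD mO c1 c4)).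
- move=> k x _; rewrite partialM//; last by apply: smooth_comp1 => //; case: (tphi k).
  rewrite partial_comp1//; last by case: (tphi k).
  by ring.
- by move=> x _; rewrite mxE; ring.
Qed.

Lemma measurable_above1 u : measurable_fun Omega u -> measurable (above1 Omega u).
Proof.
move=> mu0; have := mu0 mO `]1, +oo[%classic (measurable_itv _).
congr measurable; apply/seteqP; split=> x [Ox]; rewrite /= in_itv/= andbT //.
Qed.

Lemma smooth1_rise_bounded : exists2 M : R, 0 < M &
  forall x, `|derive1 rise x| <= M /\ `|derive1 (derive1 rise) x| <= M.
Proof.
have Hl (y : R) : y <= 1 -> rise y = 0 * y + 0 by move=> ?; rewrite rise_le1// mul0r addr0.
have Hr (y : R) : 2 <= y -> rise y = 1 * y + 0 by move=> ?; rewrite rise_ge2// mul1r addr0.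
have [M1 H1] := smooth1_derive1_bounded smooth1_rise Hl Hr.
have [M2 H2] := smooth1_derive2_bounded smooth1_rise Hl Hr.
exists (`|M1| + `|M2| + 1); first by rewrite ltr_wpDl// addr_ge0.
move=> x; have := H1 x; have := H2 x; have := ler_norm M1; have := ler_norm M2.
by have := normr_ge0 M1; have := normr_ge0 M2; split; lra.
Qed.

Lemma rise_cvg (y : R) :
  (j.+1%:R^-1 * rise (y / j.+1%:R^-1)) @[j --> \oo] --> Num.max y 0.
Proof.
have [y0|y0] := leP y 0.
  rewrite (_ : (fun j => _) = cst 0); first exact: cvg_cst.
  apply/funext => j; rewrite rise_le1 ?mulr0//.
  by rewrite (@le_trans _ _ 0)// mulr_le0_ge0// invr_ge0 invr_ge0.
apply: cvg_near_cst; near=> j.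
have : 2 / y <= j.+1%:R.
  by near: j; exists (Num.truncn (2 / y)) => // k /= jk; rewrite ltW// (lt_le_trans (truncnS_gt _))// ler_nat.
rewrite ler_pdivrMr// => yj.
rewrite rise_ge2; first by rewrite mulrCA divff ?mulr1// invr_neq0// pnatr_eq0.
by rewrite invrK mulrC.
Unshelve. all: by end_near. Qed.

Lemma derive1_rise_cvg (y : R) :
  derive1 rise (y / j.+1%:R^-1) @[j --> \oo] --> ((0 < y)%R%:R : R).
Proof.
have [y0|y0] := ltP 0 y; last first.
  rewrite (_ : (fun j => _) = cst 0); first exact: cvg_cst.
  apply/funext => j; rewrite derive1_rise_lt1//.
  by rewrite (@le_lt_trans _ _ 0)// mulr_le0_ge0// invr_ge0 invr_ge0.
apply: cvg_near_cst; near=> j.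
rewrite derive1_rise_gt2//.
have : 2 / y < j.+1%:R.
  by near: j; exists (Num.truncn (2 / y)) => // k /= jk; rewrite (lt_le_trans (truncnS_gt _))// ler_nat.
by rewrite ltr_pdivrMr// invrK mulrC.
Unshelve. all: by end_near. Qed.

Lemma rise_bound (y : R) : `|rise y| <= `|y|.
Proof.
rewrite /rise normrM ler_piMr// ger0_norm ?subr_ge0 ?step_bound//.
by rewrite lerBlDr lerDl step_ge0.
Qed.

(** Limit of the smooth functions [rescale rise 1 (e j)]. Their derivatives vanish up to a point
    above [1], so the limiting gradient is [0] everywhere on [{u <= 1}], the level set [{u = 1}]
    included. *)
Lemma W0_pos_part u g : W0 u g ->
  W0 (fun x => pos_part (u x - 1)) (fun x => (1 < u x)%R%:R *: g x).
Proof.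
move=> Wu; have [C C0 HC] := smooth1_rise_bounded.
have su := W0_sqint Wu; have sg := W0_sqint_grad Wu.
pose e (j : nat) : R := j.+1%:R^-1.
have e0 j : 0 < e j by rewrite invr_gt0.
have en0 j : e j != 0 by rewrite gt_eqF.
pose t j := rescale rise 1 (e j).
have st j : smooth1 (t j) by apply: smooth1_rescale; exact: smooth1_rise.
have t0 j : t j 0 = 0.
  rewrite /t /rescale rise_le1 ?mulr0// sub0r.
  by rewrite (@le_trans _ _ 0)// mulr_le0_ge0// ?lerN10// invr_ge0 ltW.
have dt j s : derive1 (t j) s = derive1 rise ((s - 1) / e j).
  by rewrite derive1_rescale//; exact: smooth1_rise.
have b1 j s : `|derive1 (t j) s| <= C by rewrite dt; have [] := HC ((s - 1) / e j).
have b2 j s : `|derive1 (derive1 (t j)) s| <= (e j)^-1 * C.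
  rewrite derive2_rescale//; last exact: smooth1_rise.
  rewrite normrM gtr0_norm ?invr_gt0//; apply: ler_wpM2l.
    by rewrite invr_ge0 ltW.
  exact: (HC ((s - 1) / e j)).2.
have z1 (x : 'rV[R]_n) : `|1 : R| <= 1 by rewrite normr1.
have z2 i (x : 'rV[R]_n) : `|partial i (fun=> 1) x| <= 1 :> R.
  by rewrite (partialE (is_derive_cst (1 : R) _ _)) normr0.
have W j := W0_chain Wu (st j) (t0 j) (b1 j) (b2 j) (@smooth_cst R n 1) z1 z2.
have mu1 : measurable_fun Omega u by case: su.
have mt j : measurable_fun Omega (fun x => t j (u x)).
  apply: measurableT_comp => //.
  by apply: continuous_measurable_fun; exact: smooth1_continuous.
have mdt j : measurable_fun Omega (fun x => derive1 (t j) (u x)).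
  apply: measurableT_comp => //.
  by apply: continuous_measurable_fun; exact: smooth1_continuous (smooth1_derive (st j)).2.
have mpos : measurable_fun Omega (fun x => pos_part (u x - 1)).
  by apply: measurable_maxr => //; exact: measurable_funB.
have m1u : measurable_fun Omega (fun x => (1 < u x)%R%:R : R).
  apply: (eq_measurable_fun (\1_(above1 Omega u) : _ -> R)).
    move=> x; rewrite inE => Ox; rewrite indicE; congr (_%:R).
    have [h|h] := boolP (1 < u x)%R; first by rewrite mem_set.
    by rewrite memNset// => -[_]; exact/negP.
  by apply: measurable_indic; exact: measurable_above1.
apply: (W0_lim W).
- apply: (@L2cvg_dominated _ _ _ mu Omega mO _ _ (fun x => u x - 1)) => //.
  + by move=> j; under eq_fun do rewrite mul1r; exact: mt.
  + apply: sqintB => //; apply: (sqint_bounded mO fO (M := 1)) => // x _.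
    by rewrite normr1.
  + by move=> x _; under eq_fun do rewrite mul1r; exact: rise_cvg.
  + move=> j x _; rewrite mul1r /t /rescale normrM (gtr0_norm (e0 j)).
    rewrite mulrC -ler_pdivlMr//; apply: le_trans (rise_bound _) _.
    by rewrite normrM normfV (gtr0_norm (e0 j)).
- move=> i; apply: (@L2cvg_dominated _ _ _ mu Omega mO _ _ (fun x => C * g x 0 i)) => //.
  + move=> j; apply: (eq_measurable_fun (fun x => derive1 (t j) (u x) * g x 0 i)).
      move=> x _; rewrite mxE (partialE (is_derive_cst (1 : R) _ _)).
      by rewrite mul0r add0r mul1r.
    by apply: measurable_funM => //; case: (sg i).
  + apply: (eq_measurable_fun (fun x => (1 < u x)%R%:R * g x 0 i)).
      by move=> x _; rewrite mxE.
    by apply: measurable_funM => //; case: (sg i).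
  + exact: sqintZ.
  + move=> x _.
    rewrite (_ : (fun j => _) = fun j => derive1 rise ((u x - 1) / e j) * g x 0 i).
      by rewrite mxE; apply: cvgMl; rewrite -subr_gt0; exact: derive1_rise_cvg.
    apply/funext => j; rewrite mxE (partialE (is_derive_cst (1 : R) _ _)).
    by rewrite mul0r add0r mul1r dt.
  + move=> j x _; rewrite mxE (partialE (is_derive_cst (1 : R) _ _)).
    by rewrite mul0r add0r mul1r !normrM ler_wpM2r// (gtr0_norm C0).
Qed.

End H10_theory.

(** * The functional and the Nehari manifold *)

Section powR_inequalities.
Context {R : realType}.
Implicit Types (x y s p : R).

(** Convexity, obtained from Young's inequality for [x] and [y^(p-1)] with exponents [p] and
    [p/(p-1)]. *)
Lemma powR_tangent p x y : 1 < p -> 0 <= x -> 0 <= y ->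
  y `^ p + p * y `^ (p - 1) * (x - y) <= x `^ p.
Proof.
move=> p1 x0 y0; have p0 : 0 < p by lra.
have pm : 0 < p - 1 by lra.
have q0 : 0 < p / (p - 1) by rewrite divr_gt0.
have pq : p^-1 + (p / (p - 1))^-1 = 1 by field; rewrite !gt_eqF.
have := conjugate_powR x0 (powR_ge0 y (p - 1)) p0 q0 pq.
rewrite -powRrM mulrCA divff ?gt_eqF// mulr1 => H.
have E := mulr_powRB1 y0 p0.
have {}H : p * (x * y `^ (p - 1)) <= x `^ p + (p - 1) * y `^ p.
  have -> : x `^ p + (p - 1) * y `^ p = p * (x `^ p / p + y `^ p / (p / (p - 1))).
    by field; rewrite !gt_eqF.
  by rewrite ler_pM2l.
by nra.
Qed.

(** The energy along a ray, normalized, is largest at [s = 1]: apply the tangent inequality of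
    exponent [p/2] to [s^2] at the point [1]. *)
Lemma powR_sqr_bound p s : 2 < p -> 0 <= s ->
  s ^+ 2 / 2 - s `^ p / p <= 2^-1 - p^-1.
Proof.
move=> p2 s0; have p21 : 1 < p / 2 by lra.
have := powR_tangent p21 (sqr_ge0 s) ler01.
rewrite !powR1 mulr1 -(powR_mulrn 2 s0) -powRrM.
have -> : 2%:R * (p / 2) = p by field.
rewrite powR_mulrn// => H.
have p0 : 0 < p by lra.
have -> : s ^+ 2 / 2 - s `^ p / p = (p * s ^+ 2 / 2 - s `^ p) / p.
  by field; rewrite gt_eqF.
have -> : 2^-1 - p^-1 = (p / 2 - 1) / p by field; rewrite gt_eqF.
by rewrite ler_pM2r ?invr_gt0//; nra.
Qed.

Lemma powR_le p x y : 0 <= p -> 0 <= x -> x <= y -> x `^ p <= y `^ p.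
Proof. by move=> p0 x0 xy; rewrite ge0_ler_powR// nnegrE (le_trans x0). Qed.

Lemma powR_add_bound p x y : 0 <= p -> 0 <= x -> 0 <= y ->
  (x + y) `^ p <= 2 `^ p * (x `^ p + y `^ p).
Proof.
move=> p0 x0 y0; have [xy|yx] := leP x y.
  apply: (@le_trans _ _ ((2 * y) `^ p)); first by apply: powR_le => //; lra.
  by rewrite powRM// ler_wpM2l ?powR_ge0// lerDr powR_ge0.
apply: (@le_trans _ _ ((2 * x) `^ p)); first by apply: powR_le => //; lra.
by rewrite powRM// ler_wpM2l ?powR_ge0// lerDl powR_ge0.
Qed.

End powR_inequalities.

(** * Energy and constraint expressed with real integrals *)

Section Nehari_competitors.
Context {R : realType} {N : nat}.
Hypothesis hN : (3 <= N)%N.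
Variables (Omega : set 'rV[R]_N) (lambda kappa : R).
Hypothesis oO : open Omega.
Hypothesis fO : (lebesgue_rV N Omega < +oo)%E.
Hypothesis kappa0 : 0 < kappa.
Local Notation mu := (@lebesgue_rV R N).
Local Notation p := (crit R N).
Implicit Types (u v : 'rV[R]_N -> R) (g h : 'rV[R]_N -> 'rV[R]_N).

Let mO : measurable Omega := rV_open_measurable oO.

Lemma crit_gt2 : 2 < p.
Proof.
have N3 : 3 <= N%:R :> R by rewrite ler_nat.
by rewrite /crit ltr_pdivlMr; lra.
Qed.

Definition gsq (y : 'rV[R]_N) : R := \sum_i y 0 i ^+ 2.

Lemma gsq_ge0 y : 0 <= gsq y.
Proof. by apply: sumr_ge0 => i _; exact: sqr_ge0. Qed.

Lemma grad2E u x : grad2 Omega u x = gsq (grad Omega u x).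
Proof. by rewrite /grad2 /eucl_norm sqr_sqrtr// gsq_ge0. Qed.

Lemma gsqZ (c : R) y : gsq (c *: y) = c ^+ 2 * gsq y.
Proof.
by rewrite /gsq mulr_sumr; apply: eq_bigr => i _; rewrite !mxE exprMn.
Qed.

Lemma gsq0 : gsq 0 = 0.
Proof. by rewrite /gsq big1// => i _; rewrite mxE expr0n. Qed.

Definition chi u x : R := (1 < u x)%R%:R.
Definition vpos u x : R := pos_part (u x - 1).

Lemma vpos_ge0 u x : 0 <= vpos u x.
Proof. by rewrite /vpos /pos_part le_max lexx orbT. Qed.

Lemma vpos_gt u x : 1 < u x -> vpos u x = u x - 1.
Proof. by move=> h; rewrite /vpos /pos_part max_l// subr_ge0 ltW. Qed.

Lemma vpos_le u x : u x <= 1 -> vpos u x = 0.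
Proof. by move=> h; rewrite /vpos /pos_part max_r// subr_le0. Qed.

Local Notation "f \in_L1" := (mu.-integrable Omega (EFin \o f)) (at level 2).
Local Notation "\I f" := (Rintegral mu Omega f) (at level 10, f at level 9).

Lemma gsq_L1 g : (forall i, sqint mu Omega (fun x => g x 0 i)) ->
  (fun x => gsq (g x)) \in_L1.
Proof.
move=> sg; rewrite /gsq; elim: (index_enum _) => [|i r IH].
  under [in X in _.-integrable _ X]eq_fun do rewrite big_nil.
  exact: L1_cst.
rewrite (_ : (fun x => \sum_(j <- i :: r) g x 0 j ^+ 2) =
    (fun x => g x 0 i ^+ 2 + \sum_(j <- r) g x 0 j ^+ 2)).
  apply: L1D => //; exact: sqint_L1.
by apply/funext => x; rewrite big_cons.
Qed.

Lemma measurable_chi u : measurable_fun Omega u -> measurable_fun Omega (chi u).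
Proof.
move=> mu1; apply: (eq_measurable_fun (\1_(above1 Omega u) : _ -> R)).
  move=> x; rewrite inE => Ox; rewrite indicE /chi; congr (_%:R).
  have [h|h] := boolP (1 < u x)%R; first by rewrite mem_set.
  by rewrite memNset// => -[_]; exact/negP.
by apply: measurable_indic; exact: measurable_above1.
Qed.

Lemma chi_bound u x : `|chi u x| <= 1.
Proof. by rewrite /chi; case: (_ < _); rewrite ?normr1 ?normr0. Qed.

Lemma L1_boundedM (f b : 'rV[R]_N -> R) (M : R) : measurable_fun Omega b ->
  (forall x, Omega x -> `|b x| <= M) -> f \in_L1 -> (fun x => b x * f x) \in_L1.
Proof.
move=> mb bM If; have mf := L1_measurable If.
apply: (L1_le mO (g := fun x => M * `|f x|)).
- exact: measurable_funM.
- apply: L1Z => //; have := integrable_abse If.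
  by rewrite (_ : abse \o _ = EFin \o (fun x => `|f x|)).
- by move=> x Ox; rewrite normrM ler_wpM2r//; exact: bM.
Qed.

Lemma chi_L1 u (f : 'rV[R]_N -> R) : measurable_fun Omega u -> f \in_L1 ->
  (fun x => chi u x * f x) \in_L1.
Proof.
move=> mu1; apply: (L1_boundedM (M := 1)); first exact: measurable_chi.
by move=> x _; exact: chi_bound.
Qed.

Lemma chi1_L1 u : measurable_fun Omega u -> (chi u) \in_L1.
Proof.
move=> mu1; apply: measurable_bounded_integrable => //; first exact: measurable_chi.
exists 1; split; first exact: num_real.
by move=> y y1 x _ /=; rewrite (le_trans (chi_bound u x))// ltW.
Qed.

Lemma sqint_vpos u : sqint mu Omega u -> sqint mu Omega (vpos u).
Proof.
move=> su; apply: L1_sqint.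
  apply: measurable_maxr => //; apply: measurable_funB => //; by case: su.
apply: (L1_le mO (g := fun x => (u x - 1) ^+ 2)).
- apply: measurable_funX; apply: measurable_maxr => //; apply: measurable_funB => //.
  by case: su.
- apply: sqint_L1 => //; apply: sqintB => //.
  by apply: (sqint_bounded mO fO (M := 1)) => // x _; rewrite normr1.
- move=> x _; rewrite ger0_norm ?sqr_ge0//.
  have [h|h] := ltP 1 (u x); first by rewrite vpos_gt.
  by rewrite vpos_le// expr0n sqr_ge0.
Qed.

Lemma integral_above1 u (f : 'rV[R]_N -> R) :
  (\int[mu]_(x in above1 Omega u) (f x)%:E = \int[mu]_(x in Omega) (chi u x * f x)%:E)%E.
Proof.
rewrite (_ : above1 Omega u = Omega `&` [set x | 1 < u x])//.
rewrite integral_mkcondr; apply: eq_integral => x _; rewrite patchE /chi.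
have [h|h] := boolP (1 < u x)%R; first by rewrite mem_set// mul1r.
by rewrite memNset ?mul0r//; exact/negP.
Qed.

(** Competitors come with an explicit gradient, which agrees with the one chosen by [grad] only
    almost everywhere; the energy may be computed with either. *)
Lemma J_real u g : W0 Omega u g -> (fun x => vpos u x `^ p) \in_L1 ->
  J Omega lambda kappa u =
  (2^-1 * \I (fun x => gsq (g x)) + \I (chi u)
   - lambda / 2 * \I (fun x => vpos u x ^+ 2)
   - kappa / p * \I (fun x => vpos u x `^ p))%:E.
Proof.
move=> Wu Ip; have su := W0_sqint Wu; have sg := W0_sqint_grad Wu.
have mu1 : measurable_fun Omega u by case: su.
have Wh := H10_W0 oO fO (W0_H10 oO fO Wu).
have Ig := gsq_L1 sg; have Igr := gsq_L1 (W0_sqint_grad Wh).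
have Iv := sqint_L1 (sqint_vpos su).
pose F y x := 2^-1 * gsq (y x) + chi u x - lambda / 2 * vpos u x ^+ 2
   - kappa / p * vpos u x `^ p.
have IF y : (fun x => gsq (y x)) \in_L1 -> (F y) \in_L1.
  move=> Iy; apply: L1B => //; last exact: L1Z.
  apply: L1B => //; last exact: L1Z.
  by apply: L1D; [|exact: L1Z|exact: chi1_L1].
transitivity (\int[mu]_(x in Omega) (F (grad Omega u) x)%:E)%E.
  apply: eq_integral => x; rewrite inE => Ox; congr (_%:E).
  rewrite /F grad2E; congr (_ + _ - _ - _).
  rewrite indicE /chi; congr (_%:R).
  have [h|h] := boolP (1 < u x)%R; first by rewrite mem_set.
  by rewrite memNset// => -[_]; exact/negP.
transitivity (\int[mu]_(x in Omega) (F g x)%:E)%E.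
  apply: ae_eq_integral => //.
  - by apply/measurable_EFinP; exact: L1_measurable (IF _ Igr).
  - by apply/measurable_EFinP; exact: L1_measurable (IF _ Ig).
  have : {ae mu, forall x i, Omega x -> grad Omega u x 0 i = g x 0 i}.
    by apply: filter_forall => i; exact: (W0_grad oO fO Wu i).
  apply: filterS => x H Ox; congr (_%:E); rewrite /F; congr (_ * _ + _ - _ - _).
  by apply: eq_bigr => i _; rewrite H.
rewrite -(EFin_Rintegral mO (IF _ Ig)); congr (_%:E).
rewrite /F RintegralB//; [|by apply: L1B => //; [apply: L1D => //; [exact: L1Z|exact: chi1_L1]|exact: L1Z]|exact: L1Z].
rewrite RintegralB//; [|by apply: L1D => //; [exact: L1Z|exact: chi1_L1]|exact: L1Z].
rewrite RintegralD//; [|exact: L1Z|exact: chi1_L1].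
by rewrite !RintegralZl.
Qed.

Lemma chi_vpos_sqr u x : chi u x * (u x - 1) ^+ 2 = vpos u x ^+ 2.
Proof.
rewrite /chi; have [h|h] := ltP 1 (u x); first by rewrite mul1r vpos_gt.
by rewrite vpos_le// mul0r expr0n.
Qed.

Lemma chi_vpos_powR u x : chi u x * (u x - 1) `^ p = vpos u x `^ p.
Proof.
rewrite /chi; have [h|h] := ltP 1 (u x); first by rewrite mul1r vpos_gt.
by rewrite vpos_le// mul0r powR0// gt_eqF// (lt_trans _ crit_gt2).
Qed.

Lemma Nehari_intro u g : W0 Omega u g -> (fun x => vpos u x `^ p) \in_L1 ->
  \I (fun x => chi u x * gsq (g x)) - lambda * \I (fun x => vpos u x ^+ 2) =
    kappa * \I (fun x => vpos u x `^ p) ->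
  0 < kappa * \I (fun x => vpos u x `^ p) ->
  Nehari Omega lambda kappa u.
Proof.
move=> Wu Ip E pos; have su := W0_sqint Wu; have sg := W0_sqint_grad Wu.
have mu1 : measurable_fun Omega u by case: su.
have H := W0_H10 oO fO Wu; have Wh := H10_W0 oO fO H.
have Ig := gsq_L1 sg; have Igr := gsq_L1 (W0_sqint_grad Wh).
have Iv := sqint_L1 (sqint_vpos su).
have Ep : (\int[mu]_(x in above1 Omega u) (((u x - 1) `^ p)%R%:E) =
    (\I (fun x => vpos u x `^ p))%:E)%E.
  rewrite integral_above1 (EFin_Rintegral mO Ip).
  by apply: eq_integral => x _; rewrite chi_vpos_powR.
have IF y : (fun x => gsq (y x)) \in_L1 ->
    (fun x => chi u x * gsq (y x) - lambda * vpos u x ^+ 2) \in_L1.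
  by move=> Iy; apply: L1B => //; [exact: chi_L1|exact: L1Z].
split=> //; last by rewrite Ep -EFinM lte_fin.
rewrite Ep -EFinM -E integral_above1.
transitivity (\int[mu]_(x in Omega)
    (chi u x * gsq (g x) - lambda * vpos u x ^+ 2)%:E)%E; last first.
  rewrite -(EFin_Rintegral mO (IF _ Ig)); congr (_%:E).
  by rewrite RintegralB//; [rewrite RintegralZl|exact: chi_L1|exact: L1Z].
transitivity (\int[mu]_(x in Omega)
    (chi u x * gsq (grad Omega u x) - lambda * vpos u x ^+ 2)%:E)%E.
  apply: eq_integral => x _; congr (_%:E).
  by rewrite -chi_vpos_sqr grad2E; ring.
apply: ae_eq_integral => //.
- by apply/measurable_EFinP; exact: L1_measurable (IF _ Igr).
- by apply/measurable_EFinP; exact: L1_measurable (IF _ Ig).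
have : {ae mu, forall x i, Omega x -> grad Omega u x 0 i = g x 0 i}.
  by apply: filter_forall => i; exact: (W0_grad oO fO Wu i).
apply: filterS => x G Ox; congr (_%:E); congr (_ * _ - _).
by apply: eq_bigr => i _; rewrite G.
Qed.

Lemma Nehari_elim u : Nehari Omega lambda kappa u ->
  let g := grad Omega u in
  [/\ W0 Omega u g, (fun x => vpos u x `^ p) \in_L1,
  \I (fun x => chi u x * gsq (g x)) - lambda * \I (fun x => vpos u x ^+ 2) =
    kappa * \I (fun x => vpos u x `^ p) &
  0 < kappa * \I (fun x => vpos u x `^ p)].
Proof.
move=> [H E pos] g; have Wu : W0 Omega u g by exact: H10_W0.
have su := W0_sqint Wu; have sg := W0_sqint_grad Wu.
have mu1 : measurable_fun Omega u by case: su.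
have Ig := gsq_L1 sg.
have Iv := sqint_L1 (sqint_vpos su).
have EP : (\int[mu]_(x in above1 Omega u) (((u x - 1) `^ p)%R%:E) =
    \int[mu]_(x in Omega) (vpos u x `^ p)%:E)%E.
  by rewrite integral_above1; apply: eq_integral => x _; rewrite chi_vpos_powR.
have IF : (fun x => chi u x * gsq (g x) - lambda * vpos u x ^+ 2) \in_L1.
  by apply: L1B => //; [exact: chi_L1|exact: L1Z].
have EA : (\int[mu]_(x in above1 Omega u)
    ((grad2 Omega u x - lambda * (u x - 1) ^+ 2)%R%:E) =
    (\I (fun x => chi u x * gsq (g x)) - lambda * \I (fun x => vpos u x ^+ 2))%:E)%E.
  rewrite integral_above1 -RintegralZl// -RintegralB//; [|exact: chi_L1|exact: L1Z].
  rewrite (EFin_Rintegral mO IF); apply: eq_integral => x _; congr (_%:E).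
  by rewrite -chi_vpos_sqr grad2E; ring.
rewrite EA EP in E; rewrite EP in pos.
(* If the integral were infinite, so would be the right side of the constraint, while its left side
   is a real number. *)
have Ip : (fun x => vpos u x `^ p) \in_L1.
  apply/integrableP; split.
    apply/measurable_EFinP.
    exact: (measurableT_comp (measurable_powR _) (proj1 (sqint_vpos su))).
  under eq_integral do rewrite /= ger0_norm ?powR_ge0//.
  rewrite ltNge leye_eq; apply/negP => /eqP Ey.
  by move: E; rewrite Ey gt0_muley ?lte_fin.
split=> //.
- by apply: EFin_inj; rewrite E EFinM (EFin_Rintegral mO Ip).
- by move: pos; rewrite -(EFin_Rintegral mO Ip) -EFinM lte_fin.
Qed.

End Nehari_competitors.

(** * The mean value inequality *)

Section radial.
Context {R : realType} {N : nat}.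
Local Notation mu := (@lebesgue_rV R N).
Implicit Types (c x : 'rV[R]_N) (f T : R -> R).

Lemma smooth1_lin_comp f (a : R) : smooth1 f -> smooth1 (fun t => f (1 - a * t)).
Proof.
move=> sf; apply: (smooth1_ext _ (smooth1_comp sf (smooth1_affine (- a) 1))) => t.
by rewrite mulNr addrC.
Qed.

Lemma is_derive_lin_comp f (a x : R) : smooth1 f ->
  is_derive x 1 (fun t => f (1 - a * t)) (- a * derive1 f (1 - a * x)).
Proof.
move=> sf; have [df _] := smooth1_derive sf.
have D1 : is_derive x 1 (fun t : R => 1 - a * t) (- a).
  apply: is_derive_val (is_deriveB (is_derive_cst (1 : R) x 1)
    (is_deriveZ a (is_derive_id x (1 : R)))) _ _ => //.
  by rewrite /GRing.scale/= mulr1 sub0r.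
apply: is_derive_val (is_derive1_comp (df _) D1) _ _ => //.
by rewrite /GRing.scale/= mulrC.
Qed.

Lemma derive1_lin_comp f (a : R) : smooth1 f ->
  derive1 (fun t => f (1 - a * t)) = (fun t => - a * derive1 f (1 - a * t)).
Proof.
by move=> sf; apply/funext => x; rewrite derive1E; have [_ ->] := is_derive_lin_comp a x sf.
Qed.

Lemma smooth_gsqB c : smooth (fun x => gsq (x - c)).
Proof.
rewrite /gsq; apply: smooth_sum => i; under eq_fun do rewrite !mxE expr2.
have H : smooth (fun x => x 0 i - c 0 i).
  by apply: smoothD; [exact: smooth_coord|exact: smooth_cst].
exact: smoothM.
Qed.

Lemma partial_gsqB c i x : partial i (fun y => gsq (y - c)) x = 2 * (x 0 i - c 0 i).
Proof.
apply: partialE; apply: (is_derive_near_line (g := fun t : R =>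
  t * t + (2 * (x 0 i - c 0 i)) * t + gsq (x - c))).
  move=> t; rewrite /gsq (bigD1 i)//= [in RHS](bigD1 i)//= !mxE !eqxx.
  rewrite (eq_bigr (fun j => (x - c) 0 j ^+ 2)); first by rewrite /= mulr1; ring.
  by move=> j /negbTE ji; rewrite !mxE ji andbF mulr0 add0r.
apply: is_derive_val (is_deriveD (is_deriveD
  (is_deriveM (is_derive_id (0 : R) (1 : R)) (is_derive_id (0 : R) (1 : R)))
  (is_deriveZ (2 * (x 0 i - c 0 i)) (is_derive_id (0 : R) (1 : R))))
  (is_derive_cst (gsq (x - c)) (0 : R) (1 : R))) _ _ => //.
by rewrite /GRing.scale/= !mulr1 !addr0 add0r.
Qed.

Lemma radial_laplacian T c x : smooth1 T ->
  \sum_i partial i (partial i (fun y => T (gsq (y - c)))) x =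
  4 * gsq (x - c) * derive1 (derive1 T) (gsq (x - c)) + 2 * N%:R * derive1 T (gsq (x - c)).
Proof.
move=> sT; have [_ sT'] := smooth1_derive sT; have sq := smooth_gsqB c.
rewrite (eq_bigr (fun i => 4 * derive1 (derive1 T) (gsq (x - c)) * (x - c) 0 i ^+ 2
  + 2 * derive1 T (gsq (x - c)))).
  by rewrite big_split/= -mulr_sumr -/(gsq (x - c)) sumr_const card_ord -mulr_natr; ring.
move=> i _.
have -> : partial i (fun y => T (gsq (y - c))) =
    fun y => derive1 T (gsq (y - c)) * (2 * (y 0 i - c 0 i)).
  by apply/funext => y; rewrite (partial_comp1 i y sT sq) partial_gsqB.
have sl : smooth (fun y : 'rV[R]_N => 2 * (y 0 i - c 0 i)).
  apply: smoothM; first exact: smooth_cst.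
  by apply: smoothD; [exact: smooth_coord|exact: smooth_cst].
rewrite (partialM i x (smooth_comp1 sT' sq) sl) (partial_comp1 i x sT' sq) partial_gsqB.
have -> : partial i (fun y : 'rV[R]_N => 2 * (y 0 i - c 0 i)) x = 2.
  apply: partialE; apply: (is_derive_near_line (g := fun t : R => 2 * t + 2 * (x 0 i - c 0 i))).
    by move=> t; rewrite !mxE !eqxx /= mulr1; ring.
  apply: is_derive_val (is_deriveD (is_deriveZ 2 (is_derive_id (0 : R) (1 : R)))
    (is_derive_cst (2 * (x 0 i - c 0 i)) (0 : R) (1 : R))) _ _ => //.
  by rewrite /GRing.scale/= mulr1 addr0.
by rewrite !mxE; ring.
Qed.

(* [kernel] is minus the derivative of the bump [flat1 (1 - t)]. *)
Definition kernel (t : R) : R := flat ('X ^+ 2) (1 - t).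

Lemma kernel_ge0 t : 0 <= kernel t.
Proof.
rewrite /kernel /flat; case: ifP => // t1.
by rewrite hornerXn mulr_ge0 ?sqr_ge0 ?expR_ge0.
Qed.

Lemma kernel_gt0 t : t < 1 -> 0 < kernel t.
Proof.
move=> t1; rewrite /kernel /flat subr_gt0 t1 hornerXn mulr_gt0 ?expR_gt0//.
by rewrite exprn_gt0// invr_gt0 subr_gt0.
Qed.

Lemma kernel_ge1 t : 1 <= t -> kernel t = 0.
Proof. by move=> t1; rewrite /kernel /flat ltNge subr_le0 t1. Qed.

Lemma kernel_lb t : 0 <= t -> t <= 2^-1 -> expR (- 2) <= kernel t.
Proof.
move=> t0 t1; have h : 0 < 1 - t by lra.
rewrite /kernel /flat h hornerXn.
have y1 : 1 <= (1 - t)^-1 by rewrite -[leLHS]invr1 lef_pV2 ?posrE//; lra.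
have y2 : (1 - t)^-1 <= 2 by rewrite -[leRHS]invrK lef_pV2 ?posrE ?invr_gt0//; lra.
rewrite -[leLHS]mul1r ler_pM ?expR_ge0 ?ler_expR ?lerN2//.
by rewrite exprn_ege1.
Qed.

Lemma kernel_bounded : exists2 C, 0 < C & forall t, kernel t <= C.
Proof.
have [C C0 HC] := poly_expR_bounded ('X ^+ 2 : {poly R}).
exists (C + 1); first by lra.
move=> t; rewrite /kernel /flat; case: ifP => [t1|_]; last by lra.
have := HC (1 - t)^-1; rewrite invr_ge0 (ltW t1) => /(_ isT).
by move=> /(le_trans (ler_norm _)); lra.
Qed.

Lemma flat_bounded (P : {poly R}) : exists2 C, 0 <= C & forall t, `|flat P t| <= C.
Proof.
have [C C0 HC] := poly_expR_bounded P.
exists C => // t; rewrite /flat; case: ifP => [t1|_]; last by rewrite normr0.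
by apply: HC; rewrite invr_ge0 ltW.
Qed.

Lemma derive1_flat (P : {poly R}) : derive1 (flat P) = flat ('X ^+ 2 * (P - P^`())).
Proof. by apply/funext => x; rewrite derive1E; have [_ ->] := is_derive_flat P x. Qed.

End radial.

(** * Kernel means of superharmonic functions *)

Section mean_value.
Context {R : realType} {N : nat}.
Hypothesis hN : (3 <= N)%N.
Variable Omega : set 'rV[R]_N.
Hypothesis oO : open Omega.
Hypothesis fO : (lebesgue_rV N Omega < +oo)%E.
Local Notation mu := (@lebesgue_rV R N).
Local Notation "f \in_L1" := (mu.-integrable Omega (EFin \o f)) (at level 2).
Local Notation "\I f" := (Rintegral mu Omega f) (at level 10, f at level 9).

Let mO : measurable Omega := rV_open_measurable oO.

Lemma indic_L1 (B : set 'rV[R]_N) : measurable B -> (\1_B : _ -> R) \in_L1.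
Proof.
move=> mB; apply: (L1_le mO (g := fun=> 1)).
- exact: measurable_indic.
- exact: L1_cst.
- by move=> x _; rewrite indicE; case: (_ \in _); rewrite ?normr1 ?normr0.
Qed.

Lemma Rintegral_indic (B : set 'rV[R]_N) : measurable B ->
  \I (\1_B) = fine (mu (B `&` Omega)).
Proof. by move=> mB; rewrite /Rintegral integral_indic. Qed.

Lemma Rintegral_ball (c : 'rV[R]_N) e : 0 < e -> ball c e `<=` Omega ->
  \I (\1_(ball c e)) = (e *+ 2) ^+ N.
Proof.
move=> e0 sub; have mB : measurable (ball c e).
  by apply: rV_open_measurable; exact: ball_open.
by rewrite Rintegral_indic// setIidl// lebesgue_ball.
Qed.

Lemma Rintegral_le_ball (f : 'rV[R]_N -> R) (c : 'rV[R]_N) e K : 0 < e -> 0 <= K ->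
  ball c e `<=` Omega -> f \in_L1 ->
  (forall x, Omega x -> ball c e x -> f x <= K) ->
  (forall x, Omega x -> ~ ball c e x -> f x <= 0) -> \I f <= K * (e *+ 2) ^+ N.
Proof.
move=> e0 K0 sub If fin fout; have mB : measurable (ball c e).
  by apply: rV_open_measurable; exact: ball_open.
rewrite -(Rintegral_ball e0 sub) -RintegralZl//; last exact: indic_L1.
apply: le_Rintegral => //; first by apply: L1Z => //; exact: indic_L1.
move=> x Ox; have [xB|xB] := pselect (ball c e x).
  by rewrite mem_set// mulr1; exact: fin.
by rewrite memNset// mulr0; exact: fout.
Qed.

(* [profile s |x - c|^2] is increasing in [s] in the mean against a superharmonic
   function, its [s]-derivative [profile1] being minus a multiple of a Laplacian. *)
Definition profile (s y : R) : R := s ^+ N * kernel (s ^+ 2 * y).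
Definition profile1 (s y : R) : R :=
  N%:R * s ^+ N.-1 * kernel (s ^+ 2 * y)
  - 2 * s ^+ N.-1 * (s ^+ 2 * y * derive1 (flat ('X ^+ 2)) (1 - s ^+ 2 * y)).

Lemma is_derive_profile (s y : R) : is_derive s 1 (fun t => profile t y) (profile1 s y).
Proof.
have sf : smooth1 (flat ('X ^+ 2 : {poly R})) := smooth1_flat _.
have D0 : is_derive s 1 (fun t : R => 1 - t * t * y) (- (2 * s * y)).
  apply: is_derive_val (is_deriveB (is_derive_cst (1 : R) s 1)
    (is_deriveM (is_deriveM (is_derive_id s (1 : R)) (is_derive_id s (1 : R)))
      (is_derive_cst y s (1 : R)))) _ _ => //.
  by rewrite /GRing.scale/=; ring.
have D1 := @is_derive1_comp _ (flat 'X^2) (fun t => 1 - t * t * y) s _ _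
  ((smooth1_derive sf).1 _) D0.
have D2 := is_deriveX N (is_derive_id s (1 : R)).
apply: is_derive_val (is_deriveM D2 D1) _ _.
  by apply/funext => t; rewrite /profile /kernel !fctE /= (expr2 t).
rewrite /profile1 /kernel /GRing.scale/= (expr2 s).
have -> : (id ^+ N) s = s ^+ N.-1 * s.
  by rewrite exprfctE -exprSr prednK ?(leq_trans _ hN).
by move: (flat _ _) (derive1 _ _) => a b; ring.
Qed.

(** With [y = x - c], the [s]-derivative of [s^N * kernel (s^2 |y|^2)] is [1/s] times the divergence
    of the field [y * s^N * kernel (s^2 |y|^2)], and this field is [- s^(N-2) / 2] times the
    gradient of the bump [flat1 (1 - s^2 |y|^2)]. *)
Lemma profile_laplacian (s : R) (c x : 'rV[R]_N) :
  s ^+ (N - 3) / 2 *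
    \sum_i partial i (partial i (fun y => flat1 (1 - s ^+ 2 * gsq (y - c)))) x
  = - profile1 s (gsq (x - c)).
Proof.
have sf : smooth1 (flat ('X ^+ 2 : {poly R})) := smooth1_flat _.
have df : derive1 (flat1 : R -> R) = flat ('X ^+ 2).
  by apply/funext => t; rewrite derive1E; have [_ ->] := is_derive_flat1 t.
rewrite (radial_laplacian (T := fun t => flat1 (1 - s ^+ 2 * t))); last first.
  exact: smooth1_lin_comp smooth1_flat1.
rewrite derive1_lin_comp ?df; last exact: smooth1_flat1.
have -> : derive1 (fun t => - s ^+ 2 * flat ('X ^+ 2) (1 - s ^+ 2 * t)) =
    (fun t => - s ^+ 2 * (- s ^+ 2 * derive1 (flat ('X ^+ 2)) (1 - s ^+ 2 * t))).
  apply/funext => t; rewrite derive1E; apply: derive_val.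
  apply: is_derive_val (is_deriveZ (- s ^+ 2) (is_derive_lin_comp (s ^+ 2) t sf)) _ _ => //.
have -> : profile1 s (gsq (x - c)) = s ^+ (N - 3) * (
    N%:R * s ^+ 2 * kernel (s ^+ 2 * gsq (x - c))
  - 2 * s ^+ 2 * (s ^+ 2 * gsq (x - c)
       * derive1 (flat ('X ^+ 2)) (1 - s ^+ 2 * gsq (x - c)))).
  rewrite /profile1; have H (n : nat) : (2 < n)%N -> n.-1 = (n - 3 + 2)%N.
    by case: n => [|[|[|n]]]// _; rewrite !subSS subn0 addn2.
  rewrite {}H//.
  by rewrite exprD; ring.
rewrite /kernel; by move: (flat _ _) (derive1 _ _) => a b; field.
Qed.

Lemma profile1_bounded (r : R) : 0 <= r ->
  exists2 C, 0 <= C & forall s y, 0 <= s <= r -> 0 <= y -> `|profile1 s y| <= C.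
Proof.
move=> r0; have [C1 C10 H1] := flat_bounded ('X ^+ 2 : {poly R}).
have [C2 C20 H2] := flat_bounded ('X ^+ 2 * ('X ^+ 2 - ('X ^+ 2)^`()) : {poly R}).
exists (N%:R * r ^+ N.-1 * C1 + 2 * r ^+ N.-1 * C2).
  by rewrite addr_ge0 ?mulr_ge0 ?exprn_ge0.
move=> s y /andP[s0 sr] y0; have sN : s ^+ N.-1 <= r ^+ N.-1 by rewrite lerXn2r// nnegrE.
have sN0 : 0 <= s ^+ N.-1 by rewrite exprn_ge0.
have t0 : 0 <= s ^+ 2 * y by rewrite mulr_ge0 ?sqr_ge0.
apply: (le_trans (ler_normB _ _)); apply: lerD; rewrite normrM.
  apply: ler_pM => //; last exact: H1.
  by rewrite ger0_norm ?ler_wpM2l// mulr_ge0.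
rewrite (ger0_norm (mulr_ge0 (ler0n _ 2) sN0)).
apply: ler_pM => //; [exact: mulr_ge0| by rewrite ler_wpM2l|].
rewrite derive1_flat normrM (ger0_norm t0).
have [t1|t1] := ltP (s ^+ 2 * y) 1; last first.
  by rewrite /flat ltNge subr_le0 t1/= normr0 mulr0.
by rewrite -[leRHS]mul1r ler_pM// ?(ltW t1)//; exact: H2.
Qed.

Lemma smooth1_profile1 (s : R) : smooth1 (profile1 s).
Proof.
have sf : smooth1 (flat ('X ^+ 2 : {poly R})) := smooth1_flat _.
have M1 (c : R) (f : R -> R) : smooth1 f -> smooth1 (fun y => c * f y).
  by move=> sF; apply: smooth1M => //; exact: smooth1_cst.
apply: (smooth1_ext (f := fun y =>
    N%:R * s ^+ N.-1 * flat ('X ^+ 2) (1 - s ^+ 2 * y)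
    + (- 2 * s ^+ N.-1) * (s ^+ 2 * y * derive1 (flat ('X ^+ 2)) (1 - s ^+ 2 * y)))).
  by move=> y; rewrite /profile1 /kernel !mulNr.
apply: smooth1D; apply: (M1 _); first exact: smooth1_lin_comp.
apply: smooth1M; first by apply: (M1 _); exact: smooth1_id.
by apply: smooth1_lin_comp; exact: (smooth1_derive sf).2.
Qed.

Lemma cut_L1 (w : 'rV[R]_N -> R) c (r : R) : w \in_L1 ->
  (fun x => w x * (gsq (x - c) <= r)%R%:R) \in_L1.
Proof.
move=> Iw; apply: (L1_ext mO (f := fun x => \1_[set y | gsq (y - c) <= r] x * w x)).
  by move=> x _; rewrite mulrC indicE; congr (_ * (nat_of_bool _)%:R); apply/idP/idP; rewrite inE.
apply: (L1_boundedM oO (M := 1)) => //.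
  apply: measurable_indic; apply: rV_closed_measurable.
  apply: (@closed_comp _ _ (fun y : 'rV[R]_N => gsq (y - c)) [set y : R | y <= r]); last exact: closed_le.
  by move=> x _; apply: smooth_continuous; exact: smooth_gsqB.
by move=> x _; rewrite indicE; case: (_ \in _); rewrite ?normr1 ?normr0.
Qed.

Section superharmonic.
Variables (A : set 'rV[R]_N) (w : 'rV[R]_N -> R).
Hypothesis AO : A `<=` Omega.
Hypothesis Iw : w \in_L1.
Hypothesis w0 : forall x, Omega x -> 0 <= w x.
Hypothesis super : forall phi, test_function A phi -> (forall x, 0 <= phi x) ->
  \I (fun x => w x * \sum_i partial i (partial i phi) x) <= 0.
Variables (c : 'rV[R]_N) (rho : R).
Hypothesis rho0 : 0 < rho.
Hypothesis rhoA : forall x, gsq (x - c) <= rho ^+ 2 -> A x.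

Let q x := gsq (x - c).
Let q_ge0 x : 0 <= q x. Proof. exact: gsq_ge0. Qed.
Let mq f : smooth1 f -> measurable_fun Omega (fun x => f (q x)).
Proof. by move=> sf; apply: smooth_measurable; exact: smooth_comp1 sf (smooth_gsqB c). Qed.

Let F s := \I (fun x => w x * profile s (q x)).

Let F_L1 s : 0 <= s -> (fun x => w x * profile s (q x)) \in_L1.
Proof.
move=> s0; have [C C0 HC] := @kernel_bounded R.
apply: (L1_ext mO (f := fun x => profile s (q x) * w x)) => [x _|]; first exact: mulrC.
apply: (L1_boundedM oO (M := s ^+ N * C)) => //.
  rewrite /profile /kernel; apply: (mq (f := fun y => s ^+ N * flat ('X ^+ 2) (1 - s ^+ 2 * y))).
  by apply: smooth1M; [exact: smooth1_cst|exact: smooth1_lin_comp (smooth1_flat _)].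
move=> x _; rewrite ger0_norm /profile ?mulr_ge0 ?exprn_ge0 ?kernel_ge0//.
by rewrite ler_wpM2l ?exprn_ge0.
Qed.

Let F_derive s : 0 < s ->
  derivable F s 1 /\ derive1 F s = \I (fun x => w x * profile1 s (q x)).
Proof.
move=> s0; have r0 : 0 <= 2 * s by lra.
have [C C0 HC] := profile1_bounded r0.
pose f s x := w x * profile s (q x).
have df (t : R) x : is_derive t 1 (f ^~ x) (w x * profile1 t (q x)).
  apply: is_derive_val (is_deriveZ (w x) (is_derive_profile t (q x))) _ _ => //.
have pf t x : partial1of2 f t x = w x * profile1 t (q x).
  by rewrite partial1of2E; have [_ ->] := df t x.
have Is : `]0, 2 * s[%classic s by rewrite /= in_itv/=; lra.
have intf t : `]0, 2 * s[%classic t -> (f t) \in_L1.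
  by rewrite /= in_itv/= => /andP[t0 _]; apply: F_L1; exact: ltW.
have derf t x : `]0, 2 * s[%classic t -> Omega x -> derivable (f ^~ x) t 1.
  by move=> _ _; have [] := df t x.
have G0 x : 0 <= C * `|w x| by rewrite mulr_ge0.
have IG : (fun x => C * `|w x|) \in_L1.
  by apply: L1Z => //; exact: (integrable_norm Iw).
have Gub t x : `]0, 2 * s[%classic t -> Omega x -> `|partial1of2 f t x| <= C * `|w x|.
  rewrite /= in_itv/= => /andP[t0 ts] _; rewrite pf normrM mulrC ler_wpM2r//.
  by apply: HC => //; rewrite !ltW.
split.
  exact: (derivable_under_integral mO Is intf derf G0 IG Gub).
rewrite (differentiation_under_integral mO Is intf derf G0 IG Gub).
by apply: eq_Rintegral => x _; exact: pf.
Qed.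

Let test_bump s : rho^-1 <= s -> test_function A (fun x => flat1 (1 - s ^+ 2 * q x)).
Proof.
move=> rs; have s0 : 0 < s by rewrite (lt_le_trans _ rs)// invr_gt0.
apply: (test_function_supp (K := [set x | q x <= rho ^+ 2])) => //.
- apply: (smooth_comp1 (smooth1_lin_comp (s ^+ 2) smooth1_flat1)).
  exact: smooth_gsqB.
- apply: (@subclosed_compact _ _ (ccube c rho)); last 2 first.
  + exact: compact_ccube.
  + move=> x /= qx i; rewrite -(ler_pXn2r (n := 2)) ?nnegrE ?(ltW rho0)//.
    rewrite real_normK ?num_real// (le_trans _ qx)// /q /gsq (bigD1 i)//= !mxE.
    by rewrite lerDl sumr_ge0// => j _; exact: sqr_ge0.
  + apply: (@closed_comp _ _ q [set y | y <= rho ^+ 2]); last exact: closed_le.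
    by move=> x _; apply: smooth_continuous; exact: smooth_gsqB.
- move=> x /= /negP; rewrite -ltNge => qx; apply: flat1_le0; rewrite subr_le0.
  have E : s ^+ 2 * rho ^+ 2 >= 1.
    rewrite -exprMn exprn_ege1// -[leLHS](mulVf (lt0r_neq0 rho0)).
    by rewrite ler_pM2r.
  by rewrite (le_trans E)// ler_pM2l ?exprn_gt0// ltW.
Qed.

(** For [s >= 1/rho] the bump is supported in the closed Euclidean ball of radius [rho], so it may
    be tested against [w]; [profile_laplacian] turns the outcome into the sign of the derivative of
    [F]. *)
Let F_incr s : rho^-1 <= s -> F rho^-1 <= F s.
Proof.
move=> rs; have ri : 0 < rho^-1 by rewrite invr_gt0.
apply: (@ger0_derive1_le_cc R F rho^-1 (s + 1)); rewrite ?in_itv/= ?lexx//.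
- by move=> t; rewrite in_itv/= => /andP[t1 _]; apply: (F_derive _).1; exact: lt_trans t1.
- move=> t; rewrite in_itv/= => /andP[t1 _]; have t0 := lt_trans ri t1.
  rewrite (F_derive t0).2.
  have [C C0 HC] := profile1_bounded (ltW t0).
  have tN : 0 < t ^+ (N - 3) / 2 by rewrite divr_gt0 ?exprn_gt0.
  have Ip : (fun x => w x * profile1 t (q x)) \in_L1.
    apply: (L1_ext mO (f := fun x => profile1 t (q x) * w x)) => [x _|]; first exact: mulrC.
    apply: (L1_boundedM oO (M := C) _ _ Iw) => [|x _]; last first.
      by apply: HC; rewrite ?lexx ?(ltW t0)//; exact: q_ge0.
    exact: mq (smooth1_profile1 t).
  have := super (test_bump (ltW t1)) (fun x => flat1_ge0 _).
  have -> : \I (fun x => w x * \sum_i partial i (partial i (fun y => flat1 (1 - t ^+ 2 * q y))) x)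
      = - (t ^+ (N - 3) / 2)^-1 * \I (fun x => w x * profile1 t (q x)).
    rewrite -RintegralZl//; apply: eq_Rintegral => x _.
    rewrite -[profile1 t (q x)]opprK -(profile_laplacian t c x).
    move: (\sum_i _) (gt_eqF tN) => S; move: (t ^+ (N - 3) / 2) => a /negbT a0.
    by field.
  by rewrite mulNr oppr_le0 pmulr_rge0 ?invr_gt0.
- apply: derivable_within_continuous => t; rewrite in_itv/= => /andP[t1 _].
  by apply: (F_derive _).1; exact: lt_le_trans t1.
- lra.
- by apply/andP; split => //; lra.
Qed.

(** Compare [F] at [1/rho] with [F] at a large [s]. At [1/rho] the kernel is at least [exp (-2)] on
    the half ball; at large [s] the mean only sees points where [w <= M]. The volume [(4/s)^N] of
    the cube of half-side [2/s] cancels [s^N] and leaves [4^N]. *)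
Lemma mean_value Ck M : 0 < Ck -> (forall t : R, kernel t <= Ck) ->
  (\forall x \near c, w x <= M) ->
  \I (fun x => w x * (q x <= rho ^+ 2 / 2)%R%:R) <= expR 2 * Ck * 4 ^+ N * rho ^+ N * M.
Proof.
move=> Ck0 HC /nbhs_ballP[e /= e0 He].
have Ac : A c by apply: rhoA; rewrite subrr gsq0 sqr_ge0.
have M0 : 0 <= M.
  by apply: le_trans (w0 (AO Ac)) _; apply: He; exact: ballxx.
have [d d0 Hd] : exists2 d, 0 < d & ball c d `<=` Omega.
  by have /nbhs_ballP[d /= d0 Hd] := oO (AO Ac); exists d.
pose t := Num.min e d; have t0 : 0 < t by rewrite lt_min e0.
(* With [2 / s <= t], the cube of half-side [2 / s] contains the support of the kernel and lies both
   in [Omega] and where [w <= M]. *)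
pose s := Num.max rho^-1 (2 / t).
have rs : rho^-1 <= s by rewrite le_max lexx.
have s0 : 0 < s by rewrite (lt_le_trans _ rs)// invr_gt0.
have st : 2 / s <= t.
  by rewrite ler_pdivrMr// mulrC -ler_pdivrMr// le_max lexx orbT.
have F1 : F s <= s ^+ N * Ck * M * ((2 / s) *+ 2) ^+ N.
  apply: (@Rintegral_le_ball _ c) => //.
  - by rewrite divr_gt0.
  - by rewrite !mulr_ge0 ?exprn_ge0 ?(ltW s0) ?(ltW Ck0).
  - apply: subset_trans Hd; apply: le_ball; apply: (le_trans st).
    by rewrite ge_min lexx orbT.
  - by apply: F_L1; exact: ltW.
  - move=> x Ox xb; rewrite mulrC; apply: ler_pM => //; rewrite ?w0//.
    + by rewrite mulr_ge0 ?exprn_ge0 ?kernel_ge0 ?(ltW s0).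
    + by rewrite ler_wpM2l ?exprn_ge0 ?(ltW s0).
    + by apply: He; apply: le_ball xb; rewrite (le_trans st)// ge_min lexx.
  - move=> x Ox xb; rewrite /profile kernel_ge1 ?mulr0//.
    rewrite leNgt; apply/negP => lt1; apply: xb; rewrite rV_ballE ?divr_gt0// => i /=.
    rewrite -(ltr_pXn2r (n := 2)) ?nnegrE ?divr_ge0 ?(ltW s0)//.
    rewrite real_normK ?num_real// expr_div_n ltr_pdivlMr ?exprn_gt0// mulrC.
    apply: (@le_lt_trans _ _ (s ^+ 2 * q x)); last by rewrite (lt_trans lt1)// -natrX ltr1n.
    rewrite ler_pM2l ?exprn_gt0// /q /gsq (bigD1 i)//= !mxE lerDl.
    by rewrite sumr_ge0// => j _; exact: sqr_ge0.
have F2 : \I (fun x => w x * (q x <= rho ^+ 2 / 2)%R%:R) <= expR 2 * rho ^+ N * F rho^-1.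
  rewrite -RintegralZl//; last by apply: F_L1; rewrite invr_ge0 ltW.
  apply: le_Rintegral => //.
  - exact: cut_L1.
  - by apply: L1Z => //; apply: F_L1; rewrite invr_ge0 ltW.
  move=> x Ox; rewrite mulrCA ler_wpM2l ?w0//; case: (leP (q x) _) => [qx|_]; last first.
    by rewrite /profile !mulr_ge0 ?expR_ge0 ?exprn_ge0 ?invr_ge0 ?kernel_ge0 ?(ltW rho0).
  rewrite /profile !exprVn.
  have -> : expR 2 * rho ^+ N * (rho ^- N * kernel (rho ^- 2 * q x)) = expR 2 * kernel (rho ^- 2 * q x).
    by rewrite -mulrA mulVKf// gt_eqF ?exprn_gt0.
  have E : expR 2 * expR (- 2) = 1 :> R by rewrite -expRD subrr expR0.
  rewrite (_ : true%:R = 1) // -[X in X <= _]E ler_pM2l ?expR_gt0//.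
  apply: kernel_lb; first by rewrite mulr_ge0 ?invr_ge0 ?exprn_ge0 ?(ltW rho0).
  by rewrite mulrC ler_pdivrMr ?exprn_gt0// mulrC.
apply: (le_trans F2); apply: (@le_trans _ _ (expR 2 * rho ^+ N * F s)).
  by rewrite ler_pM2l ?F_incr// mulr_gt0 ?expR_gt0 ?exprn_gt0.
apply: (@le_trans _ _ (expR 2 * rho ^+ N * (s ^+ N * Ck * M * (2 / s *+ 2) ^+ N))).
  by rewrite ler_pM2l// mulr_gt0 ?expR_gt0 ?exprn_gt0.
have -> : 2 / s *+ 2 = 4 * s^-1 by rewrite -mulr_natl mulrA -natrM.
by rewrite exprMn exprVn le_eqVlt; apply/orP; left; apply/eqP; field; rewrite expf_neq0// gt_eqF.
Qed.

End superharmonic.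
End mean_value.

(** * Truncations multiplied by test functions *)

Section test_composition.
Context {R : realType} {n : nat}.
Variable Omega : set 'rV[R]_n.
Hypothesis oO : open Omega.
Hypothesis fO : (lebesgue_rV n Omega < +oo)%E.
Local Notation mu := (@lebesgue_rV R n).
Local Notation "f \in_L1" := (mu.-integrable Omega (EFin \o f)) (at level 2).
Local Notation "\I f" := (Rintegral mu Omega f) (at level 10, f at level 9).

Let mO : measurable Omega := rV_open_measurable oO.

Lemma Rintegral_sum (I : Type) (r : seq I) (F : I -> 'rV[R]_n -> R) :
  (forall i, (F i) \in_L1) ->
  (fun x => \sum_(i <- r) F i x) \in_L1 /\
  \I (fun x => \sum_(i <- r) F i x) = \sum_(i <- r) \I (F i).
Proof.
move=> IF; elim: r => [|i r [Ir Er]].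
  split; first by apply: (L1_ext mO (f := fun=> 0)) => [x _|]; rewrite ?big_nil//; exact: L1_cst.
  rewrite big_nil /Rintegral integral0_eq// => x _; by rewrite big_nil.
have I1 : (fun x => F i x + \sum_(j <- r) F j x) \in_L1 by exact: L1D.
split; first by apply: (L1_ext mO _ I1) => x _; rewrite big_cons.
rewrite big_cons -Er -RintegralD//; apply: eq_Rintegral => x _.
by rewrite big_cons.
Qed.

Lemma test_bounds (A : set 'rV[R]_n) z : test_function A z ->
  exists Z, (forall x, `|z x| <= Z) /\ (forall i x, `|partial i z x| <= Z).
Proof.
move=> tz; have [Z0 H0] := test_function_bounded tz.
have /choice[Z HZ] i : exists Z, forall x, `|partial i z x| <= Z.
  exact: test_function_bounded (test_function_partial i tz).
have Zi i : 0 <= Z i by rewrite (le_trans _ (HZ i 0)).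
have Z00 : 0 <= Z0 by rewrite (le_trans _ (H0 0)).
exists (Z0 + \sum_i Z i); split=> [x|i x].
  by rewrite (le_trans (H0 x))// lerDl sumr_ge0.
rewrite (le_trans (HZ i x))// (bigD1 i)//= addrCA lerDl addr_ge0// sumr_ge0//.
Qed.

Definition tgrad (z : 'rV[R]_n -> R) x : 'rV[R]_n := \row_i partial i z x.

Definition cgrad (z : 'rV[R]_n -> R) (t : R -> R) u (g : 'rV[R]_n -> 'rV[R]_n) x : 'rV[R]_n :=
  \row_i (partial i z x * t (u x) + z x * (derive1 t (u x) * g x 0 i)).

(** [t 0] may be nonzero because [z] has compact support: [W0_chain] applies to [t - t 0], and the
    constant contributes a multiple of [z]. *)
Lemma W0_test_comp u g z (t : R -> R) (C C2 : R) : W0 Omega u g ->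
  test_function Omega z -> smooth1 t -> (forall s, `|derive1 t s| <= C) ->
  (forall s, `|derive1 (derive1 t) s| <= C2) ->
  W0 Omega (fun x => z x * t (u x)) (cgrad z t u g).
Proof.
move=> W tz st tC tC2; have [Z [Z1 Z2]] := test_bounds tz.
pose t1 s := t s - t 0.
have dt1 : derive1 t1 = derive1 t.
  apply/funext => s; rewrite derive1E; apply: derive_val.
  apply: is_derive_val (is_deriveB ((smooth1_derive st).1 s)
    (is_derive_cst (t 0) s (1 : R))) _ _ => //.
  by rewrite subr0.
have st1 : smooth1 t1 by apply: smooth1D => //; exact: smooth1_cst.
have Wc := @W0_chain _ _ _ oO fO u g t1 z C C2 Z W st1 (subrr _) _ _ (let: And3 s _ _ := tz in s) Z1 Z2.
rewrite dt1 in Wc; have {Wc} Wc := Wc tC tC2.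
apply: (W0_ext oO _ _ (W0D oO Wc (W0Z oO (t 0) (W0_test oO fO tz)))).
  by move=> x _; rewrite /t1; ring.
by move=> x _; apply/rowP => i; rewrite !mxE /t1; ring.
Qed.

End test_composition.

(** * Perturbations of a minimizer *)

Section minimizer.
Context {R : realType} {N : nat}.
Hypothesis hN : (3 <= N)%N.
Variables (Omega : set 'rV[R]_N) (lambda kappa : R).
Hypothesis oO : open Omega.
Hypothesis fO : (lebesgue_rV N Omega < +oo)%E.
Hypothesis lambda0 : 0 < lambda.
Hypothesis kappa0 : 0 < kappa.
Local Notation mu := (@lebesgue_rV R N).
Local Notation p := (crit R N).
Local Notation "f \in_L1" := (mu.-integrable Omega (EFin \o f)) (at level 2).
Local Notation "\I f" := (Rintegral mu Omega f) (at level 10, f at level 9).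

Let mO : measurable Omega := rV_open_measurable oO.
Variable u : 'rV[R]_N -> R.
Hypothesis uN : Nehari Omega lambda kappa u.
Hypothesis umin : J Omega lambda kappa u =
  ereal_inf [set J Omega lambda kappa v | v in Nehari Omega lambda kappa].
Local Notation A := (above1 Omega u).
Local Notation g := (grad Omega u).
Local Notation v := (vpos u).

Let AO : A `<=` Omega. Proof. by move=> x []. Qed.

Definition nehari_level : R := kappa * \I (fun x => v x `^ p).

Lemma Nehari_grad_level :
  \I (fun x => chi u x * gsq (g x)) - lambda * \I (fun x => v x ^+ 2) = nehari_level.
Proof. by have [] := Nehari_elim hN oO fO kappa0 uN. Qed.

Lemma nehari_level_gt0 : 0 < nehari_level.
Proof. by have [] := Nehari_elim hN oO fO kappa0 uN. Qed.

Lemma W0_u : W0 Omega u g.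
Proof. by have [] := Nehari_elim hN oO fO kappa0 uN. Qed.

Lemma vpos_powR_L1 : (fun x => v x `^ p) \in_L1.
Proof. by have [] := Nehari_elim hN oO fO kappa0 uN. Qed.

(* The competitors are [min (u, 1) + s (v - psi)], with [s] chosen to satisfy the
   Nehari constraint; by [decr_eq] the gradient of [v - psi] vanishes where
   [v - psi] does, so that this set contributes nothing to the energy. *)
Record decrement (psi : 'rV[R]_N -> R) (h : 'rV[R]_N -> 'rV[R]_N) : Prop := {
  decr_W0 : W0 Omega psi h ;
  decr_out : forall x, u x <= 1 -> psi x = 0 /\ h x = 0 ;
  decr_le : forall x, Omega x -> psi x <= v x ;
  decr_bounded : exists M, forall x, Omega x -> `|psi x| <= M ;
  decr_eq : forall x, Omega x -> 1 < u x -> psi x = v x -> h x = g x }.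

Definition decr_grad (h : 'rV[R]_N -> 'rV[R]_N) : R :=
  \I (fun x => chi u x * gsq (g x - h x)).
(** Together with [decr_b], the two sides of the Nehari constraint for the competitor with [s = 1].
    A general [s] multiplies them by [s^2] and [s^p], so the constraint reads [s^(p-2) = a / b]. *)
Definition decr_a psi h : R :=
  decr_grad h - lambda * \I (fun x => (v x - psi x) ^+ 2).
Definition decr_b psi : R := kappa * \I (fun x => (v x - psi x) `^ p).
(** The measure of the part of [{u > 1}] that the competitor lowers to the value [1], that is, what
    the characteristic function saves in [J]. *)
Definition decr_gain psi : R := \I (fun x => chi u x * (psi x == v x)%:R).

Lemma decr_powR_L1 psi h : decrement psi h -> (fun x => (v x - psi x) `^ p) \in_L1.
Proof.
move=> [W _ le [M HM] _]; have p2 := @crit_gt2 R N hN.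
have p0 : 0 <= p by rewrite (le_trans _ (ltW p2)).
apply: (L1_le mO (g := fun x => 2 `^ p * (v x `^ p + M `^ p))).
- apply: (measurableT_comp (measurable_powR _)).
  apply: measurable_funB; last by case: (W0_sqint W).
  by case: (sqint_vpos oO fO (W0_sqint W0_u)).
- by apply: L1Z => //; apply: L1D => //; [exact: vpos_powR_L1|exact: L1_cst].
- move=> x Ox; rewrite ger0_norm ?powR_ge0//.
  have := HM x Ox; rewrite ler_norml => /andP[Ml Mr].
  have M0 : 0 <= M by lra.
  apply: (@le_trans _ _ ((v x + M) `^ p)).
    by apply: powR_le => //; [rewrite subr_ge0; exact: le|lra].
  by apply: powR_add_bound => //; exact: vpos_ge0.
Qed.

Lemma sqint_decr psi h : decrement psi h -> sqint mu Omega (fun x => v x - psi x).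
Proof.
move=> [W _ _ _ _]; apply: sqintB => //; last exact: W0_sqint W.
exact: sqint_vpos (W0_sqint W0_u).
Qed.

Lemma decr_grad_L1 psi h : decrement psi h ->
  (fun x => chi u x * gsq (g x - h x)) \in_L1.
Proof.
move=> [W _ _ _ _]; apply: chi_L1 => //; first by case: (W0_sqint W0_u).
apply: (gsq_L1 oO fO (g := fun x => g x - h x)) => i.
apply: (sqint_ext mO _ (sqintB mO (W0_sqint_grad W0_u i) (W0_sqint_grad W i))).
by move=> x _; rewrite !mxE.
Qed.

(** * Constraint and energy of a competitor *)

Section competitor.
Variables (psi : 'rV[R]_N -> R) (h : 'rV[R]_N -> 'rV[R]_N).
Hypothesis D : decrement psi h.
Variable s : R.
Hypothesis s0 : 0 < s.

(** Since [u = min (u, 1) + v], this is [min (u, 1) + s (v - psi)], written as a linear combination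
    to which [W0D] and [W0Z] apply. *)
Definition competitor x : R := u x + ((s - 1) * v x + (- s) * psi x).
Definition competitor_grad x : 'rV[R]_N :=
  g x + ((s - 1) *: ((1 < u x)%R%:R *: g x) + (- s) *: h x).

Lemma W0_competitor : W0 Omega competitor competitor_grad.
Proof.
apply: W0D => //; first exact: W0_u.
apply: W0D => //; first by apply: W0Z => //; exact: W0_pos_part W0_u.
by apply: W0Z => //; case: D.
Qed.

Lemma competitor_gt x : 1 < u x -> competitor x = 1 + s * (v x - psi x).
Proof. by move=> ux; rewrite /competitor vpos_gt//; ring. Qed.

Lemma competitor_le x : u x <= 1 -> competitor x = u x.
Proof.
move=> ux; rewrite /competitor vpos_le//; have [_ /(_ x ux)[-> _] _ _ _] := D.
by rewrite !mulr0 !addr0.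
Qed.

Lemma competitor_grad_gt x : 1 < u x -> competitor_grad x = s *: (g x - h x).
Proof.
move=> ux; rewrite /competitor_grad ux scale1r scalerBr scaleNr addrA; congr (_ - _).
by rewrite -{1}[g x]scale1r -scalerDl; congr (_ *: _); ring.
Qed.

Lemma competitor_grad_le x : u x <= 1 -> competitor_grad x = g x.
Proof.
move=> ux; rewrite /competitor_grad ltNge ux/= scale0r scaler0 add0r.
by have [_ /(_ x ux)[_ ->] _ _ _] := D; rewrite scaler0 addr0.
Qed.

Lemma vpos_competitor x : Omega x -> vpos competitor x = s * (v x - psi x).
Proof.
move=> Ox; have [_ out le _ _] := D; have [ux|ux] := ltP 1 (u x).
  rewrite /vpos competitor_gt// addrAC subrr add0r /pos_part max_l//.
  by rewrite mulr_ge0 ?subr_ge0 ?(ltW s0)//; exact: le.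
by rewrite vpos_le ?competitor_le// vpos_le// (out x ux).1 subrr mulr0.
Qed.

Lemma chi_competitor x : Omega x ->
  chi competitor x = chi u x - chi u x * (psi x == v x)%:R.
Proof.
move=> Ox; have [_ _ le _ _] := D; rewrite /chi; have [ux|ux] := ltP 1 (u x).
  rewrite competitor_gt// mul1r.
  have := le x Ox; rewrite le_eqVlt; case: eqP => [->|_] /=.
    by rewrite !subrr mulr0 addr0 ltxx.
  by move=> lt; rewrite subr0 ltrDl mulr_gt0// subr_gt0.
by rewrite competitor_le// ltNge ux/= mul0r subr0.
Qed.

Lemma chi_gsq_competitor x : Omega x ->
  chi competitor x * gsq (competitor_grad x) = s ^+ 2 * (chi u x * gsq (g x - h x)).
Proof.
move=> Ox; have [_ _ _ _ eqv] := D; rewrite chi_competitor// /chi.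
have [ux|ux] := ltP 1 (u x); last by rewrite !mul0r subr0 !mul0r mulr0.
rewrite competitor_grad_gt// gsqZ !mul1r; case: eqP => [/eqv->//|_].
  by rewrite [g x - g x]subrr gsq0 !mulr0.
by rewrite subr0 mul1r.
Qed.

Lemma gsq_competitor x :
  gsq (competitor_grad x) = (gsq (g x) - chi u x * gsq (g x))
    + s ^+ 2 * (chi u x * gsq (g x - h x)).
Proof.
rewrite /chi; have [ux|ux] := ltP 1 (u x).
  by rewrite competitor_grad_gt// gsqZ !mul1r subrr add0r.
by rewrite competitor_grad_le// !mul0r subr0 mulr0 addr0.
Qed.

Lemma vpos_competitor_L1 : (fun x => vpos competitor x `^ p) \in_L1.
Proof.
apply: (L1_ext mO (f := fun x => s `^ p * (v x - psi x) `^ p)).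
  move=> x; rewrite inE => Ox; rewrite vpos_competitor// powRM ?(ltW s0)//.
  by rewrite subr_ge0; have [_ _ le _ _] := D; exact: le.
by apply: L1Z => //; exact: decr_powR_L1 D.
Qed.

Lemma integral_vpos_competitor : kappa * \I (fun x => vpos competitor x `^ p) =
  s `^ p * decr_b psi.
Proof.
rewrite /decr_b mulrCA -[in RHS]RintegralZl//; last exact: decr_powR_L1 D.
congr (_ * _); apply: eq_Rintegral => x; rewrite inE => Ox.
rewrite vpos_competitor// powRM ?(ltW s0)//.
by rewrite subr_ge0; have [_ _ le _ _] := D; exact: le.
Qed.

Lemma integral_vpos2_competitor : \I (fun x => vpos competitor x ^+ 2) =
  s ^+ 2 * \I (fun x => (v x - psi x) ^+ 2).
Proof.
rewrite -RintegralZl//; last by apply: sqint_L1; exact: sqint_decr D.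
apply: eq_Rintegral => x; rewrite inE => Ox.
by rewrite vpos_competitor// exprMn.
Qed.

Lemma Nehari_competitor : s ^+ 2 * decr_a psi h = s `^ p * decr_b psi ->
  0 < decr_b psi -> Nehari Omega lambda kappa competitor.
Proof.
move=> E b0; apply: (Nehari_intro hN oO fO W0_competitor vpos_competitor_L1).
  rewrite integral_vpos_competitor -E integral_vpos2_competitor /decr_a /decr_grad.
  rewrite (_ : \I (fun x => chi competitor x * gsq (competitor_grad x)) =
    s ^+ 2 * \I (fun x => chi u x * gsq (g x - h x))); first by ring.
  rewrite -RintegralZl//; last exact: decr_grad_L1 D.
  by apply: eq_Rintegral => x; rewrite inE => Ox; rewrite chi_gsq_competitor.
by rewrite integral_vpos_competitor mulr_gt0// powR_gt0.
Qed.

Lemma competitor_gain_L1 : (fun x => chi u x * (psi x == v x)%:R) \in_L1.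
Proof.
have Iw := chi1_L1 oO fO (proj1 (W0_sqint W0_competitor)).
apply: (L1_ext mO (f := fun x => chi u x - chi competitor x)).
  by move=> x; rewrite inE => Ox; rewrite chi_competitor//; ring.
by apply: L1B => //; apply: chi1_L1 => //; case: (W0_sqint W0_u).
Qed.

Lemma J_competitor : J Omega lambda kappa competitor =
  (2^-1 * (\I (fun x => gsq (g x)) - \I (fun x => chi u x * gsq (g x)))
   + \I (chi u) - decr_gain psi
   + s ^+ 2 / 2 * decr_a psi h - s `^ p / p * decr_b psi)%:E.
Proof.
have mu1 : measurable_fun Omega u by case: (W0_sqint W0_u).
have Ig := gsq_L1 oO fO (W0_sqint_grad W0_u).
have Icg := chi_L1 oO mu1 Ig.
have Ich := decr_grad_L1 D.
rewrite (J_real lambda kappa oO fO W0_competitor vpos_competitor_L1).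
congr (_%:E).
have -> : kappa / p * \I (fun x => vpos competitor x `^ p) = s `^ p / p * decr_b psi.
  by rewrite -mulrA (mulrC p^-1) mulrA integral_vpos_competitor; ring.
rewrite integral_vpos2_competitor.
have -> : \I (fun x => gsq (competitor_grad x)) =
    \I (fun x => gsq (g x)) - \I (fun x => chi u x * gsq (g x)) + s ^+ 2 * decr_grad h.
  rewrite /decr_grad -RintegralZl// -RintegralB// -RintegralD//.
  - by apply: eq_Rintegral => x _; rewrite gsq_competitor.
  - exact: L1B.
  - exact: L1Z.
have -> : \I (chi competitor) = \I (chi u) - decr_gain psi.
  have Iz := competitor_gain_L1.
  rewrite /decr_gain -RintegralB//; last exact: chi1_L1.
  by apply: eq_Rintegral => x; rewrite inE => Ox; exact: chi_competitor.
rewrite /decr_a; move: (\I (chi u)) (decr_grad h) (decr_gain psi) (decr_b psi) => I1 I2 I3 I4.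
by field; rewrite gt_eqF// (lt_trans _ (@crit_gt2 R N hN)).
Qed.

End competitor.

Lemma decr_gain_L1 psi h : decrement psi h ->
  (fun x => chi u x * (psi x == v x)%:R) \in_L1.
Proof. by move=> D; exact: competitor_gain_L1 D _ ltr01. Qed.

Lemma J_level : J Omega lambda kappa u =
  (2^-1 * (\I (fun x => gsq (g x)) - \I (fun x => chi u x * gsq (g x)))
   + \I (chi u) + (2^-1 - p^-1) * nehari_level)%:E.
Proof.
rewrite (J_real lambda kappa oO fO W0_u vpos_powR_L1); congr (_%:E).
have E := Nehari_grad_level; rewrite mulrBl -{1}E /nehari_level; field.
by rewrite gt_eqF// (lt_trans _ (@crit_gt2 R N hN)).
Qed.

(** The energies on [{u <= 1}] cancel. Subtracting [nehari_level] from both [decr_a] and [decr_b]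
    leaves the multiple [s^2/2 - s^p/p] of the level, which by [powR_sqr_bound] is at most what
    [J u] contains. *)
Lemma perturbation psi h : decrement psi h -> 0 < decr_a psi h -> 0 < decr_b psi ->
  exists s, [/\ 0 < s, s `^ (p - 2) = decr_a psi h / decr_b psi &
    decr_gain psi <= s ^+ 2 / 2 * (decr_a psi h - nehari_level)
      - s `^ p / p * (decr_b psi - nehari_level)].
Proof.
move=> D a0 b0; have p2 := @crit_gt2 R N hN; have p0 : 0 < p by lra.
pose s := (decr_a psi h / decr_b psi) `^ (p - 2)^-1.
have ab0 : 0 < decr_a psi h / decr_b psi by rewrite divr_gt0.
have s0 : 0 < s by rewrite powR_gt0.
have sp : s `^ (p - 2) = decr_a psi h / decr_b psi.
  by rewrite /s -powRrM mulVf ?powRr1 ?(ltW ab0)// gt_eqF// subr_gt0.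
exists s; split=> //.
have E : s ^+ 2 * decr_a psi h = s `^ p * decr_b psi.
  have -> : p = 2 + (p - 2) by ring.
  rewrite powRD; last by apply/implyP => _; rewrite gt_eqF.
  by rewrite powR_mulrn ?(ltW s0)// sp; field; rewrite gt_eqF.
have Nw := Nehari_competitor D s0 E b0.
have : (J Omega lambda kappa u <= J Omega lambda kappa (competitor psi s))%E.
  by rewrite umin; apply: ereal_inf_lbound; exists (competitor psi s).
rewrite J_level (J_competitor D s0) lee_fin.
have := powR_sqr_bound p2 (ltW s0); have := nehari_level_gt0; nra.
Qed.

Let Wu : W0 Omega u g := W0_u.
Let sv : sqint mu Omega v := sqint_vpos oO fO (W0_sqint Wu).
Let sg := W0_sqint_grad Wu.
Let Ivp := vpos_powR_L1.

Definition dot (y z : 'rV[R]_N) : R := \sum_i y 0 i * z 0 i.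

Lemma gsqB (y z : 'rV[R]_N) : gsq (y - z) = gsq y - 2 * dot y z + gsq z.
Proof.
rewrite /gsq /dot mulr_sumr -sumrB -big_split/=; apply: eq_bigr => i _.
by rewrite !mxE; ring.
Qed.

Lemma dotZr (c : R) (y z : 'rV[R]_N) : dot y (c *: z) = c * dot y z.
Proof. by rewrite /dot mulr_sumr; apply: eq_bigr => i _; rewrite mxE mulrCA. Qed.

Lemma dot0r (y : 'rV[R]_N) : dot y 0 = 0.
Proof. by rewrite /dot big1// => i _; rewrite mxE mulr0. Qed.

Lemma dot_L1 (y z : 'rV[R]_N -> 'rV[R]_N) :
  (forall i, sqint mu Omega (fun x => y x 0 i)) ->
  (forall i, sqint mu Omega (fun x => z x 0 i)) ->
  (fun x => dot (y x) (z x)) \in_L1.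
Proof.
move=> sy sz; rewrite /dot; elim: (index_enum _) => [|i r IH].
  apply: (L1_ext mO (f := fun=> 0)) => [x _|]; first by rewrite big_nil.
  exact: L1_cst.
apply: (L1_ext mO (f := fun x => y x 0 i * z x 0 i + \sum_(j <- r) y x 0 j * z x 0 j)).
  by move=> x _; rewrite big_cons.
by apply: L1D => //; exact: sqint_mul_L1.
Qed.

Lemma powR_pred_le (y : R) : 0 <= y -> y `^ (p - 1) <= 1 + y `^ p.
Proof.
move=> y0; have p2 := @crit_gt2 R N hN; have [y1|y1] := leP y 1.
  rewrite (@le_trans _ _ 1) ?lerDl ?powR_ge0//.
  by have := @powR_le R (p - 1) y 1 _ y0 y1; rewrite powR1; apply; lra.
rewrite (@le_trans _ _ (y `^ p)) ?lerDr//.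
by rewrite ler_powR ?(ltW y1)//; lra.
Qed.

Lemma powR_pred_L1 (f psi : 'rV[R]_N -> R) (M : R) : measurable_fun Omega f ->
  (forall x, Omega x -> 0 <= f x) -> (fun x => f x `^ p) \in_L1 ->
  measurable_fun Omega psi -> (forall x, Omega x -> `|psi x| <= M) ->
  (fun x => f x `^ (p - 1) * psi x) \in_L1.
Proof.
move=> mf f0 If mpsi psiM.
apply: (L1_ext mO (f := fun x => psi x * f x `^ (p - 1))) => [x _|]; first exact: mulrC.
apply: (L1_boundedM oO mpsi psiM).
apply: (L1_le mO (g := fun x => 1 + f x `^ p)).
- exact: (measurableT_comp (measurable_powR _) mf).
- by apply: L1D => //; exact: L1_cst.
- by move=> x Ox; rewrite ger0_norm ?powR_ge0// powR_pred_le// f0.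
Qed.

(** * Expansion of the two sides of the constraint *)

Section expansion.
Variables (psi : 'rV[R]_N -> R) (h : 'rV[R]_N -> 'rV[R]_N).
Hypothesis D : decrement psi h.

Let spsi := W0_sqint (decr_W0 D).
Let sh := W0_sqint_grad (decr_W0 D).
Let Ivd := decr_powR_L1 D.

Lemma decr_aE : decr_a psi h =
  nehari_level - 2 * \I (fun x => dot (g x) (h x)) + \I (fun x => gsq (h x))
  + 2 * lambda * \I (fun x => v x * psi x) - lambda * \I (fun x => psi x ^+ 2).
Proof.
have mu1 : measurable_fun Omega u by case: (W0_sqint Wu).
have Icg := chi_L1 oO mu1 (gsq_L1 oO fO sg).
have Id := dot_L1 sg sh; have Ih := gsq_L1 oO fO sh.
have Iv := sqint_L1 sv; have Ip := sqint_L1 spsi; have Ivpsi := sqint_mul_L1 mO sv spsi.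
rewrite -Nehari_grad_level /decr_a /decr_grad.
have -> : \I (fun x => chi u x * gsq (g x - h x)) =
    \I (fun x => chi u x * gsq (g x)) - 2 * \I (fun x => dot (g x) (h x))
    + \I (fun x => gsq (h x)).
  rewrite -RintegralZl// -RintegralB//; last by apply: L1Z.
  rewrite -RintegralD//; last by apply: L1B => //; exact: L1Z.
  apply: eq_Rintegral => x _; rewrite /chi; have [ux|ux] := ltP 1 (u x).
    by rewrite !mul1r gsqB.
  by rewrite (decr_out D ux).2 gsq0 dot0r !mul0r mulr0 subrr addr0.
have -> : \I (fun x => (v x - psi x) ^+ 2) =
    \I (fun x => v x ^+ 2) - 2 * \I (fun x => v x * psi x) + \I (fun x => psi x ^+ 2).
  rewrite -RintegralZl// -RintegralB//; last by apply: L1Z.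
  rewrite -RintegralD//; last by apply: L1B => //; exact: L1Z.
  by apply: eq_Rintegral => x _; ring.
ring.
Qed.

Lemma decr_b_ge :
  nehari_level - decr_b psi <= p * kappa * \I (fun x => v x `^ (p - 1) * psi x).
Proof.
have p2 := @crit_gt2 R N hN; have [M HM] := decr_bounded D.
have Ip1 : (fun x => v x `^ (p - 1) * psi x) \in_L1.
  apply: (powR_pred_L1 _ _ Ivp (proj1 spsi) HM); first by case: sv.
  by move=> x _; exact: vpos_ge0.
rewrite lerBlDr -lerBlDl /nehari_level /decr_b (mulrC p) -mulrA -mulrBr ler_pM2l//.
rewrite -RintegralZl// -RintegralB//; last exact: L1Z.
apply: le_Rintegral => //; first by apply: L1B => //; exact: L1Z.
move=> x Ox; rewrite (le_trans _ (powR_tangent (y := v x) _ _ _)) ?vpos_ge0//.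
- by lra.
- lra.
- by rewrite subr_ge0 (decr_le D).
Qed.

(** The tangent is now taken at [v - psi] instead of [v], which reverses the estimate of
    [decr_b_ge]. *)
Lemma decr_b_le : decr_b psi <=
  nehari_level - p * kappa * \I (fun x => (v x - psi x) `^ (p - 1) * psi x).
Proof.
have p2 := @crit_gt2 R N hN; have [M HM] := decr_bounded D.
have d0 x : Omega x -> 0 <= v x - psi x by move=> Ox; rewrite subr_ge0 (decr_le D).
have Ip1 : (fun x => (v x - psi x) `^ (p - 1) * psi x) \in_L1.
  by apply: (powR_pred_L1 _ d0 Ivd (proj1 spsi) HM); apply: measurable_funB;
    [case: sv|case: spsi].
rewrite lerBrDr /nehari_level /decr_b (mulrC p) -mulrA -mulrDr ler_pM2l//.
rewrite -RintegralZl// -RintegralD//; last exact: L1Z.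
apply: le_Rintegral => //; first by apply: L1D => //; exact: L1Z.
move=> x Ox; rewrite (le_trans _ (powR_tangent (y := v x - psi x) _ _ _)) ?vpos_ge0//.
- by lra.
- lra.
- exact: d0.
Qed.

Lemma decr_gain_ge0 : 0 <= decr_gain psi.
Proof.
apply: Rintegral_ge0 => x Ox; rewrite /chi.
by case: (_ < _); case: (_ == _); rewrite ?mulr1 ?mulr0.
Qed.

(** Substituting [s^p = s^2 * (a / b)] leaves a bracket free of [s]: [supersolution] uses only its
    sign, while [decr_gain_bound] estimates [s^2] separately. *)
Lemma decr_gain_le : 0 < decr_a psi h -> 0 < decr_b psi ->
  exists2 s, 0 < s /\ s `^ (p - 2) = decr_a psi h / decr_b psi &
  decr_gain psi <= s ^+ 2 * ((decr_a psi h - nehari_level) / 2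
    - (decr_a psi h / decr_b psi)
      * (decr_b psi - nehari_level) / p).
Proof.
move=> a0 b0; have [s [s0 sE le]] := perturbation D a0 b0.
exists s => //; apply: (le_trans le).
have -> : s `^ p = s ^+ 2 * (decr_a psi h / decr_b psi).
  rewrite -sE -powR_mulrn ?(ltW s0)// -powRD; last by apply/implyP => _; rewrite gt_eqF.
  by congr (_ `^ _); ring.
by rewrite le_eqVlt; apply/orP; left; apply/eqP; field; rewrite !gt_eqF// (lt_trans _ (@crit_gt2 R N hN)).
Qed.

End expansion.

(* Minimality against [psi = - e * phi], to first order in [e]. *)
Section supersolution.
Variables (phi : 'rV[R]_N -> R) (h : 'rV[R]_N -> 'rV[R]_N) (M : R).
Hypothesis Wphi : W0 Omega phi h.
Hypothesis phi_out : forall x, u x <= 1 -> phi x = 0 /\ h x = 0.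
Hypothesis phi_ge0 : forall x, Omega x -> 0 <= phi x.
Hypothesis phi_le : forall x, Omega x -> phi x <= M.

Let increment e : 0 < e -> decrement (fun x => (- e) * phi x) (fun x => (- e) *: h x).
Proof.
move=> e0; split.
- exact: W0Z.
- by move=> x /phi_out[-> ->]; rewrite mulr0 scaler0.
- by move=> x Ox; rewrite (@le_trans _ _ 0) ?vpos_ge0// mulNr oppr_le0 mulr_ge0 ?(ltW e0) ?phi_ge0.
- exists (e * M) => x Ox; rewrite mulNr normrN ger0_norm ?mulr_ge0 ?(ltW e0) ?phi_ge0//.
  by rewrite ler_pM2l// phi_le.
- move=> x Ox ux E; have : 0 < v x by rewrite vpos_gt// subr_gt0.
  by rewrite -E mulNr oppr_gt0 ltNge mulr_ge0 ?(ltW e0) ?phi_ge0.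
Qed.

Lemma supersolution :
  lambda * \I (fun x => v x * phi x) + kappa * \I (fun x => v x `^ (p - 1) * phi x)
  <= \I (fun x => dot (g x) (h x)).
Proof.
have p2 := @crit_gt2 R N hN; have p0 : 0 < p by lra.
have sphi := W0_sqint Wphi; have sh := W0_sqint_grad Wphi.
have L0 := nehari_level_gt0.
have nM x : Omega x -> `|phi x| <= M by move=> Ox; rewrite ger0_norm ?phi_ge0 ?phi_le.
have Ip1 : (fun x => v x `^ (p - 1) * phi x) \in_L1.
  apply: (powR_pred_L1 _ _ Ivp (proj1 sphi) nM); first by case: sv.
  by move=> x _; exact: vpos_ge0.
have I1 := decr_powR_L1 (increment ltr01).
have Iw : (fun x => (v x + phi x) `^ (p - 1) * phi x) \in_L1.
  apply: (powR_pred_L1 _ _ _ (proj1 sphi) nM).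
  - by apply: measurable_funD; [case: sv|case: sphi].
  - by move=> x Ox; rewrite addr_ge0 ?vpos_ge0 ?phi_ge0.
  - by apply: (L1_ext mO _ I1) => x _; rewrite mulN1r opprK.
set X := \I (fun x => dot (g x) (h x)); set V := \I (fun x => v x * phi x).
set Y := \I (fun x => v x `^ (p - 1) * phi x).
pose Q := \I (fun x => gsq (h x)); pose P := \I (fun x => phi x ^+ 2).
(* The tangent slope of [decr_b] grows with [e], so its value at [e = 1] serves for all [e <= 1]. *)
pose C := p * kappa * \I (fun x => (v x + phi x) `^ (p - 1) * phi x).
have Y0 : 0 <= Y.
  by apply: Rintegral_ge0 => x Ox; rewrite mulr_ge0 ?powR_ge0 ?phi_ge0.
have V0 : 0 <= V.
  by apply: Rintegral_ge0 => x Ox; rewrite mulr_ge0 ?vpos_ge0 ?phi_ge0.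
have Q0 : 0 <= Q by apply: Rintegral_ge0 => x _; exact: gsq_ge0.
have P0 : 0 <= P by apply: Rintegral_ge0 => x _; exact: sqr_ge0.
have C0 : 0 <= C.
  apply: mulr_ge0; first by apply: mulr_ge0; exact: ltW.
  by apply: Rintegral_ge0 => x Ox; rewrite mulr_ge0 ?powR_ge0 ?phi_ge0.
have aE e : 0 < e -> decr_a (fun x => (- e) * phi x) (fun x => (- e) *: h x)
    = nehari_level + 2 * e * X + e ^+ 2 * Q - 2 * lambda * e * V - lambda * e ^+ 2 * P.
  move=> e0; rewrite (decr_aE (increment e0)).
  have -> : \I (fun x => dot (g x) ((- e) *: h x)) = - e * X.
    rewrite -RintegralZl//; last exact: dot_L1.
    by apply: eq_Rintegral => x _; rewrite dotZr.
  have -> : \I (fun x => gsq ((- e) *: h x)) = e ^+ 2 * Q.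
    rewrite -RintegralZl//; last exact: gsq_L1.
    by apply: eq_Rintegral => x _; rewrite gsqZ sqrrN.
  have -> : \I (fun x => v x * (- e * phi x)) = - e * V.
    rewrite -RintegralZl//; last exact: sqint_mul_L1.
    by apply: eq_Rintegral => x _; ring.
  have -> : \I (fun x => (- e * phi x) ^+ 2) = e ^+ 2 * P.
    rewrite -RintegralZl//; last exact: sqint_L1.
    by apply: eq_Rintegral => x _; ring.
  ring.
have b_ge e : 0 < e -> nehari_level + p * kappa * e * Y <= decr_b (fun x => (- e) * phi x).
  move=> e0; have := decr_b_ge (increment e0).
  have -> : \I (fun x => v x `^ (p - 1) * (- e * phi x)) = - e * Y.
    by rewrite -RintegralZl//; apply: eq_Rintegral => x _; ring.
  lra.
have b_le e : 0 < e -> e <= 1 -> decr_b (fun x => (- e) * phi x) <= nehari_level + e * C.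
  move=> e0 e1; apply: (le_trans (decr_b_le (increment e0))).
  have I2 := decr_powR_L1 (increment e0).
  have I3 : (fun x => (v x - (- e) * phi x) `^ (p - 1) * (- e * phi x)) \in_L1.
    apply: (powR_pred_L1 _ _ I2 (M := e * M)).
    - apply: measurable_funB; first by case: sv.
      by case: (W0_sqint (decr_W0 (increment e0))).
    - by move=> x Ox; rewrite mulNr opprK addr_ge0 ?vpos_ge0 ?mulr_ge0 ?(ltW e0) ?phi_ge0.
    - by case: (W0_sqint (decr_W0 (increment e0))).
    - move=> x Ox; rewrite mulNr normrN normrM gtr0_norm// ler_pM2l//; exact: nM.
  have : - e * \I (fun x => (v x + phi x) `^ (p - 1) * phi x) <=
      \I (fun x => (v x - (- e) * phi x) `^ (p - 1) * (- e * phi x)).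
    rewrite -RintegralZl//; apply: le_Rintegral => //; first exact: L1Z.
    move=> x Ox; rewrite [leRHS]mulrCA !mulNr lerN2 ler_pM2l// ler_wpM2r ?phi_ge0//.
    apply: powR_le; first lra.
      by rewrite opprK addr_ge0 ?vpos_ge0 ?mulr_ge0 ?(ltW e0) ?phi_ge0.
    by rewrite opprK lerD2l ler_piMl ?phi_ge0.
  rewrite -(ler_pM2l (mulr_gt0 p0 kappa0)) /C; lra.
clearbody X V Y Q P C.
rewrite -lerBrDl; set Z := X - lambda * V.
rewrite leNgt; apply/negP => ltZ.
(* By contradiction, for small [e]. [K1] bounds [(nehari_level - a) / e], and [K] collects the
   coefficients of all second-order terms: the end of the proof yields
   [nehari_level * (kappa * Y - Z) <= e * K], against the choice of [e]. *)
pose K1 := 2 * `|Z| + lambda * P.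
pose K := K1 * (kappa * Y) + nehari_level * Q / 2 + C * `|Z| + C * Q / 2.
have Z0 := normr_ge0 Z; have [Zl Zr] : - `|Z| <= Z /\ Z <= `|Z|.
  by apply/andP; rewrite -ler_norml.
have lP : 0 <= lambda * P by apply: mulr_ge0 => //; exact: ltW.
have lV : 0 <= lambda * V by apply: mulr_ge0 => //; exact: ltW.
have kY : 0 <= kappa * Y by apply: mulr_ge0 => //; exact: ltW.
have K10 : 0 <= K1 by rewrite /K1; lra.
have K0 : 0 <= K.
  have : 0 <= K1 * (kappa * Y) by exact: mulr_ge0.
  have : 0 <= nehari_level * Q by apply: mulr_ge0 => //; exact: ltW.
  have : 0 <= C * `|Z| by exact: mulr_ge0.
  have : 0 <= C * Q by exact: mulr_ge0.
  rewrite /K; lra.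
have [e e0 [e1 e2 e3]] : exists2 e, 0 < e & [/\ e <= 1, e * (K1 + 1) <= nehari_level / 2 &
    e * (K + 1) < nehari_level * (kappa * Y - Z)].
  have dl0 : 0 < nehari_level * (kappa * Y - Z) by rewrite mulr_gt0// subr_gt0.
  pose e2 := nehari_level / 2 / (K1 + 1); pose e3 := nehari_level * (kappa * Y - Z) / 2 / (K + 1).
  have [e20 e30] : 0 < e2 /\ 0 < e3 by split; apply: divr_gt0; lra.
  exists (Num.min 1 (Num.min e2 e3)); first by rewrite !lt_min ltr01 e20.
  split; first by rewrite ge_min lexx.
    by rewrite -ler_pdivlMr ?ge_min ?lexx ?orbT//; lra.
  rewrite -ltr_pdivlMr; last lra.
  rewrite (@le_lt_trans _ _ e3) ?ge_min ?lexx ?orbT// /e3 ltr_pM2r ?invr_gt0; lra.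
have aE1 := aE e e0; have bg := b_ge e e0; have bl := b_le e e0 e1.
set a := decr_a _ _ in aE1; set b := decr_b _ in bg bl.
have a0 : nehari_level - e * K1 <= a.
  rewrite aE1 /K1; have : 0 <= e * (Z + `|Z|) by rewrite mulr_ge0 ?(ltW e0)//; lra.
  have : 0 <= e ^+ 2 * Q by rewrite mulr_ge0 ?sqr_ge0.
  have : e ^+ 2 * (lambda * P) <= e * (lambda * P).
    by rewrite ler_wpM2r// expr2 ger_pMl.
  rewrite /Z; lra.
have eY : 0 <= e * (kappa * Y) by rewrite mulr_ge0 ?(ltW e0).
have bL : nehari_level <= b.
  have : 0 <= p * (e * (kappa * Y)) by apply: mulr_ge0 => //; exact: ltW.
  lra.
have b0 : 0 < b by lra.
have a1 : 0 < a by lra.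
have [s [s0 _] gain] := decr_gain_le (increment e0) a1 b0.
rewrite -/a -/b in gain.
have := le_trans (decr_gain_ge0 _) gain; rewrite pmulr_rge0 ?exprn_gt0// subr_ge0 => ineq.
(* The gain is nonnegative, hence so is the bracket of [decr_gain_le]; divided by [e], this is the
   first-order inequality. *)
have {ineq} H1 : a * (kappa * Y) <= b * (Z + e * Q / 2).
  rewrite -(ler_pM2l e0).
  have E1 : a / b * (p * kappa * e * Y) / p <= (a - nehari_level) / 2.
    apply: le_trans ineq; rewrite ler_pM2r ?invr_gt0// ler_pM2l ?divr_gt0//; lra.
  have E2 : a * (e * (kappa * Y)) = b * (a / b * (p * kappa * e * Y) / p).
    by field; rewrite !gt_eqF.
  rewrite (mulrCA e a) E2 (mulrCA e b) ler_pM2l//; apply: (le_trans E1).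
  have : 0 <= e ^+ 2 * (lambda * P) by rewrite mulr_ge0 ?sqr_ge0.
  by rewrite aE1 /Z; lra.
have H2 : (nehari_level - e * K1) * (kappa * Y) <= a * (kappa * Y) by rewrite ler_wpM2r.
have H3 : 0 <= Z + e * Q / 2.
  rewrite -(pmulr_rge0 _ b0); apply: le_trans H1; apply: le_trans H2.
  by rewrite mulr_ge0//; lra.
have H4 : b * (Z + e * Q / 2) <= (nehari_level + e * C) * (Z + e * Q / 2) by rewrite ler_wpM2r.
have H5 : e * (e * (C * Q)) <= e * (C * Q).
  by apply: ler_piMl => //; apply: mulr_ge0; [exact: ltW|exact: mulr_ge0].
have H6 : e * (C * Z) <= e * (C * `|Z|) by rewrite ler_pM2l// ler_wpM2l.
have : nehari_level * (kappa * Y - Z) <= e * K by rewrite /K; lra.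
lra.
Qed.

End supersolution.

(** * Superharmonicity and the Caccioppoli inequality *)

Lemma test_above1_out z x : test_function A z -> u x <= 1 ->
  z x = 0 /\ forall i, partial i z x = 0.
Proof.
move=> tz ux; have nA : ~ A x by case=> _; rewrite ltNge ux.
split=> [|i]; first exact: test_function_out tz nA.
exact: test_function_out (test_function_partial i tz) nA.
Qed.

Lemma cgrad_out z t x : test_function A z -> u x <= 1 -> cgrad z t u g x = 0.
Proof.
move=> tz ux; have [z0 dz0] := test_above1_out tz ux.
by apply/rowP => i; rewrite !mxE z0 dz0 !mul0r addr0.
Qed.

Lemma superharmonic z : test_function A z -> (forall x, 0 <= z x) ->
  \I (fun x => v x * \sum_i partial i (partial i z) x) <= 0.
Proof.
move=> tz z0; have tzO := test_function_sub AO tz.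
have Wz := W0_test oO fO tzO; have [M HM] := test_function_bounded tz.
have sup := supersolution (M := M) Wz _ _ _.
have {sup} : 0 <= \I (fun x => dot (g x) (tgrad z x)).
  apply: le_trans (sup _ _ _).
  - apply: addr_ge0; (apply: mulr_ge0; [exact: ltW|]); apply: Rintegral_ge0 => x _.
      by rewrite mulr_ge0 ?vpos_ge0.
    by rewrite mulr_ge0 ?powR_ge0.
  - move=> x ux; have [-> dz0] := test_above1_out tz ux; split=> //.
    by apply/rowP => i; rewrite !mxE dz0.
  - by move=> x _; exact: z0.
  - by move=> x _; rewrite (le_trans (ler_norm _)).
have spz i : sqint mu Omega (partial i z) by apply: (test_sqint oO fO (A := A)); exact: test_function_partial.
have sppz i : sqint mu Omega (partial i (partial i z)).
  by apply: (test_sqint oO fO (A := A)); do 2!apply: test_function_partial.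
have [_ E1] := @Rintegral_sum _ _ _ oO fO _ (index_enum 'I_N)
  (fun i x => g x 0 i * partial i z x) (fun i => sqint_mul_L1 mO (sg i) (spz i)).
have -> : \I (fun x => dot (g x) (tgrad z x)) = \sum_i \I (fun x => g x 0 i * partial i z x).
  rewrite -E1; apply: eq_Rintegral => x _; rewrite /dot.
  by apply: eq_bigr => i _; rewrite mxE.
have [_ E2] := @Rintegral_sum _ _ _ oO fO _ (index_enum 'I_N)
  (fun i x => v x * partial i (partial i z) x) (fun i => sqint_mul_L1 mO sv (sppz i)).
have -> : \I (fun x => v x * \sum_i partial i (partial i z) x) =
    \sum_i \I (fun x => v x * partial i (partial i z) x).
  by rewrite -E2; apply: eq_Rintegral => x _; rewrite mulr_sumr.
rewrite -oppr_ge0 -sumrN; congr (0 <= _); apply: eq_bigr => i _.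
have tpz := test_function_sub (fun _ _ => I) (test_function_partial i tz).
have E3 := W0_ibp oO fO i (W0_pos_part oO fO Wu) tpz.
rewrite /ip in E3; rewrite [X in - X](_ : _ = - \I (fun x => g x 0 i * partial i z x)) ?opprK//.
rewrite -[LHS]/(\I (fun x => pos_part (u x - 1) * partial i (partial i z) x)) E3.
congr (- _); apply: eq_Rintegral => x _; rewrite !mxE.
have [ux|ux] := ltP 1 (u x); first by rewrite mul1r.
by rewrite (test_above1_out tz ux).2 !mulr0.
Qed.

Lemma L1_test_cut z m : test_function A z -> (forall x, 0 <= z x <= 1) ->
  (fun x => z x ^+ 2 * (v x <= 2 * m)%R%:R * gsq (g x)) \in_L1.
Proof.
move=> [sz _ _] z01; have Ig := gsq_L1 oO fO sg.
apply: (L1_boundedM oO (M := 1 * 1)) Ig => //.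
  apply: measurable_funM; first by apply: measurable_funX; exact: smooth_measurable.
  have mc : measurable_fun Omega (fun x => 1 - chi (fun y => v y - 2 * m + 1) x).
    apply: measurable_funB => //; apply: measurable_chi => //.
    by apply: measurable_funD => //; apply: measurable_funB => //; case: sv.
  apply: eq_measurable_fun mc => x _; rewrite /chi ltrDr subr_gt0 ltNge.
  by case: (v x <= _); rewrite ?subr0 ?subrr.
move=> x _; rewrite normrM ler_pM//.
  by have /andP[zl zr] := z01 x; rewrite ger0_norm ?sqr_ge0// expr_le1.
by case: (v x <= _); rewrite ?normr1 ?normr0.
Qed.

(** Test the supersolution inequality with [z^2 * t (u)]. As [t] decreases, the gradient term enters
    with a negative sign, and [t^2 <= 9 m^2 k], where [k] is minus the derivative of [t], lets
    Young's inequality absorb the cross term with factor [36 m^2]. Where [v <= 2 m] one has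
    [k >= 1 / (9 e)]; hence [324 = 36 * 9]. *)
Lemma caccioppoli z m : test_function A z -> (forall x, 0 <= z x <= 1) -> 0 < m ->
  \I (fun x => z x ^+ 2 * (v x <= 2 * m)%R%:R * gsq (g x)) <=
  324 * expR 1 * m ^+ 2 * \I (fun x => gsq (tgrad z x)).
Proof.
move=> tz z01 m0; have tzO := test_function_sub AO tz.
have tz2 : test_function A (fun x => z x * z x).
  by apply: test_function_mul => //; case: tz.
have sz : smooth z by case: tz.
have [C1 C10 H1] := flat_bounded ('X ^+ 2 : {poly R}).
have [C2 C20 H2] := flat_bounded ('X ^+ 2 * ('X ^+ 2 - ('X ^+ 2)^`()) : {poly R}).
have [C0 C00 H0] := flat_bounded (1 : {poly R}).
(* [t] is decreasing, with slope bounded away from [0] where [u - 1 <= 2 * m]. *)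
pose t s := m * flat1 (3 - (s - 1) / m).
pose k s := flat ('X ^+ 2) (3 - (s - 1) / m).
have aff (x : R) : is_derive x 1 (fun s : R => 3 - (s - 1) / m) (- m^-1).
  apply: is_derive_val (is_deriveB (is_derive_cst (3 : R) x 1) (is_deriveM
    (is_deriveB (is_derive_id x (1 : R)) (is_derive_cst (1 : R) x 1))
    (is_derive_cst m^-1 x (1 : R)))) _ _ => //.
  by rewrite /GRing.scale/=; ring.
have dt : derive1 t = fun s => - k s.
  apply/funext => s; rewrite derive1E; apply: derive_val.
  have D1 := @is_derive1_comp _ flat1 (fun s => 3 - (s - 1) / m) s _ _ (is_derive_flat1 _) (aff s).
  apply: is_derive_val (is_deriveZ m D1) _ _ => //.
  by rewrite /GRing.scale/= /k; field; rewrite gt_eqF.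
have dk : derive1 (fun s => - k s) =
    fun s => m^-1 * flat ('X ^+ 2 * ('X ^+ 2 - ('X ^+ 2)^`())) (3 - (s - 1) / m).
  apply/funext => s; rewrite derive1E; apply: derive_val.
  have D1 := @is_derive1_comp _ (flat 'X^2) (fun s => 3 - (s - 1) / m) s _ _ (is_derive_flat _ _) (aff s).
  apply: is_derive_val (is_deriveN D1) _ _ => //.
  by ring.
have st : smooth1 t.
  apply: smooth1M; first exact: smooth1_cst.
  apply: (smooth1_comp smooth1_flat1).
  by apply: (smooth1_ext _ (smooth1_affine (- m^-1) (3 + m^-1))) => s; ring.
have Wp : W0 Omega (fun x => z x * z x * t (u x)) (cgrad (fun x => z x * z x) t u g).
  apply: (W0_test_comp oO fO (C := C1) (C2 := m^-1 * C2) Wu (test_function_sub AO tz2) st).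
    by move=> s; rewrite dt normrN; exact: H1.
  move=> s; rewrite dt dk normrM gtr0_norm ?invr_gt0// ler_pM2l ?invr_gt0//; exact: H2.
have t0 s : 0 <= t s by rewrite mulr_ge0 ?flat1_ge0 ?ltW.
have pz x : 0 <= z x * z x * t (u x) by have /andP[z0 _] := z01 x; apply: mulr_ge0 => //; exact: mulr_ge0.
have sup := supersolution (M := m * C0) Wp _ _ _.
have {sup} sup : 0 <= \I (fun x => dot (g x) (cgrad (fun x => z x * z x) t u g x)).
  apply: le_trans (sup _ _ _).
  - apply: addr_ge0; (apply: mulr_ge0; [exact: ltW|]); apply: Rintegral_ge0 => x _.
      by apply: mulr_ge0 => //; exact: vpos_ge0.
    by apply: mulr_ge0 => //; exact: powR_ge0.
  - move=> x ux; rewrite (cgrad_out _ tz2 ux) (test_above1_out tz ux).1.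
    by rewrite !mul0r.
  - by move=> x _; exact: pz.
  - move=> x _; have /andP[z0 z1] := z01 x; rewrite -[leRHS]mul1r.
    apply: ler_pM => //; first exact: mulr_ge0.
      by rewrite -[leRHS]mul1r ler_pM.
    by rewrite /t ler_pM2l// (le_trans (ler_norm _))//; exact: H0.
have k0 s : 0 <= k s.
  by rewrite /k /flat; case: ifP => // _; rewrite hornerXn mulr_ge0 ?sqr_ge0 ?expR_ge0.
(* With [y = 3 - (s - 1) / m <= 3], positive: [exp (-2/y) <= exp (-1/y) <= 9 y^(-2) exp (-1/y)]. *)
have t2 s : 1 <= s -> t s ^+ 2 <= 9 * m ^+ 2 * k s.
  move=> s1; rewrite /t exprMn [leRHS](_ : _ = m ^+ 2 * (9 * k s)); last by ring.
  rewrite ler_pM2l ?exprn_gt0//.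
  have y3 : 3 - (s - 1) / m <= 3 by rewrite gerBl divr_ge0 ?subr_ge0 ?(ltW m0).
  rewrite /k; move: (3 - (s - 1) / m) y3 => y y3; have [y0|y0] := leP y 0.
    by rewrite flat1_le0// expr0n/= /flat ltNge y0/= mulr0.
  rewrite flat1E// /flat y0 hornerXn mulrA expr2 ler_wpM2r ?expR_ge0//.
  rewrite (@le_trans _ _ 1) ?expR_le1 ?oppr_le0 ?invr_ge0 ?(ltW y0)//.
  by rewrite exprVn ler_pdivlMr ?exprn_gt0// mul1r; nra.
(* Here [1 <= y <= 3], so [y^(-2) >= 1/9] and [exp (-1/y) >= exp (-1)]. *)
have k1 x : v x <= 2 * m -> 1 < u x -> 1 <= 9 * expR 1 * k (u x).
  move=> v2 ux; rewrite (vpos_gt ux) in v2.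
  have y1 : 1 <= 3 - (u x - 1) / m.
    by rewrite lerBrDl -lerBrDr (_ : 3 - 1 = 2) ?ler_pdivrMr//; ring.
  have y3 : 3 - (u x - 1) / m <= 3 by rewrite gerBl divr_ge0 ?subr_ge0 ?(ltW m0) ?(ltW ux).
  rewrite /k; move: (3 - (u x - 1) / m) y1 y3 => y y1 y3; have y0 : 0 < y by lra.
  rewrite /flat y0 hornerXn exprVn mulrACA -expRD -[leLHS]mul1r; apply: ler_pM => //.
    by rewrite ler_pdivlMr ?exprn_gt0// mul1r; nra.
  by rewrite -[leLHS]expR0 ler_expR subr_ge0 invf_le1.
have Iz : (fun x => gsq (tgrad z x)) \in_L1.
  by apply: gsq_L1 => // i; exact: W0_sqint_grad (W0_test oO fO tzO) i.
have mz : measurable_fun Omega (fun x => z x ^+ 2).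
  by apply: measurable_funX; exact: smooth_measurable.
have z2 x : `|z x ^+ 2| <= 1.
  by have /andP[zl zr] := z01 x; rewrite ger0_norm ?sqr_ge0// expr_le1.
have Ig := gsq_L1 oO fO sg.
have Ik : (fun x => z x ^+ 2 * k (u x) * gsq (g x)) \in_L1.
  apply: (L1_boundedM oO (M := 1 * C1)) Ig => //.
    apply: measurable_funM => //.
    apply: (measurableT_comp (f := k)); last by case: (W0_sqint Wu).
    apply: continuous_measurable_fun; apply: smooth1_continuous.
    apply: (smooth1_comp (smooth1_flat _)).
    by apply: (smooth1_ext _ (smooth1_affine (- m^-1) (3 + m^-1))) => s; ring.
  by move=> x _; rewrite normrM ler_pM//; exact: H1.
have Ii := L1_test_cut m tz z01.
have Ic : (fun x => dot (g x) (cgrad (fun x => z x * z x) t u g x)) \in_L1.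
  by apply: dot_L1 => // i; exact: W0_sqint_grad Wp i.
have : \I (fun x => dot (g x) (cgrad (fun x => z x * z x) t u g x)) <=
    18 * m ^+ 2 * \I (fun x => gsq (tgrad z x))
    - 2^-1 * \I (fun x => z x ^+ 2 * k (u x) * gsq (g x)).
  rewrite -!RintegralZl// -RintegralB//; [|exact: L1Z|exact: L1Z].
  apply: le_Rintegral => //; first by apply: L1B => //; exact: L1Z.
  move=> x Ox; have [ux|ux] := ltP 1 (u x); last first.
    have [-> dz] := test_above1_out tz ux; rewrite (cgrad_out _ tz2 ux) dot0r.
    rewrite expr0n/= !mul0r mulr0 subr0; apply: mulr_ge0; last exact: gsq_ge0.
    by apply: mulr_ge0 => //; exact: sqr_ge0.
  rewrite /gsq /dot !mulr_sumr -sumrB; apply: ler_sum => i _.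
  rewrite !mxE dt (partialM i x sz sz); move: (t2 (u x) (ltW ux)) (k0 (u x)).
  move: (t (u x)) (k (u x)) (z x) (partial i z x) (g x 0 i) => a b c d e ab b0.
  (* Where the derivative of [t] vanishes so does [t], by [ab]; elsewhere multiply by [b] and
     complete the square. *)
  have [E|bn] := eqVneq b 0.
    have -> : a = 0 by apply/eqP; rewrite -sqrf_eq0 eq_le sqr_ge0 andbT (le_trans ab)// E mulr0.
    rewrite E !(mulr0, mul0r, oppr0, addr0, subr0).
    by apply: mulr_ge0; [apply: mulr_ge0 => //|]; exact: sqr_ge0.
  have bp : 0 < b by rewrite lt_def bn.
  have sq : 0 <= (c * b * e - 2 * a * d) ^+ 2 by exact: sqr_ge0.
  have ad : d ^+ 2 * a ^+ 2 <= d ^+ 2 * (9 * m ^+ 2 * b) by rewrite ler_wpM2l ?sqr_ge0.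
  rewrite -(ler_pM2l bp); nra.
have : \I (fun x => z x ^+ 2 * (v x <= 2 * m)%R%:R * gsq (g x)) <=
    9 * expR 1 * \I (fun x => z x ^+ 2 * k (u x) * gsq (g x)).
  rewrite -RintegralZl//; apply: le_Rintegral => //; first exact: L1Z.
  move=> x Ox; rewrite mulrA; apply: ler_wpM2r; first exact: gsq_ge0.
  have [ux|ux] := ltP 1 (u x); last first.
    by rewrite (test_above1_out tz ux).1 expr0n/= !mul0r mulr0.
  rewrite mulrCA; apply: ler_wpM2l; first exact: sqr_ge0.
  by case: (leP (v x) _) => [v2|_]; [exact: k1|rewrite !mulr_ge0 ?expR_ge0].
have : 0 < expR 1 :> R by exact: expR_gt0.
move=> e0 H3 H4; apply: (le_trans H3).
have H5 := le_trans sup H4.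
have H6 : \I (fun x => z x ^+ 2 * k (u x) * gsq (g x)) <=
    36 * m ^+ 2 * \I (fun x => gsq (tgrad z x)) by lra.
by rewrite -(ler_pM2l e0) in H6; lra.
Qed.

(** The contributions [- K] of [a] and [(a / b) K] of [b] cancel up to [K (a - b) / b], where
    [a - b = (a - l) + (l - b)] is at most [Q + q K] and [b >= l / 2]. *)
Lemma gain_arith (a b l q K Q : R) : 2 < q -> 0 < l -> 0 <= K -> 0 <= Q ->
  l / 2 <= a -> l / 2 <= b -> a - l <= Q - 2 * K -> l - b <= q * K ->
  (a - l) / 2 - a / b * (b - l) / q <= Q / 2 + 2 * K * (Q + q * K) / l /\
  0 <= Q / 2 + 2 * K * (Q + q * K) / l.
Proof.
move=> q2 l0 K0 Q0 al bl aQ bK; have q0 : 0 < q by lra.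
have a0 : 0 < a by lra.
have b0 : 0 < b by lra.
have qK : 0 <= q * K by rewrite mulr_ge0// ltW.
have ab0 : 0 <= a / b by rewrite divr_ge0 ?ltW.
split; last first.
  by rewrite addr_ge0 ?divr_ge0 ?mulr_ge0 ?addr_ge0 ?(ltW l0) ?(ltW q0).
have E1 : - (a / b * (b - l) / q) <= a / b * K.
  rewrite (_ : - _ = a / b * ((l - b) / q)); last by ring.
  by rewrite ler_wpM2l// ler_pdivrMr// mulrC.
have E2 : a / b * K - K <= 2 * K * (Q + q * K) / l.
  rewrite (_ : _ - _ = K * ((a - b) / b)); last by field; rewrite gt_eqF.
  rewrite (_ : _ / l = K * ((Q + q * K) / (l / 2))); last by field; rewrite gt_eqF.
  rewrite ler_wpM2l// (@le_trans _ _ ((Q + q * K) / b))//.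
    by rewrite ler_pM2r ?invr_gt0//; lra.
  by rewrite ler_wpM2l ?addr_ge0// lef_pV2 ?posrE ?divr_gt0.
lra.
Qed.

Let p2 : 2 < p := @crit_gt2 R N hN.
Let p0 : 0 < p. Proof. exact: lt_trans p2. Qed.

(** Weight for Young's inequality, chosen so that the part carried by the energy of [u] is at most
    [nehari_level / 8]; the added [1] keeps the denominator positive. *)
Definition gain_eta : R := nehari_level / (8 * (\I (fun x => gsq (g x)) + 1)).
(** Bound for [s^2] when [a / b <= 4], which follows from [a <= 2 * nehari_level] and
    [b >= nehari_level / 2]. *)
Definition gain_scale : R := (4 `^ (p - 2)^-1) ^+ 2.

Let G := \I (fun x => gsq (g x)).
Let G0 : 0 <= G. Proof. by apply: Rintegral_ge0 => x _; exact: gsq_ge0. Qed.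

Lemma gain_eta_gt0 : 0 < gain_eta.
Proof.
have G1 : 0 < G + 1 := ltr_wpDl G0 ltr01.
have l0 := nehari_level_gt0.
by apply: divr_gt0 => //; apply: mulr_gt0.
Qed.

Lemma gain_eta_le : gain_eta * G <= nehari_level / 8.
Proof.
have G1 : 0 < G + 1 := ltr_wpDl G0 ltr01.
have l0 := nehari_level_gt0.
rewrite /gain_eta -/G (_ : _ * G = nehari_level / 8 * (G / (G + 1))); last first.
  by field; rewrite gt_eqF.
by rewrite ger_pMr ?divr_gt0// ler_pdivrMr// mul1r lerDl.
Qed.

Lemma decr_gain_bound psi h M : decrement psi h ->
  (forall x, Omega x -> 0 <= psi x) -> (forall x, Omega x -> psi x <= M) ->
  let Q := \I (fun x => gsq (h x)) in
  let Y := \I (fun x => v x `^ (p - 1) * psi x) in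
  let P := \I (fun x => psi x ^+ 2) in
  Q <= nehari_level -> Q / gain_eta <= nehari_level / 8 -> lambda * P <= nehari_level / 4 -> p * kappa * Y <= nehari_level / 2 ->
  decr_gain psi <=
    gain_scale * (Q / 2 + 2 * (kappa * Y) * (Q + p * kappa * Y) / nehari_level).
Proof.
move=> D psi0 psiM Q Y P QL QeL PL YL.
have Lp : 0 < nehari_level := nehari_level_gt0; have pp : 0 < p := p0; have e0 := gain_eta_gt0; have eG := gain_eta_le.
have spsi := W0_sqint (decr_W0 D); have sh := W0_sqint_grad (decr_W0 D).
have sup := supersolution (decr_W0 D) (decr_out D) psi0 psiM.
have aE := decr_aE D; have bE := decr_b_ge D.
rewrite -/Q -/P in aE; rewrite -/Y in sup bE.
set X := \I (fun x => dot (g x) (h x)) in sup aE.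
set V := \I (fun x => v x * psi x) in sup aE.
set a := decr_a _ _ in aE; set b := decr_b _ in bE.
have Q0 : 0 <= Q by apply: Rintegral_ge0 => x _; exact: gsq_ge0.
have Y0 : 0 <= Y by apply: Rintegral_ge0 => x Ox; rewrite mulr_ge0 ?powR_ge0 ?psi0.
have V0 : 0 <= V by apply: Rintegral_ge0 => x Ox; rewrite mulr_ge0 ?vpos_ge0 ?psi0.
have P0 : 0 <= P by apply: Rintegral_ge0 => x _; exact: sqr_ge0.
have lP : 0 <= lambda * P by apply: mulr_ge0 => //; exact: ltW.
have lV : 0 <= lambda * V by apply: mulr_ge0 => //; exact: ltW.
have kY : 0 <= kappa * Y by apply: mulr_ge0 => //; exact: ltW.
(* Young's inequality only serves to keep [a] above half the level. The upper bound [a_le] comes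
   from [sup], where the term linear in [h] has disappeared. *)
have young : 2 * X <= gain_eta * G + Q / gain_eta.
  rewrite mulrC (mulrC Q).
  have Ig := gsq_L1 oO fO sg; have Ih := gsq_L1 oO fO sh; have Ix := dot_L1 sg sh.
  rewrite /G /Q mulrC -!RintegralZl// -RintegralD//; [|exact: L1Z|exact: L1Z].
  apply: le_Rintegral => //; [exact: L1Z|by apply: L1D => //; exact: L1Z|].
  move=> x _; rewrite /dot /gsq !mulr_sumr -big_split/=; apply: ler_sum => i _.
  move: (g x 0 i) (h x 0 i) => y z.
  have : 0 <= (gain_eta * y - z) ^+ 2 / gain_eta by rewrite divr_ge0 ?sqr_ge0 ?ltW.
  rewrite (_ : _ / _ = gain_eta * y ^+ 2 - 2 * (y * z) + gain_eta^-1 * z ^+ 2); first lra.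
  by field; rewrite gt_eqF.
have a_ge : nehari_level / 2 <= a by rewrite aE; lra.
have a_le : a - nehari_level <= Q - 2 * (kappa * Y) by rewrite aE; lra.
have b_ge : nehari_level / 2 <= b by lra.
have a0 : 0 < a by lra.
have b0 : 0 < b by lra.
have [s [s0 sE] gain] := decr_gain_le D a0 b0.
rewrite -/a -/b in sE gain.
have s2 : s ^+ 2 <= gain_scale.
  rewrite /gain_scale lerXn2r ?nnegrE ?powR_ge0 ?(ltW s0)//.
  have -> : s = (s `^ (p - 2)) `^ (p - 2)^-1.
    by rewrite -powRrM divff ?powRr1 ?(ltW s0)// gt_eqF// subr_gt0.
  apply: powR_le; rewrite ?powR_ge0 ?invr_ge0 ?subr_ge0 ?(ltW p2)//.
  by rewrite sE ler_pdivrMr//; lra.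
apply: (le_trans gain).
have [D_le D_ge0] : _ /\ _ := gain_arith p2 Lp kY Q0 a_ge b_ge a_le ltac:(by rewrite mulrA).
rewrite (mulrA p) in D_le D_ge0.
apply: (@le_trans _ _ (s ^+ 2 * (Q / 2 + 2 * (kappa * Y) * (Q + p * kappa * Y) / nehari_level))).
  by rewrite ler_pM2l ?exprn_gt0.
by apply: ler_wpM2r.
Qed.

(** * The competitor localized near a point *)

Section local_competitor.
Variables (x0 : 'rV[R]_N) (rho sig m Mc Ch Ck : R).
Hypothesis sigE : sig = rho / (2 * N%:R).
Hypothesis rho0 : 0 < rho.
Hypothesis rho1 : rho <= 1.
Hypothesis rhoA : forall x, gsq (x - x0) <= rho ^+ 2 -> A x.
Hypothesis m0 : 0 < m.
Hypothesis cutoff_le : forall (c : 'rV[R]_N) s i x, 0 < s ->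
  `|partial i (cutoff c s) x| <= Mc / s.
Hypothesis hump_lip : forall t : R, `|derive1 hump t| <= Ch.

Local Notation z := (cutoff x0 sig).
Local Notation T := (rescale hump 1 m).
Local Notation psi := (fun x => z x * T (u x)).
Local Notation h := (cgrad z T u g).
Local Notation vol := (((2 * sig) *+ 2) ^+ N).

Let N0 : 0 < N%:R :> R. Proof. by rewrite ltr0n (leq_trans _ hN). Qed.
Let N1 : 1 <= N%:R :> R. Proof. by rewrite ler1n (leq_trans _ hN). Qed.
Let sig0 : 0 < sig. Proof. by rewrite sigE divr_gt0 ?mulr_gt0. Qed.
Let sig2 : 0 < sig / 2. Proof. by rewrite divr_gt0. Qed.
Let sigD : 0 < 2 * sig. Proof. by rewrite mulr_gt0. Qed.

Lemma gsq_cube_le (x c : 'rV[R]_N) s : (forall i, `|x 0 i - c 0 i| <= s) ->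
  gsq (x - c) <= N%:R * s ^+ 2.
Proof.
move=> xs; rewrite /gsq (@le_trans _ _ (\sum_(i < N) s ^+ 2))//.
  apply: ler_sum => i _; rewrite !mxE -real_normK ?num_real//.
  by rewrite lerXn2r ?nnegrE// (le_trans _ (xs i)).
by rewrite sumr_const card_ord mulr_natl.
Qed.

(** The origin of [sig = rho / (2 * N)]: a cube of half-side [2 * sig] has squared Euclidean radius
    at most [N * (2 * sig)^2 = rho^2 / N]. *)
Let ball_rho x : ball x0 (2 * sig) x -> gsq (x - x0) <= rho ^+ 2.
Proof.
rewrite rV_ballE// => xb.
have /le_trans -> // : gsq (x - x0) <= N%:R * (2 * sig) ^+ 2.
  by apply: gsq_cube_le => i; exact: ltW.
rewrite (_ : _ * _ = rho ^+ 2 / N%:R); last by rewrite sigE; field; rewrite gt_eqF.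
by rewrite ler_pdivrMr// ler_peMr ?sqr_ge0.
Qed.

Let ball_half x : ball x0 (sig / 2) x -> gsq (x - x0) <= rho ^+ 2 / 2.
Proof.
rewrite rV_ballE// => xb.
have /le_trans -> // : gsq (x - x0) <= N%:R * sig ^+ 2.
  by apply: gsq_cube_le => i; apply: ltW; apply: (lt_le_trans (xb i)); move: sig0; lra.
rewrite (_ : _ * _ = rho ^+ 2 / 2 / (2 * N%:R)); last by rewrite sigE; field; rewrite gt_eqF.
by rewrite ler_pdivrMr ?mulr_gt0// ler_peMr ?divr_ge0 ?sqr_ge0//; move: N1; lra.
Qed.

Let ballO : ball x0 (2 * sig) `<=` Omega.
Proof. by move=> x /ball_rho/rhoA[]. Qed.

Let tzb : test_function (ball x0 (2 * sig)) z.
Proof.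
apply: test_function_cutoff => // x xs; rewrite rV_ballE// => i.
by apply: le_lt_trans (xs i) _; move: sig0; lra.
Qed.

Let tz : test_function A z.
Proof. by apply: test_function_sub tzb => x /ball_rho/rhoA. Qed.

Let tzO : test_function Omega z := test_function_sub AO tz.

Let z_out x : ~ ball x0 (2 * sig) x -> z x = 0 /\ tgrad z x = 0.
Proof.
move=> xb; split; first exact: test_function_out tzb xb.
by apply/rowP => i; rewrite !mxE; exact: test_function_out (test_function_partial i tzb) xb.
Qed.

Lemma hump_ge0 (y : R) : 0 <= y -> 0 <= hump y.
Proof. by move=> y0; rewrite /hump mulr_ge0 ?step_ge0. Qed.

Lemma hump_le (y : R) : 0 <= y -> hump y <= y.
Proof. by move=> y0; rewrite /hump ler_piMr ?step_bound. Qed.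

Lemma hump_le2 (y : R) : 0 <= y -> hump y <= 2.
Proof.
move=> y0; have [y2|y2] := leP y 2; first exact: le_trans (hump_le y0) _.
by rewrite hump_ge2// ltW.
Qed.

Let T_bounds x : 1 < u x -> [/\ 0 <= T (u x), T (u x) <= v x & T (u x) <= 2 * m].
Proof.
move=> ux; rewrite (vpos_gt ux) /rescale.
have y0 : 0 <= (u x - 1) / m by rewrite divr_ge0 ?subr_ge0 ?(ltW m0) ?(ltW ux).
split; first by rewrite mulr_ge0 ?hump_ge0 ?(ltW m0).
  by rewrite mulrC -ler_pdivlMr// hump_le.
by rewrite mulrC ler_pM2r// hump_le2.
Qed.

Let T_out x : 1 < u x -> 2 * m <= v x -> T (u x) = 0.
Proof.
move=> ux; rewrite (vpos_gt ux) /rescale => v2.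
by rewrite hump_ge2 ?mulr0// ler_pdivlMr.
Qed.

Let z01 x : 0 <= z x <= 1.
Proof. by rewrite cutoff_ge0 cutoff_bound. Qed.

Lemma local_bounds x : 0 <= psi x /\ psi x <= 2 * m.
Proof.
have [z0 z1] := andP (z01 x); have [ux|ux] := ltP 1 (u x).
  have [t0 _ t2] := T_bounds ux; split; first exact: mulr_ge0.
  by rewrite -[leRHS]mul1r ler_pM.
by rewrite (test_above1_out tz ux).1 mul0r mulr_ge0 ?(ltW m0).
Qed.

Let hump0 (y : R) : y <= 1 -> hump y = 1 * y + 0.
Proof. by move=> y1; rewrite hump_le1// mul1r addr0. Qed.

Let hump2 (y : R) : 2 <= y -> hump y = 0 * y + 0.
Proof. by move=> y1; rewrite hump_ge2// mul0r addr0. Qed.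

Lemma local_decrement : decrement psi h.
Proof.
have [C2 HC2] := smooth1_derive2_bounded smooth1_hump hump0 hump2.
have Wp : W0 Omega psi h.
  apply: (W0_test_comp oO fO (C := Ch) (C2 := m^-1 * C2) Wu tzO).
  - exact: smooth1_rescale smooth1_hump.
  - by move=> t; rewrite derive1_rescale ?gt_eqF//; exact: smooth1_hump.
  - move=> t; rewrite derive2_rescale ?gt_eqF//; last exact: smooth1_hump.
    by rewrite normrM gtr0_norm ?invr_gt0// ler_pM2l ?invr_gt0.
split => //.
- by move=> x ux; rewrite (cgrad_out _ tz ux) (test_above1_out tz ux).1 mul0r.
- move=> x Ox; have [z0 z1] := andP (z01 x); have [ux|ux] := ltP 1 (u x).
    have [t0 tv _] := T_bounds ux; rewrite (le_trans _ tv)//.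
    by rewrite -[leRHS]mul1r ler_pM.
  by rewrite (test_above1_out tz ux).1 mul0r vpos_ge0.
- by exists (2 * m) => x _; have [p1 p3] := local_bounds x; rewrite ger0_norm.
- move=> x Ox ux E; have [z0 z1] := andP (z01 x); have [t0 tv _] := T_bounds ux.
  have v0 : 0 < v x by rewrite vpos_gt// subr_gt0.
  (* From [z * T = v] with [z <= 1], [T <= v] and [v > 0], both inequalities are equalities. Then
     [step_lt1] forces [(u x - 1) / m <= 1], where the derivative of [T] is [1], and the gradient of
     [z] is [0] at its maximum. *)
  have Tv : T (u x) = v x by apply/eqP; rewrite eq_le tv/= -E ler_piMl.
  have zE : z x = 1 by apply: (mulIf (lt0r_neq0 v0)); rewrite mul1r -{1}Tv.
  have y1 : (u x - 1) / m <= 1.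
    rewrite leNgt; apply/negP => /step_lt1 lt; move: Tv.
    rewrite (vpos_gt ux) /rescale /hump mulrA (mulrC m) divfK ?gt_eqF// => Tv.
    have u10 : 0 < u x - 1 by rewrite subr_gt0.
    by move: lt; rewrite -(ltr_pM2l u10) Tv mulr1 ltxx.
  apply/rowP => i; rewrite !mxE zE (partial_cutoff_in i sig0 zE) mul0r add0r mul1r.
  by rewrite derive1_rescale ?gt_eqF// ?derive1_hump_le1// ?mul1r//; exact: smooth1_hump.
Qed.

Let Iz : (fun x => gsq (tgrad z x)) \in_L1.
Proof. by apply: gsq_L1 => // i; exact: W0_sqint_grad (W0_test oO fO tzO) i. Qed.

Lemma integral_gsq_cutoff : \I (fun x => gsq (tgrad z x)) <= N%:R * (Mc / sig) ^+ 2 * vol.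
Proof.
apply: (Rintegral_le_ball oO fO (c := x0)) => //.
- by apply: mulr_ge0; [exact: ltW|exact: sqr_ge0].
- move=> x _ _; rewrite /gsq (@le_trans _ _ (\sum_(i < N) (Mc / sig) ^+ 2))//.
    apply: ler_sum => i _; rewrite !mxE -real_normK ?num_real// lerXn2r ?nnegrE//.
      by apply: le_trans (cutoff_le x0 i x sig0).
    exact: cutoff_le.
  by rewrite sumr_const card_ord [leRHS]mulr_natl lexx.
- by move=> x _ /z_out[_ ->]; rewrite gsq0.
Qed.

(** By [(x + y)^2 <= 2 x^2 + 2 y^2]. The term with the gradient of [z] carries [T <= 2 m], whence
    [8 m^2]; the term with the gradient of [u] lives where [v <= 2 m], and [caccioppoli] gives
    [648 = 2 * 324]. *)
Lemma local_Q_le : \I (fun x => gsq (h x)) <=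
  (8 + 648 * expR 1 * Ch ^+ 2) * m ^+ 2 * (N%:R * (Mc / sig) ^+ 2 * vol).
Proof.
have D := local_decrement; have Ih := gsq_L1 oO fO (W0_sqint_grad (decr_W0 D)).
have cac := caccioppoli tz z01 m0.
apply: (@le_trans _ _ (8 * m ^+ 2 * \I (fun x => gsq (tgrad z x)) +
   2 * Ch ^+ 2 * \I (fun x => z x ^+ 2 * (v x <= 2 * m)%R%:R * gsq (g x)))).
  have Ii := L1_test_cut m tz z01.
  rewrite -!RintegralZl// -RintegralD//; [|exact: L1Z|exact: L1Z].
  apply: le_Rintegral => //; first by apply: L1D => //; exact: L1Z.
  move=> x Ox; have [ux|ux] := ltP 1 (u x); last first.
    rewrite (cgrad_out _ tz ux) gsq0 (test_above1_out tz ux).1 expr0n/= !mul0r mulr0 addr0.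
    by apply: mulr_ge0; [apply: mulr_ge0 => //; exact: sqr_ge0|exact: gsq_ge0].
  have [t0 _ t2] := T_bounds ux; rewrite /gsq !mulr_sumr -big_split/=.
  apply: ler_sum => i _; rewrite !mxE; move: (partial i z x) (g x 0 i) => d e.
  have T2 : T (u x) ^+ 2 <= 4 * m ^+ 2.
    by rewrite (_ : 4 * m ^+ 2 = (2 * m) ^+ 2); [rewrite lerXn2r ?nnegrE// (le_trans t0)|ring].
  have T1 : derive1 T (u x) ^+ 2 <= Ch ^+ 2 * (v x <= 2 * m)%R%:R.
    rewrite derive1_rescale ?gt_eqF//; last exact: smooth1_hump.
    have [v2|v2] := leP (v x) (2 * m).
      rewrite mulr1 -real_normK ?num_real// lerXn2r ?nnegrE//.
      exact: le_trans (hump_lip 0).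
    by rewrite derive1_hump_gt2 ?expr0n ?mulr0// ltr_pdivlMr// -(vpos_gt ux).
  move: T2 T1; move: (T (u x)) (derive1 T (u x)) (z x) ((v x <= 2 * m)%R%:R).
  move=> a b c w T2 T1.
  have E1 : d ^+ 2 * a ^+ 2 <= d ^+ 2 * (4 * m ^+ 2) by rewrite ler_wpM2l ?sqr_ge0.
  have E2 : (c * e) ^+ 2 * b ^+ 2 <= (c * e) ^+ 2 * (Ch ^+ 2 * w) by rewrite ler_wpM2l ?sqr_ge0.
  have : 0 <= (d * a - c * (b * e)) ^+ 2 by exact: sqr_ge0.
  nra.
have C0 : 0 <= Ch ^+ 2 by exact: sqr_ge0.
have M0 : 0 <= m ^+ 2 by exact: sqr_ge0.
apply: (@le_trans _ _ ((8 + 648 * expR 1 * Ch ^+ 2) * m ^+ 2 * \I (fun x => gsq (tgrad z x)))).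
  have := ler_wpM2l C0 cac; lra.
apply: ler_wpM2l; last exact: integral_gsq_cutoff.
exact: mulr_ge0 (addr_ge0 (ler0n _ _) (mulr_ge0 (mulr_ge0 (ler0n _ _) (expR_ge0 _)) C0)) M0.
Qed.

(** [psi] vanishes where [v >= 2 m], so [v^(p-1) <= (2 m)^(p-1) <= 2 m] on its support, the exponent
    being at least [1] and [2 m <= 1]. *)
Lemma local_Y_le : 2 * m <= 1 ->
  \I (fun x => v x `^ (p - 1) * psi x) <= 4 * m ^+ 2 * vol.
Proof.
move=> m1; have D := local_decrement; have [M HM] := decr_bounded D.
apply: (Rintegral_le_ball oO fO (c := x0)) => //.
- by apply: mulr_ge0 => //; exact: sqr_ge0.
- apply: (powR_pred_L1 _ _ vpos_powR_L1 _ HM).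
  + by case: sv.
  + by move=> x _; exact: vpos_ge0.
  + by case: (W0_sqint (decr_W0 D)).
- move=> x Ox _; have m2 : 0 <= 4 * m ^+ 2 by apply: mulr_ge0 => //; exact: sqr_ge0.
  have [ux|ux] := ltP 1 (u x); last by rewrite (test_above1_out tz ux).1 mul0r mulr0.
  have [v2|v2] := leP (2 * m) (v x); first by rewrite T_out// !mulr0.
  have [q1 q2] := local_bounds x.
  have -> : 4 * m ^+ 2 = (2 * m) * (2 * m) by ring.
  apply: ler_pM => //; first exact: powR_ge0.
  have v0 := vpos_ge0 u x.
  apply: (@le_trans _ _ ((2 * m) `^ (p - 1))).
    by apply: powR_le => //; [rewrite subr_ge0 ltW// (lt_trans _ p2)// ltr1n|exact: ltW].
  have mm : 0 < 2 * m by rewrite mulr_gt0.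
  have -> : p - 1 = (p - 2) + 1 by ring.
  rewrite powRD; last by apply/implyP => _; rewrite gt_eqF.
  rewrite powRr1 ?(ltW mm)// ler_piMl ?(ltW mm)//.
  have := @powR_le R (p - 2) (2 * m) 1 _ (ltW mm) m1.
  by rewrite powR1; apply; rewrite subr_ge0 ltW.
- by move=> x _ /z_out[-> _]; rewrite mul0r mulr0.
Qed.

Lemma local_P_le : \I (fun x => psi x ^+ 2) <= 4 * m ^+ 2 * vol.
Proof.
have D := local_decrement.
apply: (Rintegral_le_ball oO fO (c := x0)) => //.
- by apply: mulr_ge0 => //; exact: sqr_ge0.
- exact: sqint_L1 (W0_sqint (decr_W0 D)).
- move=> x _ _; have [q1 q2] := local_bounds x.
  by rewrite (_ : 4 * m ^+ 2 = (2 * m) ^+ 2); [rewrite lerXn2r ?nnegrE// (le_trans q1)|ring].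
- by move=> x _ /z_out[-> _]; rewrite mul0r expr0n.
Qed.

(** On the cube of volume [sig^N] where [z = 1] is known, points with [v <= m] satisfy [psi = v].
    The others are counted by Markov's inequality, with [mean_value] bounding the integral of [v];
    near [x0] continuity gives [v <= 2 * v x0]. *)
Lemma local_gain_ge : 0 < Ck -> (forall t : R, kernel t <= Ck) ->
  {for x0, continuous u} ->
  sig ^+ N - expR 2 * Ck * 4 ^+ N * rho ^+ N * (2 * v x0) / m <= decr_gain psi.
Proof.
move=> Ck0 HC cu; have D := local_decrement.
have Ax : A x0 by apply: rhoA; rewrite subrr gsq0 sqr_ge0.
have [Ox ux] := Ax; have v0 : 0 < v x0 by rewrite vpos_gt// subr_gt0.
have Iv : v \in_L1 by exact: sqint_L1_fin.
have near_x0 : \forall x \near x0, v x <= 2 * v x0.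
  have /cvgrPdist_lt/(_ _ v0) := cu; apply: filterS => x; rewrite ltr_norml => /andP[ul _].
  have [u1|u1] := ltP 1 (u x); last by rewrite vpos_le ?mulr_ge0 ?(ltW v0).
  by move: ul; rewrite !vpos_gt//; lra.
have mv := mean_value hN oO fO AO Iv (fun x _ => vpos_ge0 u x)
  superharmonic rho0 rhoA Ck0 HC near_x0.
have subO : ball x0 (sig / 2) `<=` Omega.
  by apply: subset_trans ballO; apply: le_ball; move: sig0; lra.
have mB : measurable (ball x0 (sig / 2)) by apply: rV_open_measurable; exact: ball_open.
have volE : \I (\1_(ball x0 (sig / 2))) = sig ^+ N.
  by rewrite (Rintegral_ball oO)// ?divr_gt0//; congr (_ ^+ N); rewrite mulr2n -splitr.
rewrite -volE lerBlDr; apply: (@le_trans _ _ (decr_gain psi +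
    m^-1 * \I (fun x => v x * (gsq (x - x0) <= rho ^+ 2 / 2)%R%:R))); last first.
  by rewrite lerD2l mulrC ler_pM2r ?invr_gt0.
have Iq : (fun x => v x * (gsq (x - x0) <= rho ^+ 2 / 2)%R%:R) \in_L1 by exact: cut_L1.
have Ig := decr_gain_L1 D.
rewrite /decr_gain -RintegralZl// -RintegralD//; last exact: L1Z.
apply: le_Rintegral => //.
- exact: indic_L1.
- by apply: L1D => //; exact: L1Z.
move=> x Ox'; have rhs0 b : 0 <= m^-1 * (v x * (b : bool)%:R).
  by rewrite mulr_ge0 ?invr_ge0 ?(ltW m0)// mulr_ge0 ?vpos_ge0.
have gain0 : 0 <= chi u x * (psi x == v x)%:R by rewrite /chi mulr_ge0.
have [xb|xb] := pselect (ball x0 (sig / 2) x); last first.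
  by rewrite memNset// addr_ge0.
rewrite mem_set//.
have [_ uxx] : A x by apply: rhoA; rewrite (le_trans (ball_half xb))//; have := sqr_ge0 rho; lra.
have zx : z x = 1.
  apply: cutoff_in => // i; move: xb; rewrite rV_ballE// => xb.
  by exact: ltW.
have [vm|vm] := leP (v x) m.
  have -> : psi x = v x.
    rewrite zx mul1r /rescale (vpos_gt uxx) hump_le1; first by rewrite mulrC divfK ?gt_eqF.
    by rewrite ler_pdivrMr// mul1r -(vpos_gt uxx).
  by rewrite eqxx /chi uxx mulr1 lerDl.
rewrite (ball_half xb) mulr1; apply: ler_wpDl => //.
by rewrite mulrC ler_pdivlMr// mul1r ltW.
Qed.

End local_competitor.

(** Finitely many smallness conditions [a * B <= t], each stored as a pair [(a, t)], are met by one
    [B]. *)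
Lemma small_scale (s : seq (R * R)) : (forall x, x \in s -> 0 < x.2) ->
  exists2 B, 0 < B & forall x, x \in s -> x.1 * B <= x.2.
Proof.
elim: s => [_|[a t] s IH pos]; first by exists 1.
have [x xs|B B0 HB] := IH; first by apply: pos; rewrite inE xs orbT.
have t0 : 0 < t by apply: (pos (a, t)); rewrite mem_head.
have [a0|a0] := leP a 0.
  exists B => // x; rewrite inE => /predU1P[->|]; last exact: HB.
  by rewrite (le_trans _ (ltW t0))// mulr_le0_ge0// ltW.
exists (Num.min B (t / a)); first by rewrite lt_min B0 divr_gt0.
have m0 : 0 <= Num.min B (t / a) by rewrite le_min !ltW// divr_gt0.
move=> x; rewrite inE => /predU1P[->|xs] /=.
  by rewrite mulrC -ler_pdivlMr// ge_min lexx orbT.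
have [x0|x0] := leP x.1 0.
  by rewrite (@le_trans _ _ 0) ?mulr_le0_ge0// ltW// pos// inE xs orbT.
by apply: le_trans (HB x xs); rewrite ler_pM2l// ge_min lexx.
Qed.

(** Here [V] is the volume [sig^N] and [B] bounds [(m / sig)^2]. In the product of [Y] with
    [Q + q * k * Y] one factor [B * V] is enough; the other is bounded by [1]. *)
Lemma gain_small (V B CQ c S l k q Q Y : R) : 0 <= V <= 1 -> 0 <= B <= 1 ->
  0 <= CQ -> 0 <= c -> 0 <= S -> 0 < l -> 0 < k -> 0 < q -> 0 <= Q -> 0 <= Y ->
  Q <= CQ * B * V -> Y <= c * B * V ->
  S * (CQ / 2 + 2 * k * c * (CQ + q * k * c) / l) * B <= 4^-1 ->
  S * (Q / 2 + 2 * (k * Y) * (Q + q * k * Y) / l) <= V / 4.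
Proof.
move=> /andP[V0 V1] /andP[B0 B1] C0 c0 S0 l0 k0 q0 Q0 Y0 QV YV small.
have BV : B * V <= 1 by rewrite -[leRHS]mul1r ler_pM.
have BV0 : 0 <= B * V by rewrite mulr_ge0.
have qk : 0 <= q * k by rewrite mulr_ge0 ?ltW.
have E1 : Q + q * k * Y <= CQ + q * k * c.
  apply: lerD.
    by rewrite (le_trans QV)// -mulrA ler_piMr.
  by rewrite ler_wpM2l// (le_trans YV)// -mulrA ler_piMr.
have E2 : 2 * (k * Y) <= 2 * k * c * (B * V).
  by rewrite mulrA -!mulrA !ler_pM2l// mulrA.
have E3 : 2 * (k * Y) * (Q + q * k * Y) / l <= 2 * k * c * (B * V) * (CQ + q * k * c) / l.
  rewrite ler_pM2r ?invr_gt0// ler_pM// ?mulr_ge0 ?(ltW k0)//.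
  by rewrite addr_ge0// mulr_ge0.
have E4 : Q / 2 + 2 * (k * Y) * (Q + q * k * Y) / l <=
    (CQ / 2 + 2 * k * c * (CQ + q * k * c) / l) * (B * V).
  rewrite (_ : _ * (B * V) = CQ * B * V / 2 + 2 * k * c * (B * V) * (CQ + q * k * c) / l).
    by rewrite lerD// ler_pM2r.
  by field; rewrite gt_eqF.
apply: (le_trans (ler_wpM2l S0 E4)); rewrite !mulrA mulrC.
by rewrite ler_wpM2l// -mulrA.
Qed.

Lemma linear_growth : exists2 alpha, 0 < alpha & forall x0 rho,
  0 < rho <= 1 -> (forall x, gsq (x - x0) <= rho ^+ 2 -> above1 Omega u x) ->
  {for x0, continuous u} -> 1 + alpha * rho <= u x0.
Proof.
have [Mc Mc0 HMc] := @partial_cutoff_bounded R N.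
have hump0 (y : R) : y <= 1 -> hump y = 1 * y + 0.
  by move=> y1; rewrite hump_le1// mul1r addr0.
have hump2 (y : R) : 2 <= y -> hump y = 0 * y + 0.
  by move=> y1; rewrite hump_ge2// mul0r addr0.
have [Ch HCh] := smooth1_derive1_bounded smooth1_hump hump0 hump2.
have [Ck Ck0 HCk] := @kernel_bounded R.
have L0 : 0 < nehari_level := nehari_level_gt0.
have eta0 : 0 < gain_eta := gain_eta_gt0.
have N0 : 0 < N%:R :> R by rewrite ltr0n (leq_trans _ hN).
have N1 : 1 <= N%:R :> R by rewrite ler1n (leq_trans _ hN).
pose L := nehari_level; pose eta := gain_eta.
pose E := expR 2 * Ck * 4 ^+ N.
(* Chosen so that, with [m = K * v x0], the term subtracted in [local_gain_ge] is exactly half of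
   [sig^N]. *)
pose K := 4 * E * (2 * N%:R) ^+ N.
pose CQ := (8 + 648 * expR 1 * Ch ^+ 2) * (N%:R * Mc ^+ 2 * 4 ^+ N).
pose c : R := 4 * 4 ^+ N.
have E0 : 0 < E by rewrite /E !mulr_gt0 ?expR_gt0 ?exprn_gt0.
have K0 : 0 < K by rewrite /K; apply: mulr_gt0; [exact: mulr_gt0|rewrite exprn_gt0// mulr_gt0].
have CQ0 : 0 <= CQ.
  apply: mulr_ge0.
    exact: (addr_ge0 (ler0n _ _) (mulr_ge0 (mulr_ge0 (ler0n _ _) (expR_ge0 _)) (sqr_ge0 _))).
  by rewrite !mulr_ge0 ?exprn_ge0 ?(ltW Mc0) ?(ltW N0).
have c0 : 0 <= c by rewrite mulr_ge0 ?exprn_ge0.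
pose S := gain_scale.
have S0 : 0 <= S by exact: sqr_ge0.
(* The first pair gives [2 * m <= 1] and [B <= 1], the next four are the smallness hypotheses of
   [decr_gain_bound], and the last one makes the gain at most [V / 4]. *)
pose s := [:: (4, 1); (CQ, L); (CQ / eta, L / 8); (lambda * c, L / 4);
  (p * kappa * c, L / 2); (S * (CQ / 2 + 2 * kappa * c * (CQ + p * kappa * c) / L), 4^-1)].
have spos (x : R * R) : x \in s -> 0 < x.2.
  have l8 : 0 < L / 8 by rewrite divr_gt0.
  have l4 : 0 < L / 4 by rewrite divr_gt0.
  have l2 : 0 < L / 2 by rewrite divr_gt0.
  by rewrite !inE => /or4P[| | |/or3P[| |]] /eqP ->; rewrite //= ?invr_gt0.
have [B B0 HB] := small_scale spos.
have [[B1 B2] [B3 [B4 [B5 B6]]]] : (4 * B <= 1 /\ CQ * B <= L) /\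
    CQ / eta * B <= L / 8 /\ lambda * c * B <= L / 4 /\ p * kappa * c * B <= L / 2 /\
    S * (CQ / 2 + 2 * kappa * c * (CQ + p * kappa * c) / L) * B <= 4^-1.
  have H a t : (a, t) \in s -> a * B <= t := HB (a, t).
  split; [split|split; [|split; [|split]]]; apply: H;
    by rewrite !inE eqxx ?orbT.
(* With this slope, [v x0 < alpha * rho] means [m < sqrt B * sig], so that [(m / sig)^2 <= B]. *)
exists (Num.sqrt B / (2 * N%:R * K)).
  by rewrite divr_gt0 ?sqrtr_gt0// mulr_gt0// mulr_gt0.
move=> x0 rho /andP[rho0 rho1] rhoA cu.
have [Ox ux] : above1 Omega u x0 by apply: rhoA; rewrite subrr gsq0 sqr_ge0.
have v0 : 0 < vpos u x0 by rewrite vpos_gt// subr_gt0.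
rewrite -lerBrDl -(vpos_gt ux) leNgt; apply/negP => vlt.
pose sig := rho / (2 * N%:R); pose m := K * vpos u x0.
have m0 : 0 < m by exact: mulr_gt0.
have sig0 : 0 < sig by rewrite divr_gt0// mulr_gt0.
have sig1 : sig <= 1 by rewrite ler_pdivrMr ?mulr_gt0//; lra.
have ms : m <= Num.sqrt B * sig.
  rewrite /m /sig mulrC -ler_pdivlMr// ltW//; apply: (lt_le_trans vlt).
  by rewrite le_eqVlt; apply/orP; left; apply/eqP; field; rewrite !gt_eqF.
have m2 : m ^+ 2 <= B * sig ^+ 2.
  rewrite -(sqr_sqrtr (ltW B0)) -exprMn lerXn2r ?nnegrE ?(ltW m0)//.
  by rewrite mulr_ge0 ?sqrtr_ge0 ?ltW.
have m2B : m ^+ 2 <= B.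
  by rewrite (le_trans m2)// ler_piMr ?(ltW B0)// expr_le1 ?(ltW sig0).
have m1 : 2 * m <= 1.
  have m20 : 0 <= 2 * m by apply: mulr_ge0 => //; exact: ltW.
  rewrite -(ler_pXn2r (n := 2)) ?nnegrE//.
  by rewrite exprMn expr1n; lra.
pose V := sig ^+ N.
have V0 : 0 < V by exact: exprn_gt0.
have V1 : V <= 1 by apply: exprn_ile1 => //; exact: ltW.
have volE : (2 * sig *+ 2) ^+ N = 4 ^+ N * V.
  by rewrite -exprMn; congr (_ ^+ N); rewrite -mulr_natl mulrA -natrM.
have D := local_decrement (erefl sig) rho0 rhoA m0 HCh.
have LB := local_bounds (erefl sig) rho0 rhoA m0.
have gain := local_gain_ge (erefl sig) rho0 rhoA m0 HCh Ck0 HCk cu.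
have Qle := local_Q_le (erefl sig) rho0 rhoA m0 HMc HCh.
have Yle := local_Y_le (erefl sig) rho0 rhoA m0 HCh m1.
have Ple := local_P_le (erefl sig) rho0 rhoA m0 HCh.
have bound := decr_gain_bound D
  (fun x _ => (LB x).1) (fun x _ => (LB x).2).
rewrite /= in bound.
have Y0 : 0 <= Rintegral (lebesgue_rV N) Omega (fun x => vpos u x `^ (p - 1) *
    (cutoff x0 sig x * rescale hump 1 m (u x))).
  by apply: Rintegral_ge0 => x _; apply: mulr_ge0; [exact: powR_ge0|exact: (LB x).1].
have Q0 : 0 <= Rintegral (lebesgue_rV N) Omega (fun x =>
    gsq (cgrad (cutoff x0 sig) (rescale hump 1 m) u (grad Omega u) x)).
  by apply: Rintegral_ge0 => x _; exact: gsq_ge0.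
move: bound Qle Yle Ple gain Y0 Q0; rewrite volE -/V -/L -/eta -/S.
move: (Rintegral _ _ _) (Rintegral _ _ _) (Rintegral _ _ _) (decr_gain _).
move=> Y P Q gn bound Qle Yle Ple gain Y0 Q0.
have mB : m ^+ 2 / sig ^+ 2 <= B by rewrite ler_pdivrMr ?exprn_gt0.
have gainE : expR 2 * Ck * 4 ^+ N * rho ^+ N * (2 * vpos u x0) / m = V / 2.
  have -> : rho ^+ N = (2 * N%:R) ^+ N * V.
    by rewrite -exprMn /sig mulrC divfK// gt_eqF// mulr_gt0.
  have n0 : (2 * N%:R) ^+ N != 0 :> R by rewrite expf_neq0// gt_eqF// mulr_gt0.
  rewrite /m /K -/E; move: (vpos u x0) v0 ((2 * N%:R) ^+ N) n0 => w w0 n n0.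
  by field; rewrite n0 !gt_eqF.
have QE : (8 + 648 * expR 1 * Ch ^+ 2) * m ^+ 2 * (N%:R * (Mc / sig) ^+ 2 * (4 ^+ N * V))
    = CQ * (m ^+ 2 / sig ^+ 2) * V.
  rewrite /CQ; move: (8 + 648 * expR 1 * Ch ^+ 2) (4 ^+ N) => a b.
  by field; rewrite gt_eqF.
have YE : 4 * m ^+ 2 * (4 ^+ N * V) = c * m ^+ 2 * V by rewrite /c; ring.
rewrite {}QE in Qle; rewrite {}YE in Yle Ple; rewrite {}gainE in gain.
clear -Qle Yle Ple gain Y0 Q0 bound mB m2B V0 V1 B0 B1 B2 B3 B4 B5 B6 CQ0 c0 S0 L0 eta0 p2
  kappa0 lambda0 hN.
have {}L0 : 0 < L := L0; have {}eta0 : 0 < eta := eta0.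
clearbody L eta CQ c S V m sig.
have pk0 : 0 < p * kappa by rewrite mulr_gt0// (lt_trans _ p2).
have QB : Q <= CQ * B * V.
  by apply: (le_trans Qle); rewrite ler_pM2r// ler_wpM2l.
have YB : Y <= c * B * V.
  by apply: (le_trans Yle); rewrite ler_pM2r// ler_wpM2l.
have PB : P <= c * B * V.
  by apply: (le_trans Ple); rewrite ler_pM2r// ler_wpM2l.
have BV (a : R) : 0 <= a -> a * B * V <= a * B.
  by move=> a0; rewrite ler_piMr// mulr_ge0// ltW.
have cB := BV _ c0; have CB := BV _ CQ0.
have Q1 : Q <= L by lra.
have Q2 : Q / eta <= L / 8.
  by rewrite ler_pdivrMr// (le_trans (le_trans QB CB))// -ler_pdivrMr// mulrAC.
have P1 : lambda * P <= L / 4.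
  by rewrite (le_trans _ B4)// -mulrA ler_pM2l//; lra.
have Y1 : p * kappa * Y <= L / 2.
  by rewrite (le_trans _ B5)// -(mulrA (p * kappa)) ler_pM2l//; lra.
have p0 : 0 < p by rewrite (lt_trans _ p2).
have V01 : 0 <= V <= 1 by rewrite (ltW V0).
have B01 : 0 <= B <= 1 by rewrite (ltW B0)/=; lra.
have {}bound := bound Q1 Q2 P1 Y1.
(* The gain is at most [V / 4], while [gain] says that it is at least [V - V / 2]. *)
have := gain_small V01 B01 CQ0 c0 S0 L0 kappa0 p0 Q0 Y0 QB YB B6.
lra.
Qed.

End minimizer.

(** * Boundary points of the domain *)

Section boundary.
Context {R : realType} {n : nat}.
Variable Omega : set 'rV[R]_n.
Hypothesis oO : open Omega.
Hypothesis fO : (lebesgue_rV n Omega < +oo)%E.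
Local Notation mu := (@lebesgue_rV R n).
Local Notation "f \in_L1" := (mu.-integrable Omega (EFin \o f)) (at level 2).
Local Notation "\I f" := (Rintegral mu Omega f) (at level 10, f at level 9).

Let mO : measurable Omega := rV_open_measurable oO.

Lemma integral_cont_gt0 (f : 'rV[R]_n -> R) x1 : f \in_L1 ->
  (forall x, Omega x -> 0 <= f x) -> {for x1, continuous f} -> Omega x1 -> 0 < f x1 ->
  0 < \I f.
Proof.
move=> If f0 cf Ox1 fx1; have f2 : 0 < f x1 / 2 by rewrite divr_gt0.
have /cvgrPdist_lt/(_ _ f2) := cf => near1.
have /nbhs_ballP[e /= e0 He] : nbhs x1 [set x | Omega x /\ `|f x1 - f x| < f x1 / 2].
  by apply: filterI => //; exact: oO.
apply: (@lt_le_trans _ _ (f x1 / 2 * (e *+ 2) ^+ n)).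
  by rewrite mulr_gt0// exprn_gt0// mulrn_wgt0.
have sub : ball x1 e `<=` Omega by move=> x /He[].
have mB : measurable (ball x1 e) by apply: rV_open_measurable; exact: ball_open.
rewrite -(Rintegral_ball oO e0 sub) -RintegralZl//; last exact: indic_L1.
apply: le_Rintegral => //; first by apply: L1Z => //; exact: indic_L1.
move=> x Ox; have [xb|xb] := pselect (ball x1 e x); last first.
  by rewrite memNset// mulr0 f0.
rewrite mem_set// mulr1; have [_] := He x xb.
by rewrite ltr_norml => /andP[_]; lra.
Qed.

(** Take [t] with [t 0 = 0] and [t = 1] on [[1, +oo[]. Where [phi] or its derivative is nonzero,
    [t (u)] is [1] and [derive1 t (u)] is [0]; integrating by parts with [W0_ibp] produces no
    boundary term, although [phi] need not vanish on the boundary of [Omega]. *)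
Lemma integral_partial_plateau u g phi i : W0 Omega u g -> test_function setT phi ->
  (forall x, Omega x -> phi x != 0 \/ partial i phi x != 0 -> 1 < u x) ->
  \I (partial i phi) = 0.
Proof.
move=> W tphi u1.
pose t (s : R) := 1 - step (2 * s).
have st : smooth1 t.
  apply: (smooth1_ext (f := fun s => 1 + -1 * step (2 * s + 0))).
    by move=> s; rewrite /t mulN1r addr0.
  apply: smooth1D; first exact: smooth1_cst.
  apply: smooth1M; first exact: smooth1_cst.
  exact: smooth1_comp smooth1_step (smooth1_affine _ _).
have tl (s : R) : s <= 2^-1 -> t s = 0 * s + 0.
  by move=> sl; rewrite /t step_le1; [ring|lra].
have tr (s : R) : 1 <= s -> t s = 0 * s + 1.
  by move=> sr; rewrite /t step_ge2; [ring|lra].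
have [C HC] := smooth1_derive1_bounded st tl tr.
have [C2 HC2] := smooth1_derive2_bounded st tl tr.
have dt s : 1 < s -> derive1 t s = 0 by move=> s1; exact: (derive1_gt tr).
have t0 : t 0 = 0 by rewrite tl// mul0r addr0.
have p1 j x : partial j (fun _ : 'rV[R]_n => 1 : R) x = 0.
  by apply: partialE; exact: is_derive_cst.
have Wt := @W0_chain _ _ _ oO fO u g t (fun=> 1) C C2 1 W st t0 HC HC2 (smooth_cst 1) _ _.
have {Wt} Wt := Wt (fun=> eq_ind_r (fun y => y <= 1) (lexx _) (normr1 _)) _.
have {}Wt := Wt (fun j x => eq_ind_r (fun y => `|y| <= 1) (eq_ind_r (fun y => y <= 1) ler01 (normr0 _)) (p1 j x)).
have := W0_ibp oO fO i Wt tphi; rewrite /ip.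
have -> : \I (fun x => 1 * t (u x) * partial i phi x) = \I (partial i phi).
  apply: eq_Rintegral => x; rewrite inE => Ox.
  suff : 1 * t (u x) * partial i phi x = partial i phi x by [].
  have [->|d0] := eqVneq (partial i phi x) 0; first by rewrite mulr0.
  by rewrite tr; [ring|apply: ltW; apply: u1 => //; right].
move=> ->; apply/eqP; rewrite oppr_eq0; apply/eqP.
rewrite /Rintegral integral0_eq// => x Ox; rewrite mxE p1 mul0r add0r mul1r.
have [->|nz] := eqVneq (phi x) 0; first by rewrite mulr0.
by rewrite dt ?mul0r//; apply: u1 => //; left.
Qed.

(* Otherwise a function of [u] would be constant in [Omega] near [p], and the
   indicator of [Omega] would have zero gradient there. The test function [psi]
   is decreasing across the boundary along the direction pointing into [Omega]. *)
Lemma boundary_point_below u g p i b (gamma : 'rV[R]_n.-1 -> R) : W0 Omega u g ->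
  ~ Omega p -> closure Omega p -> continuous gamma ->
  (\forall x \near p, Omega x <-> gamma (col' i x) < (-1) ^+ b * x 0 i) ->
  ~ (\forall x \near p, Omega x -> 1 < u x).
Proof.
move=> W nOp cOp cgamma chart u1.
have : \forall x \near p, (Omega x <-> gamma (col' i x) < (-1) ^+ b * x 0 i) /\
    (Omega x -> 1 < u x) by exact: filterI chart u1.
move=> /nbhs_ballP[d /= d0 Hd].
pose s : R := (-1) ^+ b; have s2 : s * s = 1 by rewrite -expr2 sqrr_sign.
have sN (y : R) : `|s * y| = `|y| by rewrite normrM normr_sign mul1r.
pose t := d / 8; have t0 : 0 < t by rewrite divr_gt0.
have tE : t = d / 8 by [].
clearbody t.
have gp : s * p 0 i <= gamma (col' i p).
  rewrite leNgt; apply/negP => lt; apply: nOp; apply/(Hd p (ballxx _ d0)).1; exact: lt.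
have /cvgrPdist_lt/(_ _ t0)/nbhs_ballP[e /= e0 He] := cgamma (col' i p).
pose w := Num.min (e / 2) (d / 2).
have w0 : 0 < w by rewrite lt_min !divr_gt0.
(* The centre of [f1] is moved by [t] out of [Omega]. As [gamma] varies by less than [t], every
   point of [Omega] in the cylinder lies on the inner side of [q], where [f1] does not increase in
   the inward direction. The half-width [2 * t] reaches past [p] and stays within [3 * t <= d / 2]
   of it. *)
pose q := p 0 i - s * t.
pose f1 (y : R) := flat1 (1 - ((2 * t) ^- 2) * ((y - q) * (y - q))).
pose f (j : 'I_n) (y : R) := if j == i then f1 y else bump ((y - p 0 j) / w).
have sf1 : smooth1 f1.
  have := smooth1_comp (smooth1_lin_comp ((2 * t) ^- 2) smooth1_flat1)
    (smooth1M (smooth1_affine 1 (- q)) (smooth1_affine 1 (- q))).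
  by apply: smooth1_ext => y; rewrite /f1 !mul1r.
have sf j : smooth1 (f j).
  rewrite /f; case: eqP => // _; exact: smooth1_affine_comp smooth1_bump.
have df1 y : derive1 f1 y = - (2 * (y - q) * (2 * t) ^- 2 * kernel ((2 * t) ^- 2 * ((y - q) * (y - q)))).
  rewrite derive1E; apply: derive_val.
  have D1 : is_derive y (1 : R) (fun z : R => 1 - (2 * t) ^- 2 * ((z - q) * (z - q)))
      (- (2 * (y - q) * (2 * t) ^- 2)).
    have D2 := is_deriveB (is_derive_id y (1 : R)) (is_derive_cst q y (1 : R)).
    apply: is_derive_val (is_deriveB (is_derive_cst (1 : R) y 1)
      (is_deriveZ ((2 * t) ^- 2) (is_deriveM D2 D2))) _ _ => //.
    by rewrite /GRing.scale/= !fctE; ring.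
  have D3 := @is_derive1_comp _ flat1 _ y _ _ (is_derive_flat1 _) D1.
  by apply: is_derive_val D3 _ _ => //; rewrite mulrN mulrC.
have fi : f i = f1 by apply/funext => y; rewrite /f eqxx.
have c0 : 0 < (2 * t) ^- 2 by rewrite invr_gt0 exprn_gt0// mulr_gt0.
have f_ge0 j y : 0 <= f j y.
  by rewrite /f; case: eqP => _; [exact: flat1_ge0|exact: bump_ge0].
pose psi := tensor f.
have psi_out x : ~ ccube p (d / 2) x -> psi x = 0.
  move=> /existsNP[j /negP]; rewrite -ltNge => xj; rewrite /psi /tensor (bigD1 j)//=.
  rewrite /f; case: eqP => [ji|_]; last first.
    rewrite bump_out ?mul0r// normrM normfV (gtr0_norm w0) ler_pdivlMr// mul1r.
    by rewrite (le_trans _ (ltW xj))// ge_min lexx orbT.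
  rewrite /f1 flat1_le0 ?mul0r// subr_le0 -expr2 mulrC ler_pdivlMr ?exprn_gt0 ?mulr_gt0// mul1r.
  rewrite -[leRHS]real_normK ?num_real// lerXn2r ?nnegrE ?mulr_ge0 ?(ltW t0)//.
  have : `|x 0 j - p 0 j| <= `|x 0 j - q| + t.
    have -> : x 0 j - p 0 j = (x 0 j - q) + - (s * t) by rewrite ji /q; ring.
    by rewrite (le_trans (ler_normD _ _))// normrN sN (gtr0_norm t0).
  by move: xj; rewrite tE; lra.
have tpsi : test_function (ball p d) psi.
  apply: (test_function_supp (smooth_tensor sf) (@compact_ccube _ _ p (d / 2))) => //.
  by move=> x xc; rewrite rV_ballE// => j; apply: le_lt_trans (xc j) _; lra.
have I0 : \I (partial i psi) = 0.
  apply: (integral_partial_plateau W (test_function_sub (fun _ _ => I) tpsi)).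
  move=> x Ox nz; have [|xb] := pselect (ball p d x); first by move=> /Hd[_]; exact.
  case: nz; first by rewrite (test_function_out tpsi xb) eqxx.
  by rewrite (test_function_out (test_function_partial i tpsi) xb) eqxx.
have above x : Omega x -> (forall j, j != i -> `|x 0 j - p 0 j| < w) ->
    ball p d x -> 0 < s * (x 0 i - q).
  move=> Ox xw xb; have gx := (Hd x xb).1.1 Ox.
  have : `|gamma (col' i p) - gamma (col' i x)| < t.
    apply: He; rewrite rV_ballE// => k; rewrite !mxE.
    apply: (lt_le_trans (xw _ _)); first by rewrite eq_sym neq_lift.
    by rewrite ge_min; apply/orP; left; lra.
  rewrite ltr_norml => /andP[_ gt].
  have -> : s * (x 0 i - q) = s * x 0 i - s * p 0 i + s * s * t by rewrite /q; ring.
  by rewrite s2; move: gp gx; rewrite -/s; lra.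
have prod_ge0 (x : 'rV[R]_n) : 0 <= \prod_(j < n | j != i) f j (x 0 j) by exact: prodr_ge0.
have psi_partial x : - s * partial i psi x = 2 * (s * (x 0 i - q)) * (2 * t) ^- 2 *
    (kernel ((2 * t) ^- 2 * ((x 0 i - q) * (x 0 i - q))) * \prod_(j < n | j != i) f j (x 0 j)).
  by rewrite partial_tensor// fi df1; ring.
have psi1 x : Omega x -> 0 <= - s * partial i psi x.
  move=> Ox; have [xb|xb] := pselect (ball p d x); last first.
    by rewrite (test_function_out (test_function_partial i tpsi) xb) mulr0.
  rewrite psi_partial; have [xw|] := pselect (forall j, j != i -> `|x 0 j - p 0 j| < w).
    apply: mulr_ge0; last by apply: mulr_ge0 => //; exact: kernel_ge0.
    apply: mulr_ge0; last exact: ltW.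
    by apply: mulr_ge0 => //; exact: ltW (above x Ox xw xb).
  move=> /existsNP[j /not_implyP[ji /negP]]; rewrite -leNgt => xj.
  rewrite (bigD1 j)//= {1}/f (negbTE ji) bump_out ?mul0r ?mulr0//.
  by rewrite normrM normfV (gtr0_norm w0) ler_pdivlMr// mul1r.
(* At a point of [Omega] close enough to [p] the transversal bumps equal [1], and its height differs
   from [q] by less than [2 * t], so the kernel is positive. *)
have [x1 [Ox1 px1]] : exists x1, Omega x1 /\ 0 < - s * partial i psi x1.
  have r0 : 0 < Num.min (w / 2) t by rewrite lt_min divr_gt0.
  have [x1 [Ox1 x1b]] := cOp _ (nbhsx_ballx p _ r0); exists x1; split=> //.
  move: x1b; rewrite rV_ballE// => x1b.
  have xw j : `|x1 0 j - p 0 j| < w / 2 by apply: (lt_le_trans (x1b j)); rewrite ge_min lexx.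
  have xt : `|x1 0 i - p 0 i| < t by apply: (lt_le_trans (x1b i)); rewrite ge_min lexx orbT.
  have xb : ball p d x1.
    rewrite rV_ballE// => j; apply: (lt_trans (xw j)).
    have : w <= d / 2 by rewrite ge_min lexx orbT.
    by move: d0; lra.
  have xw1 j : j != i -> `|x1 0 j - p 0 j| < w.
    by move=> _; apply: (lt_trans (xw j)); move: w0; lra.
  have sx := above x1 Ox1 xw1 xb.
  rewrite psi_partial big1 => [|j ji]; last first.
    rewrite /f (negbTE ji) bump_in// normrM normfV (gtr0_norm w0) ler_pdivrMr//.
    by rewrite mulrC ltW.
  rewrite mulr1; apply: mulr_gt0; first by apply: mulr_gt0 => //; exact: mulr_gt0.
  apply: kernel_gt0.
  rewrite -expr2 mulrC ltr_pdivrMr ?exprn_gt0 ?mulr_gt0// mul1r.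
  rewrite -[ltLHS]real_normK ?num_real// ltrXn2r ?nnegrE ?mulr_ge0 ?(ltW t0)//.
  rewrite (_ : x1 0 i - q = (x1 0 i - p 0 i) + s * t); last by rewrite /q; ring.
  by rewrite (le_lt_trans (ler_normD _ _))// sN (gtr0_norm t0); move: xt; lra.
have spsi : smooth (partial i psi) by apply: smooth_partial; exact: smooth_tensor.
have Ip : (partial i psi) \in_L1.
  apply: sqint_L1_fin => //; apply: (test_sqint oO fO (A := ball p d)).
  exact: test_function_partial.
suff : 0 < \I (fun x => - s * partial i psi x) by rewrite RintegralZl// I0 mulr0 ltxx.
apply: integral_cont_gt0 px1 => //; first exact: L1Z.
by apply: rV_continuousM; [exact: rV_continuous_cst|exact: smooth_continuous].
Qed.

End boundary.

(** * From the distance to [{u <= 1}] to a ball inside [{u > 1}] *)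

Section assembly.
Context {R : realType} {N : nat}.
Implicit Types (x y : 'rV[R]_N) (Omega : set 'rV[R]_N).

Lemma gsqBC x y : gsq (x - y) = gsq (y - x).
Proof. by rewrite -opprB -scaleN1r gsqZ sqrrN expr1n mul1r. Qed.

(** First exit of the segment from [x0] to [y]: openness puts the exit point outside [Omega], and
    the points just before it put it in the closure. *)
Lemma segment_boundary Omega x0 y : open Omega -> Omega x0 -> ~ Omega y ->
  exists p, [/\ ~ Omega p, closure Omega p & gsq (p - x0) <= gsq (y - x0)].
Proof.
move=> oO Ox0 nOy; pose f (t : R) := t *: (y - x0) + x0.
have cf : continuous f.
  move=> t; apply: (@cvgD _ _ _ _ _ (fun s : R => s *: (y - x0)) (fun=> x0)).
    exact: scalel_continuous.
  exact: cvg_cst.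
pose S := [set t : R | 0 <= t /\ ~ Omega (f t)].
have S1 : S 1 by split=> //; rewrite /f scale1r subrK.
have lbS : has_lbound S by exists 0 => t [].
have infS : has_inf S by split; [exists 1|].
have t1 : inf S <= 1 by exact: ge_inf.
have t0 : 0 <= inf S by apply: lb_le_inf; [exists 1|move=> t []].
have ball_f t (B : set 'rV[R]_N) : nbhs (f t) B ->
    exists2 e : R, 0 < e & forall s, `|t - s| < e -> B (f s).
  by move=> /cf/nbhs_ballP[e /= e0 He]; exists e.
have nOp : ~ Omega (f (inf S)).
  move=> Op; have [e e0 He] := ball_f _ _ (oO _ Op).
  have [t [t_ge nOt] lt] := inf_adherent e0 infS.
  have le : inf S <= t by apply: ge_inf.
  by apply: nOt; apply: He; rewrite distrC ger0_norm ?subr_ge0//; lra.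
have t00 : 0 < inf S.
  by rewrite lt_def t0 andbT; apply/eqP => E; apply: nOp; rewrite E /f scale0r add0r.
exists (f (inf S)); split=> //.
  move=> B /ball_f[e e0 He].
  pose d := Num.min (e / 2) (inf S).
  have d0 : 0 < d by rewrite lt_min t00 divr_gt0.
  exists (f (inf S - d)); split; last first.
    apply: He; rewrite subKr gtr0_norm// (@le_lt_trans _ _ (e / 2)) ?ge_min ?lexx//; lra.
  apply: contrapT => nO; have : inf S <= inf S - d.
    by apply: ge_inf => //; split=> //; rewrite subr_ge0 ge_min lexx orbT.
  by lra.
rewrite /f addrK gsqZ -[leRHS]mul1r ler_wpM2r ?gsq_ge0//.
by rewrite expr_le1.
Qed.

Lemma locally_lipschitz_continuous Omega (u : 'rV[R]_N -> R) x : open Omega ->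
  [locally [lipschitz u y | y in Omega]] -> Omega x -> {for x, continuous u}.
Proof.
move=> oO lip Ox; have [M [Mr HM]] := lip (x, x) (conj Ox Ox).
pose K := `|M| + 1; have K0 : 0 < K by rewrite ltr_wpDl.
have MK : M < K by rewrite (le_lt_trans (ler_norm _))// ltrDl.
have [[A B] [/= nA nB] AB] := HM K MK.
have FF : Filter (nbhs x) := nbhs_filter x.
apply/cvgrPdist_lt => e e0; have eK : 0 < e / K by rewrite divr_gt0.
have : \forall y \near x, [/\ A y, Omega y & `|x - y| < e / K].
  near=> y; split; near: y => //; first exact: oO.
  by have := nbhsx_ballx x _ eK; apply: filterS => y; rewrite -ball_normE.
apply: filterS => y [Ay Oy xy].
have := AB (y, x) (conj Ay (nbhs_singleton nB)) (conj Oy Ox) => /=.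
rewrite distrC => /le_lt_trans; apply; rewrite distrC.
by rewrite mulrC -ltr_pdivlMr.
Unshelve. all: by end_near. Qed.

Lemma eucl_dist_lt Omega (u : 'rV[R]_N -> R) x0 x : 0 < eucl_dist x0 (below1 Omega u) ->
  gsq (x - x0) < eucl_dist x0 (below1 Omega u) ^+ 2 -> Omega x -> 1 < u x.
Proof.
set r := eucl_dist _ _ => r0 xr Ox; rewrite ltNge; apply/negP => ux.
have : r <= eucl_norm (x0 - x).
  apply: ge_inf; last by exists x.
  by exists 0 => _ [y _ <-]; exact: sqrtr_ge0.
apply/negP; rewrite -ltNge /eucl_norm -/(gsq _) gsqBC.
by rewrite -[ltRHS](ger0_norm (ltW r0)) -sqrtr_sqr ltr_sqrt// exprn_gt0.
Qed.

End assembly.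

Theorem theorem1p1 (R : realType) (N : nat) (hN : (3 <= N)%N)
  (Omega : set 'rV[R]_N) (hOmega : bounded_domain Omega)
  (hC2 : C2_boundary Omega)
  (lambda kappa : R) (hlambda : 0 < lambda) (hkappa : 0 < kappa)
  (u : 'rV[R]_N -> R) (hu : Nehari Omega lambda kappa u)
  (hlip : [locally [lipschitz u x | x in Omega]])
  (hmin : J Omega lambda kappa u =
    ereal_inf [set J Omega lambda kappa v | v in Nehari Omega lambda kappa]) :
  exists r0 c : R, [/\ 0 < r0, 0 < c &
    forall x0, above1 Omega u x0 ->
      let r := eucl_dist x0 (below1 Omega u) in
      r <= r0 -> 1 + c * r <= u x0].
Proof.
have [oO _ _ bO] := hOmega.
have fO := bounded_finite_measure (rV_open_measurable oO) bO.
have [alpha alpha0 growth] := linear_growth hN oO fO hlambda hkappa hu hmin.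
(* [linear_growth] requires a closed ball of radius at most [1], while the open ball of radius [r]
   is what is known to lie in [{u > 1}]; it is applied to [r / 2]. *)
exists 2, (alpha / 2); split; [exact: ltr0n|exact: divr_gt0|].
(* The case [r <= 0] includes an empty [below1], for which [inf] takes the default value [0]; the
   claim then follows from [u x0 > 1]. *)
move=> x0 [Ox0 ux0] r r2; have [r0|r0] := leP r 0.
  by rewrite (le_trans _ (ltW ux0))// gerDl mulr_ge0_le0// divr_ge0 ?ltW.
have near1 x : gsq (x - x0) < r ^+ 2 -> Omega x -> 1 < u x by exact: eucl_dist_lt.
have inO x : gsq (x - x0) < r ^+ 2 -> Omega x.
  move=> xr; apply: contrapT => nOx.
  have [p [nOp cOp px]] := segment_boundary oO Ox0 nOx.
  have [|i [b [gamma [Cgamma chart]]]] := hC2 p; first by split=> // /interior_subset.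
  apply: (boundary_point_below oO fO (H10_W0 oO fO (let: And3 H _ _ := hu in H))
    nOp cOp (Ck_continuous Cgamma) chart).
  have cq := @smooth_continuous _ _ _ (@smooth_gsqB R N x0) p.
  have : \forall y \near p, gsq (y - x0) < r ^+ 2.
    exact: (cq [set z | z < r ^+ 2] (lt_nbhsl (le_lt_trans px xr))).
  by apply: filterS => y; exact: near1.
rewrite (_ : alpha / 2 * r = alpha * (r / 2)); last by ring.
apply: growth => [|x xr|].
- by rewrite divr_gt0//= ler_pdivrMr// mul1r.
- have xr' : gsq (x - x0) < r ^+ 2.
    by rewrite (le_lt_trans xr)// ltrXn2r ?nnegrE ?divr_ge0 ?(ltW r0)// ltr_pdivrMr// ltr_pMr// ltr1n.
  by have Ox := inO x xr'; split=> //; exact: near1.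
- exact: (locally_lipschitz_continuous oO hlip Ox0).
Qed.
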